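(* For $m\in\mathbb{N}$, $N\in\{0,1,2,\ldots\}$, and $p\in[1,\infty]$, $$\mathcal{C}_0\left(E_{1,m}\cap L_p(\mathbb{R}^m),L_p(\mathbb{R}^m),\Delta^N\right)=\left(\frac{2}{|S^{m-1}|_{m-1}}\right)^{1/p}\mathcal{C}_0\left(E_{1,1,e}\cap L_{p,|t|^{m-1}}(\mathbb{R}),\,L_{p,|t|^{m-1}}(\mathbb{R}),\,(Be_{m/2-1})^N\right).$$
   Context: Sharp constant: for a space $\mathcal{B}\ne\{0\}$ of functions on $\Omega$ lying in a (quasi)normed function space $F(\Omega)$, a linear operator $D$ on $\mathcal{B}$, and $a\in\Omega$, $\mathcal{C}_a(\mathcal{B},F(\Omega),D):=\sup_{f\in\mathcal{B}\setminus\{0\}}|D(f)(a)|/\|f\|_{F(\Omega)}$. An entire function $f:\mathbb{C}^m\to\mathbb{C}$ has spherical type $\sigma>0$ if for any $\varepsilon>0$ there is a constant $C_0(\varepsilon,f)$ with $|f(z)|\le C_0(\varepsilon,f)\exp(\sigma(1+\varepsilon)|z|)$ for all $z\in\mathbb{C}^m$, where $|z|=(\sum_j|z_j|^2)^{1/2}$. $E_{\sigma,m}$ is the set of all such functions, identified with their restrictions to $\mathbb{R}^m$; $E_{\sigma,1,e}$ is the set of even functions in $E_{\sigma,1}$. $L_p(\mathbb{R}^m)$ is the usual complex $L_p$ space. For a weight $\mu\ge0$ on $\Omega_1\subseteq\mathbb{R}$, $\|f\|_{L_{p,\mu(t)}(\Omega_1)}=\left(\int_{\Omega_1}|f(t)|^p\mu(t)\,dt\right)^{1/p}$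 for $0<p<\infty$, and $\|f\|_{L_{\infty,\mu(t)}(\Omega_1)}=\operatorname{ess\,sup}_{\Omega_1}|f|$. $|S^{m-1}|_{m-1}=2\pi^{m/2}/\Gamma(m/2)$ for $m\ge2$ and $|S^0|_0=2$. $1/p:=0$ for $p=\infty$. $\Delta=\sum_{j=1}^m\partial^2/\partial x_j^2$ is the Laplace operator. The Bessel operator is $Be_\nu(\varphi)(r)=\varphi''(r)+\frac{2\nu+1}{r}\varphi'(r)$, $\nu\ge-1/2$, with $Be_\nu(\varphi)(0):=\lim_{r\to0}Be_\nu(\varphi)(r)$. For $N=0$, $\Delta^N$ and $(Be_\nu)^N$ are the identity (imbedding) operators. *)

(* Defs.v *)
From HB Require Import structures.
From mathcomp Require Import all_boot all_order all_algebra.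
From mathcomp Require Import all_classical all_reals all_analysis.
From mathcomp Require Import complex.
Set Implicit Arguments.
Unset Strict Implicit.
Unset Printing Implicit Defensive.
Import Order.TTheory GRing.Theory Num.Theory.
Import numFieldNormedType.Exports.
Import ComplexField.Normc.
Local Open Scope classical_set_scope.
Local Open Scope ring_scope.
Local Open Scope complex_scope.

(* [R[i]] is the field of complex numbers, [complex.Re] and [complex.Im] are
   the real coordinates, and [normc : R[i] -> R] is the modulus. *)

(* Lebesgue measure on R^n, carried by [n.-tuple R] with its product
   sigma-algebra, as the iterated product of [lebesgue_measure]. *)
Section lebesgue_tuple.
Context {R : realType}.
Local Notation T := (measurableTypeR R).

Definition tcons n (x : T * n.-tuple T) : n.+1.-tuple T :=
  [the n.+1.-tuple T of x.1 :: x.2].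

Definition tuncons n (t : n.+1.-tuple T) : T * n.-tuple T :=
  (thead t, [tuple of behead t]).

Lemma measurable_tcons n : measurable_fun [set: T * n.-tuple T] (@tcons n).
Proof. exact: measurable_cons. Qed.

Lemma measurable_tuncons n : measurable_fun [set: n.+1.-tuple T] (@tuncons n).
Proof.
apply: measurable_fun_pair; last exact: measurable_behead.
exact: (measurable_tnth ord0).
Qed.

Lemma tunconsK n : cancel (@tuncons n) (@tcons n).
Proof. by move=> t; rewrite /tcons /= [RHS]tuple_eta. Qed.

Lemma tconsK n : cancel (@tcons n) (@tuncons n).
Proof.
by case=> x t; rewrite /tuncons /tcons /= theadE; congr pair; apply: val_inj.
Qed.

Definition lebesgue_tuple0 : set (0.-tuple T) -> \bar R := \d_[tuple].

HB.instance Definition _ := Measure.on lebesgue_tuple0.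

Lemma lebesgue_tuple0_sigma_finite : sigma_finite setT lebesgue_tuple0.
Proof.
exists (fun=> setT); first by rewrite bigcup_const.
by move=> _; split=> //; rewrite /lebesgue_tuple0 diracE ltry.
Qed.

HB.instance Definition _ := Measure_isSigmaFinite.Build _ _ _
  lebesgue_tuple0 lebesgue_tuple0_sigma_finite.

Section step.
Variables (n : nat) (mu : {sigma_finite_measure set (n.-tuple T) -> \bar R}).

Definition lebesgue_tupleS : set (n.+1.-tuple T) -> \bar R :=
  pushforward (lebesgue_measure \x mu)%E (@tcons n).

Let pm : {measure set (n.+1.-tuple T) -> \bar R} :=
  measure_function_pushforward__canonical__measure_function_Measure
    (lebesgue_measure \x mu)%E (measurable_tcons (n:=n)).

HB.instance Definition _ := isMeasure.Build _ _ _ lebesgue_tupleS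
  (measure0 pm) (measure_ge0 pm) (@measure_semi_sigma_additive _ _ _ pm).

Lemma lebesgue_tupleS_sigma_finite : sigma_finite setT lebesgue_tupleS.
Proof.
have /sigma_finiteP[F [FT ndF Foo]] :=
  sigma_finiteT (lebesgue_measure : {sigma_finite_measure set T -> \bar R}).
have /sigma_finiteP[G [GT ndG Goo]] := sigma_finiteT mu.
exists (fun k => @tuncons n @^-1` (F k `*` G k)).
  rewrite -preimage_bigcup (_ : \bigcup_k _ = setT) ?preimage_setT//.
  apply/seteqP; split=> // -[x t] _.
  have [i _ Fx] : (\bigcup_k F k) x by rewrite -FT.
  have [j _ Gt] : (\bigcup_k G k) t by rewrite -GT.
  exists (maxn i j) => //; split=> /=.
    by move: x Fx; exact/subsetPset/ndF/leq_maxl.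
  by move: t Gt; exact/subsetPset/ndG/leq_maxr.
move=> k; have [mF Fk] := Foo k; have [mG Gk] := Goo k; split.
  by rewrite -[_ @^-1` _]setTI; apply: measurable_tuncons => //; exact: measurableX.
rewrite /lebesgue_tupleS /pushforward -comp_preimage.
rewrite (_ : _ \o _ = id) ?preimage_id; last first.
  by apply/funext => x /=; rewrite tconsK.
by rewrite product_measure1E// lte_mul_pinfty// ge0_fin_numE.
Qed.

HB.instance Definition _ := Measure_isSigmaFinite.Build _ _ _
  lebesgue_tupleS lebesgue_tupleS_sigma_finite.

End step.

Fixpoint lebesgue_tuple n : {sigma_finite_measure set (n.-tuple T) -> \bar R} :=
  match n with
  | 0 => lebesgue_tuple0
  | k.+1 => lebesgue_tupleS (lebesgue_tuple k)
  end.

Lemma lebesgue_tuple_box n (A : 'I_n -> set T) :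
  (forall i, measurable (A i)) ->
  lebesgue_tuple n [set t | forall i, A i (tnth t i)] =
  (\prod_(i < n) lebesgue_measure (A i))%E.
Proof.
elim: n A => [|n IHn] A mA.
  rewrite big_ord0 /= /lebesgue_tuple0 diracE mem_set//.
  by move=> [].
rewrite big_ord_recl -IHn; last by move=> i; exact: mA.
rewrite /= /lebesgue_tupleS /pushforward -product_measure1E//; last first.
  rewrite (_ : [set t | _] =
      \bigcap_(i in [set: 'I_n]) ((@tnth n T)^~ i @^-1` A (lift ord0 i))).
    apply: fin_bigcap_measurable => // i _.
    by rewrite -[_ @^-1` _]setTI; exact: measurable_tnth.
  by apply/seteqP; split=> t /= tA i; [move=> _|]; apply: tA.
congr (_ _); apply/seteqP; split=> -[x t] /=.
  move=> xtA; split; first exact: (xtA ord0).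
  by move=> i; have := xtA (lift ord0 i); rewrite tnthS.
move=> [xA tA] i; case: (unliftP ord0 i) => [j ->|->]; last exact: xA.
by rewrite tnthS; exact: tA.
Qed.

End lebesgue_tuple.

Section definitions.
Context {R : realType}.

(* The quotients make sense when [N] is finite and nonzero on the nonzero
   elements of [B]. *)
Definition sharp_constant (Omega : Type) (B : set (Omega -> R[i]))
    (N : (Omega -> R[i]) -> \bar R)
    (D : (Omega -> R[i]) -> Omega -> R[i]) (a : Omega) : \bar R :=
  ereal_sup [set ((normc (D f a))%:E / N f)%E | f in (B `\ cst 0)].

Definition entire m (F : 'rV[R[i]]_m -> R[i]) : Prop :=
  forall z, differentiable (F : 'rV[R[i]^o]_m -> R[i]^o) z.

Definition cnorm2 m (z : 'rV[R[i]]_m) : R :=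
  Num.sqrt (\sum_(j < m) normc (z 0 j) ^+ 2).

Definition spherical_type (sigma : R) m (F : 'rV[R[i]]_m -> R[i]) : Prop :=
  forall eps : R, 0 < eps -> exists C0 : R, forall z,
    normc (F z) <= C0 * expR (sigma * (1 + eps) * cnorm2 z).

(* The entire functions of spherical type [sigma], as functions on R^m. *)
Definition exp_type (sigma : R) m : set ('rV[R]_m -> R[i]) :=
  [set f | exists F : 'rV[R[i]]_m -> R[i],
    [/\ entire F, spherical_type sigma F &
        forall x, f x = F (map_mx (real_complex R) x)]].

Definition exp_type1_even (sigma : R) : set (R -> R[i]) :=
  [set f | exp_type sigma (fun x : 'rV[R]_1 => f (x 0 0)) /\
           forall t, f (- t) = f t].

Definition cmeasurable d (T : measurableType d) (f : T -> R[i]) : Prop :=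
  measurable_fun setT (fun x => complex.Re (f x)) /\
  measurable_fun setT (fun x => complex.Im (f x)).

Definition on_tuple m (f : 'rV[R]_m -> R[i])
    (t : m.-tuple (measurableTypeR R)) : R[i] :=
  f (\row_j tnth t j).

Definition Lp_norm m (p : \bar R) (f : 'rV[R]_m -> R[i]) : \bar R :=
  ('N[lebesgue_tuple m]_p[(fun t => (normc (on_tuple f t))%:E)])%E.

Definition Lp_space m (p : \bar R) : set ('rV[R]_m -> R[i]) :=
  [set f | cmeasurable (on_tuple f) /\ (Lp_norm p f < +oo)%E].

(* For [p = +oo] the weight does not enter the norm. *)
Definition wLp_norm (p : \bar R) (w : R -> R) (f : R -> R[i]) : \bar R :=
  match p with
  | r%:E => ((\int[lebesgue_measure]_t (normc (f t) `^ r * w t)%:E) `^ r^-1)%E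
  | _ => ('N[lebesgue_measure]_p[(fun t => (normc (f t))%:E)])%E
  end.

Definition wLp_space (p : \bar R) (w : R -> R) : set (R -> R[i]) :=
  [set f | cmeasurable (f : measurableTypeR R -> R[i]) /\
           (wLp_norm p w f < +oo)%E].

Definition cderive (V : normedModType R) (v : V) (f : V -> R[i]) (x : V) : R[i] :=
  'D_v (fun y => complex.Re (f y)) x +i* 'D_v (fun y => complex.Im (f y)) x.

Definition laplacian m (f : 'rV[R]_m -> R[i]) (x : 'rV[R]_m) : R[i] :=
  \sum_(j < m) cderive (delta_mx 0 j) (cderive (delta_mx 0 j) f) x.

Definition bessel_away (nu : R) (f : R -> R[i]) (r : R) : R[i] :=
  cderive (1 : R) (cderive (1 : R) f) r + ((2 * nu + 1) / r)%:C * cderive (1 : R) f r.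

Definition bessel (nu : R) (f : R -> R[i]) (r : R) : R[i] :=
  if r == 0 then
    lim (complex.Re (bessel_away nu f s) @[s --> (0 : R)^']) +i*
    lim (complex.Im (bessel_away nu f s) @[s --> (0 : R)^'])
  else bessel_away nu f r.

Definition Gamma (s : R) : R :=
  \int[lebesgue_measure]_(t in `]0, +oo[) (t `^ (s - 1) * expR (- t)).

(* The measure of the unit sphere of R^m. *)
Definition sphere_area (m : nat) : R :=
  if m == 1%N then 2 else 2 * pi `^ (m%:R / 2) / Gamma (m%:R / 2).

Definition inv_exponent (p : \bar R) : R := if p is r%:E then r^-1 else 0.

End definitions.

Arguments exp_type {R} sigma m.
Arguments laplacian {R m} f x.
Arguments bessel {R} nu f r.
Arguments sphere_area R m : clear implicits.

(* Main.v *)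
(** The two extremal problems are matched function by function. The spherical mean
    [A f r = pi^(-m/2) \int exp(-|y|^2) f (r y / |y|) dy] of a function of exponential type
    is an even function of exponential type. The Euler-Poisson-Darboux identity
    [r A(Delta f) = r (A f)'' + (m - 1) (A f)'] says that [A] intertwines the Laplacian with
    the Bessel operator, so [Be^N (A f) 0 = A (Delta^N f) 0 = Delta^N f 0]; Jensen's
    inequality and the polar formula bound the weighted norm of [A f] by a constant times
    the norm of [f]. Conversely an even [g] lifts to the radial function [f x = g |x|],
    for which [A f = g] and the norm inequality is an equality.

    The Euler-Poisson-Darboux identity is a Gaussian integration by parts, obtained by
    differentiating the translation invariance of the Lebesgue measure. The partial
    derivatives of an entire function of exponential type are again of this kind by
    Cauchy's formula, which rests on Goursat's bisection argument. *)

From HB Require Import structures.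
Require Import Defs.
From mathcomp Require Import all_boot all_order all_algebra.
From mathcomp Require Import all_classical all_reals all_analysis.
From mathcomp Require Import measurable_realfun ess_sup_inf complex ring lra.
Set Implicit Arguments.
Unset Strict Implicit.
Unset Printing Implicit Defensive.
Import Order.TTheory GRing.Theory Num.Theory.
Import numFieldNormedType.Exports.
Import ComplexField.Normc.
Local Open Scope classical_set_scope.
Local Open Scope ring_scope.
Local Open Scope complex_scope.

(** * Cauchy's formula *)

(** The spherical mean can lose a nonzero [f]: it vanishes on odd functions, for instance. Then the
    quotient of [f] is 0, and the other supremum must still be shown nonnegative, which needs a
    nonzero competitor; the mean of a translate of [f] about a point where [f] does not vanish is
    one. The lift [g |x|] must extend to an entire function, while the Euclidean norm is only the
    square root of a polynomial. Evenness of [g] makes its composite with a root of [\sum_j z_j^2]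
    independent of the root chosen, and holomorphic even where the root is not. The factor is [2
    pi^(-m/2) \int_0^oo r^(m-1) exp(-r^2) dr = 2 / |S^(m-1)|], the integral being half of
    [Gamma (m / 2)]. The iterates of the Laplacian are controlled only through a class of functions
    of some exponential growth with a quadratic first-order expansion. The Gaussian weight absorbs
    such growth, so integrability and domination are uniform throughout. The direction of [y] is
    undefined at one point only, which is null since [m] is positive. *)

Section segment_integral.
Context {R : realType}.
Implicit Types (f g : R -> R) (a b c x y l h : R).

Definition seg f a b : R := \int[lebesgue_measure]_(x in `[a, b]) f x.

Definition econt f := forall x e, 0 < e ->
  exists2 d, 0 < d & forall h, `|h| < d -> `|f (x + h) - f x| <= e.

Lemma econt_continuous f : econt f -> continuous f.
Proof.
move=> cf x; apply/cvgrPdist_le => e e0.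
have [d d0 H] := cf x e e0; near=> y.
have -> : y = x + (y - x) by rewrite addrC subrK.
rewrite distrC; apply: H; rewrite distrC.
by near: y; apply: cvgr_dist_lt.
Unshelve. all: by end_near. Qed.

Lemma continuous_integrable_seg f a b : continuous f ->
  lebesgue_measure.-integrable `[a, b] (EFin \o f).
Proof.
move=> cf; apply: continuous_compact_integrable; first exact: segment_compact.
exact: continuous_subspaceT.
Qed.

Lemma seg_split f a b c : continuous f -> a <= c -> c <= b ->
  seg f a b = seg f a c + seg f c b.
Proof.
move=> cf ac cb; apply/eqP; rewrite addrC -subr_eq; apply/eqP.
rewrite /seg (@Rintegral_itvB _ f (BLeft a) (BRight b)) ?bnd_simp//; last first.
  exact: continuous_integrable_seg.
rewrite Rintegral_itv_obnd_cbnd//.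
apply: integrableS (continuous_integrable_seg a b cf) => //.
by apply: subset_itvr; rewrite bnd_simp.
Qed.

Lemma segB f g a b : continuous f -> continuous g ->
  seg (fun x => f x - g x) a b = seg f a b - seg g a b.
Proof.
by move=> cf cg; rewrite /seg RintegralB//; exact: continuous_integrable_seg.
Qed.

Lemma seg_cst c a b : a <= b -> seg (fun=> c) a b = c * (b - a).
Proof.
move=> ab; rewrite /seg Rintegral_cst//= lebesgue_measure_itv/= lte_fin.
by move: ab; rewrite le_eqVlt => /predU1P[->|->//]; rewrite ltxx subrr.
Qed.

Lemma seg_near f c e a b : continuous f -> a <= b ->
  (forall x, a <= x <= b -> `|f x - c| <= e) ->
  `|seg f a b - c * (b - a)| <= e * (b - a).
Proof.
move=> cf ab H; rewrite -seg_cst// -segB//; last by move=> ?; exact: cvg_cst.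
have ci : continuous (fun x => f x - c).
  by move=> x; apply: cvgB; [exact: cf|exact: cvg_cst].
apply: (le_trans (le_normr_Rintegral _ _)) => //.
  exact: continuous_integrable_seg.
rewrite -(seg_cst e)//; apply: le_Rintegral => //.
- rewrite (_ : _ \o _ = EFin \o (fun x => `|f x - c|))//.
  apply: continuous_integrable_seg => x.
  by apply: cvg_norm; exact: ci.
- by apply: continuous_integrable_seg => x; exact: cvg_cst.
Qed.

End segment_integral.

(** * Goursat's theorem for closed differential forms on rectangles *)

Section goursat.
Context {R : realType}.
Implicit Types (P Q : R -> R -> R) (a b c x y l h : R).

(** Total differentiability at the single point [(x, y)], with partial derivatives [a] and [b]. Two
    instances sharing a coefficient, [diff2 P x y a b] and [diff2 Q x y b c], say that the form
    [P dx + Q dy] is closed there. *)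
Definition diff2 P x y a b := forall e, 0 < e -> exists2 d, 0 < d &
  forall h k, `|h| < d -> `|k| < d ->
  `|P (x + h) (y + k) - P x y - a * h - b * k| <= e * (`|h| + `|k|).

Lemma diff2_econtl P y : (forall x, exists a b, diff2 P x y a b) ->
  econt (P ^~ y).
Proof.
move=> dP x e e0; have [a [b D]] := dP x.
have [d d0 H] := D 1 ltr01; have na : 0 < `|a| + 1 by rewrite ltr_wpDl.
exists (Num.min d (e / (`|a| + 1))); first by rewrite lt_min d0 divr_gt0.
move=> h; rewrite lt_min => /andP[hd he].
have := H h 0 hd; rewrite normr0 d0 => /(_ isT).
rewrite mulr0 subr0 !addr0 mul1r => K.
rewrite -(subrK (a * h) (_ - P x y)) (le_trans (ler_normD _ _))//.
rewrite normrM; move: he; rewrite ltr_pdivlMr// => he; nra.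
Qed.

Lemma diff2_econtr P x : (forall y, exists a b, diff2 P x y a b) ->
  econt (P x).
Proof.
move=> dP; apply: (@diff2_econtl (fun u v => P v u)) => y.
have [a [b D]] := dP y; exists b, a => e e0.
have [d d0 H] := D e e0; exists d => // h k hd kd.
by rewrite addrAC (addrC `|h|); exact: H.
Qed.

(** The integral of [P dx + Q dy] along the boundary of the rectangle of corner [(x, y)] and sides
    [l] and [h], run counterclockwise. *)
Definition bdry P Q x y l h : R :=
  seg (P ^~ y) x (x + l) - seg (P ^~ (y + h)) x (x + l) +
  (seg (Q (x + l)) y (y + h) - seg (Q x) y (y + h)).

(** Pigeonhole for the bisection: one of the four quarters carries at least a fourth of the boundary
    integral. *)
Lemma norm_sum4 a b c d : `|a + b + c + d| <= 4 * `|a| \/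
  `|a + b + c + d| <= 4 * `|b| \/ `|a + b + c + d| <= 4 * `|c| \/
  `|a + b + c + d| <= 4 * `|d|.
Proof.
have : `|a + b + c + d| <= `|a| + `|b| + `|c| + `|d|.
  apply: (le_trans (ler_normD _ _)); rewrite lerD2r.
  by apply: (le_trans (ler_normD _ _)); rewrite lerD2r ler_normD.
have [?|?] := leP `|a + b + c + d| (4 * `|a|); first by left.
have [?|?] := leP `|a + b + c + d| (4 * `|b|); first by right; left.
have [?|?] := leP `|a + b + c + d| (4 * `|c|); first by right; right; left.
by move=> ?; right; right; right; lra.
Qed.

Variables P Q : R -> R -> R.
Hypothesis cPl : forall y, continuous (P ^~ y).
Hypothesis cQr : forall x, continuous (Q x).

Lemma bdry_split x y l h : 0 <= l -> 0 <= h ->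
  let l' := l / 2 in let h' := h / 2 in
  bdry P Q x y l h = bdry P Q x y l' h' + bdry P Q (x + l') y l' h' +
     bdry P Q x (y + h') l' h' + bdry P Q (x + l') (y + h') l' h'.
Proof.
move=> l0 h0 l' h'; rewrite /bdry.
have El : x + l' + l' = x + l by rewrite -addrA -splitr.
have Eh : y + h' + h' = y + h by rewrite -addrA -splitr.
rewrite !El !Eh.
have l1 : x <= x + l' by rewrite lerDl divr_ge0.
have l2 : x + l' <= x + l by rewrite -El lerDl divr_ge0.
have h1 : y <= y + h' by rewrite lerDl divr_ge0.
have h2 : y + h' <= y + h by rewrite -Eh lerDl divr_ge0.
rewrite (seg_split (@cPl y) l1 l2) (seg_split (@cPl (y + h)) l1 l2).
rewrite (seg_split (@cQr x) h1 h2) (seg_split (@cQr (x + l)) h1 h2).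
ring.
Qed.

(** The affine parts cancel: with the common coefficient [b], the horizontal sides contribute
    [- b * h * l] and the vertical ones [b * l * h]. Only the errors of the expansions remain. *)
Lemma bdry_small x y l h x0 y0 a b c e : 0 <= l -> 0 <= h ->
  x <= x0 <= x + l -> y <= y0 <= y + h ->
  (forall s t, x <= s <= x + l -> y <= t <= y + h ->
    `|P s t - P x0 y0 - a * (s - x0) - b * (t - y0)| <= e * (l + h) /\
    `|Q s t - Q x0 y0 - b * (s - x0) - c * (t - y0)| <= e * (l + h)) ->
  `|bdry P Q x y l h| <= 2 * e * (l + h) ^+ 2.
Proof.
move=> l0 h0 xx yy H; rewrite /bdry -!segB//.
have Hl : x <= x + l by rewrite lerDl.
have Hh : y <= y + h by rewrite lerDl.
have yl : y <= y <= y + h by rewrite lexx.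
have yr : y <= y + h <= y + h by rewrite lexx andbT.
have xl : x <= x <= x + l by rewrite lexx.
have xr : x <= x + l <= x + l by rewrite lexx andbT.
have A : `|seg (fun s => P s y - P s (y + h)) x (x + l) - (- b * h) * (x + l - x)|
    <= 2 * e * (l + h) * (x + l - x).
  apply: seg_near => // [s|s sx].
    by apply: cvgB; [exact: (@cPl y)|exact: (@cPl (y + h))].
  have [+ _] := H s y sx yl; have [+ _] := H s (y + h) sx yr.
  by rewrite !ler_norml; lra.
have B : `|seg (fun t => Q (x + l) t - Q x t) y (y + h) - (b * l) * (y + h - y)|
    <= 2 * e * (l + h) * (y + h - y).
  apply: seg_near => // [s|s sx].
    by apply: cvgB; [exact: (@cQr (x + l))|exact: (@cQr x)].
  have [_] := H x s xl sx; have [_] := H (x + l) s xr sx.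
  by rewrite !ler_norml; lra.
by move: A B; rewrite !ler_norml; lra.
Qed.

Hypothesis closed_form : forall x y, exists a b c,
  diff2 P x y a b /\ diff2 Q x y b c.

Theorem goursat x y l h : 0 <= l -> 0 <= h -> bdry P Q x y l h = 0.
Proof.
move=> l0 h0.
pose L n := l / 2 ^+ n; pose H n := h / 2 ^+ n.
have L0 n : 0 <= L n by rewrite divr_ge0// exprn_ge0.
have H0 n : 0 <= H n by rewrite divr_ge0// exprn_ge0.
have LS n : L n.+1 = L n / 2 by rewrite /L exprSr invfM mulrA.
have HS n : H n.+1 = H n / 2 by rewrite /H exprSr invfM mulrA.
pose J (p : R * R) n : R := `|bdry P Q p.1 p.2 (L n) (H n)|.
(* A state is a level together with a corner. The next corner belongs to a quarter, contained in the
   current rectangle, that carries at least a fourth of the integral. *)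
have nextP (q : nat * (R * R)) : exists p' : R * R,
    [/\ J q.2 q.1 <= 4 * J p' q.1.+1,
     q.2.1 <= p'.1 /\ p'.1 + L q.1.+1 <= q.2.1 + L q.1 &
     q.2.2 <= p'.2 /\ p'.2 + H q.1.+1 <= q.2.2 + H q.1].
  case: q => n [u v] /=; have /= := bdry_split u v (L0 n) (H0 n).
  have := LS n; have := HS n; have := L0 n.+1; have := H0 n.+1.
  rewrite /J /= => h0' l0' HSn LSn; rewrite -LSn -HSn => ->.
  have uL : u + L n.+1 + L n.+1 <= u + L n by rewrite -addrA LSn -splitr.
  have vH : v + H n.+1 + H n.+1 <= v + H n by rewrite -addrA HSn -splitr.
  have uL' : u + L n.+1 <= u + L n by apply: le_trans uL; rewrite lerDl.
  have vH' : v + H n.+1 <= v + H n by apply: le_trans vH; rewrite lerDl.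
  have uu : u <= u + L n.+1 by rewrite lerDl.
  have vv : v <= v + H n.+1 by rewrite lerDl.
  have [k|[k|[k|k]]] := norm_sum4 (bdry P Q u v (L n.+1) (H n.+1))
    (bdry P Q (u + L n.+1) v (L n.+1) (H n.+1))
    (bdry P Q u (v + H n.+1) (L n.+1) (H n.+1))
    (bdry P Q (u + L n.+1) (v + H n.+1) (L n.+1) (H n.+1)).
  - by exists (u, v).
  - by exists (u + L n.+1, v).
  - by exists (u, v + H n.+1).
  - by exists (u + L n.+1, v + H n.+1).
have [nx nxP] := choice nextP.
pose fix p n : R * R := if n is k.+1 then nx (k, p k) else (x, y).
have pS n : p n.+1 = nx (n, p n) by [].
have Jn n : `|bdry P Q x y l h| <= 4 ^+ n * J (p n) n.
  elim: n => [|n IH]; first by rewrite /J /L /H !expr0 !divr1 mul1r.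
  apply: (le_trans IH); rewrite exprSr -mulrA ler_pM2l ?exprn_gt0//.
  by rewrite pS; have [] := nxP (n, p n).
have p1 n k : (p n).1 <= (p (n + k)%N).1 /\
    (p (n + k)%N).1 + L (n + k)%N <= (p n).1 + L n.
  elim: k => [|k [IH1 IH2]]; first by rewrite addn0.
  have [_ [u v] _] := nxP ((n + k)%N, p (n + k)%N).
  by rewrite addnS pS; split; [exact: le_trans u|exact: le_trans v _].
have p2 n k : (p n).2 <= (p (n + k)%N).2 /\
    (p (n + k)%N).2 + H (n + k)%N <= (p n).2 + H n.
  elim: k => [|k [IH1 IH2]]; first by rewrite addn0.
  have [_ _ [u v]] := nxP ((n + k)%N, p (n + k)%N).
  by rewrite addnS pS; split; [exact: le_trans u|exact: le_trans v _].
(* Nested intervals: the supremum of the left ends lies in all of them. This is applied to each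
   coordinate. *)
have nested (u w : nat -> R) : (forall n, 0 <= w n) ->
    (forall n k, u n <= u (n + k)%N /\ u (n + k)%N + w (n + k)%N <= u n + w n) ->
    exists z, forall n, u n <= z <= u n + w n.
  move=> w0 uw.
  have ub n k : u k <= u n + w n.
    case: (leqP n k) => nk.
      have [_] := uw n (k - n)%N; rewrite subnKC//; have := w0 k; lra.
    have [+ _] := uw k (n - k)%N; rewrite subnKC ?(ltnW nk)//; have := w0 n; lra.
  exists (sup (range u)) => n; apply/andP; split.
    apply: ub_le_sup; last by exists n.
    by exists (u 0 + w 0) => _ [k _ <-].
  apply: ge_sup; first by exists (u 0), 0%N.
  by move=> _ [k _ <-].
have [x0 x0P] := nested (fun n => (p n).1) L L0 p1.
have [y0 y0P] := nested (fun n => (p n).2) H H0 p2.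
have [a [b [c [dP dQ]]]] := closed_form x0 y0.
apply/eqP; rewrite -normr_le0; apply/ler_addgt0Pr => e e0; rewrite add0r.
(* The summand 1 keeps the divisor positive for the degenerate rectangle [l = h = 0]. *)
have lh : 0 < 2 * (l + h) ^+ 2 + 1 by rewrite ltr_wpDl// mulr_ge0// exprn_ge0// addr_ge0.
pose e' := e / (2 * (l + h) ^+ 2 + 1); have e'0 : 0 < e' by rewrite divr_gt0.
have [d1 d10 D1] := dP _ e'0; have [d2 d20 D2] := dQ _ e'0.
have [n nP] : exists n, (l + h) / 2 ^+ n < Num.min d1 d2.
  have d0 : 0 < Num.min d1 d2 by rewrite lt_min d10.
  have lh1 : 0 <= l + h by rewrite addr_ge0.
  exists (Num.bound ((l + h) / Num.min d1 d2)).
  rewrite ltr_pdivrMr ?exprn_gt0// mulrC -ltr_pdivrMr//.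
  apply: (lt_trans (archi_boundP _)); first by rewrite divr_ge0// ltW.
  by rewrite -natrX ltr_nat ltn_expl.
have Ld : L n + H n < Num.min d1 d2 by rewrite -mulrDl.
have := Jn n; have xn := x0P n; have yn := y0P n.
have : J (p n) n <= 2 * e' * (L n + H n) ^+ 2.
  apply: (bdry_small (x0 := x0) (y0 := y0) (a := a) (b := b) (c := c)) => // s t sx ty.
  have sd : `|s - x0| <= L n by move: sx xn; rewrite ler_norml; lra.
  have td : `|t - y0| <= H n by move: ty yn; rewrite ler_norml; lra.
  have := L0 n; have := H0 n => Hn Ln.
  move: Ld; rewrite lt_min => /andP[Ld1 Ld2].
  have sL : `|s - x0| <= L n + H n by rewrite (le_trans sd)// lerDl.
  have tL : `|t - y0| <= L n + H n by rewrite (le_trans td)// lerDr.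
  have := D1 (s - x0) (t - y0); have := D2 (s - x0) (t - y0).
  rewrite !(addrC _ (_ - _)) !subrK.
  move=> /(_ (le_lt_trans sL Ld2) (le_lt_trans tL Ld2)) E2.
  move=> /(_ (le_lt_trans sL Ld1) (le_lt_trans tL Ld1)) E1.
  split; apply: (le_trans (y := e' * (`|s - x0| + `|t - y0|))) => //.
  + by rewrite ler_pM2l// lerD.
  + by rewrite ler_pM2l// lerD.
move=> Jle /le_trans; apply.
apply: (le_trans (y := 4 ^+ n * (2 * e' * (L n + H n) ^+ 2))).
  by rewrite ler_pM2l ?exprn_gt0.
(* At level [n] the square [(L n + H n) ^+ 2] equals [(l + h) ^+ 2 / 4 ^+ n], which compensates the
   factor [4 ^+ n] lost by the choices. *)
rewrite /L /H -mulrDl exprMn exprVn -exprM mulnC exprM.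
rewrite (_ : 2 ^+ 2 = 4 :> R); last by ring.
rewrite [leLHS](_ : _ = 2 * e' * (l + h) ^+ 2 * (4 ^+ n / 4 ^+ n)); last by ring.
rewrite divff ?expf_neq0// mulr1 /e'.
rewrite [leLHS](_ : _ = e * (2 * (l + h) ^+ 2 / (2 * (l + h) ^+ 2 + 1))); last by ring.
by rewrite ler_piMr ?(ltW e0)// ler_pdivrMr// mul1r lerDl.
Qed.

End goursat.

(** * Complex derivatives and the complex exponential *)

Section complex_derivative.
Context {R : realType}.
Local Notation C := R[i].
Implicit Types (z w h d : C) (f g : C -> C) (x y s t e : R).

Lemma normc_ge0 z : 0 <= normc z.
Proof. by case: z => a b; exact: sqrtr_ge0. Qed.

Lemma normc_real x : normc x%:C = `|x|.
Proof. by rewrite /normc /= expr0n /= addr0 sqrtr_sqr. Qed.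

Lemma normc_Re z : `|complex.Re z| <= normc z.
Proof.
case: z => a b /=; rewrite -(sqrtr_sqr a) ler_sqrt ?lerDl ?sqr_ge0//.
by rewrite addr_ge0// sqr_ge0.
Qed.

Lemma normc_Im z : `|complex.Im z| <= normc z.
Proof.
case: z => a b /=; rewrite -(sqrtr_sqr b) ler_sqrt ?lerDr ?sqr_ge0//.
by rewrite addr_ge0// sqr_ge0.
Qed.

Lemma ler_normcD z w : normc (z + w) <= normc z + normc w.
Proof. exact: le_normcD. Qed.

Lemma normc_le_ReIm z : normc z <= `|complex.Re z| + `|complex.Im z|.
Proof.
have -> : z = (complex.Re z)%:C + 'i * (complex.Im z)%:C by exact: complexE.
rewrite (le_trans (ler_normcD _ _))// normcM !normc_real.
rewrite [X in _ + X * _ <= _](_ : _ = 1) ?mul1r; last first.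
  by rewrite /= expr0n expr1n add0r sqrtr1.
by rewrite -complexE.
Qed.

Lemma ReD z w : complex.Re (z + w) = complex.Re z + complex.Re w.
Proof. by case: z; case: w. Qed.
Lemma ImD z w : complex.Im (z + w) = complex.Im z + complex.Im w.
Proof. by case: z; case: w. Qed.
Lemma ReN z : complex.Re (- z) = - complex.Re z. Proof. by case: z. Qed.
Lemma ImN z : complex.Im (- z) = - complex.Im z. Proof. by case: z. Qed.
Lemma ReB z w : complex.Re (z - w) = complex.Re z - complex.Re w.
Proof. by rewrite ReD ReN. Qed.
Lemma ImB z w : complex.Im (z - w) = complex.Im z - complex.Im w.
Proof. by rewrite ImD ImN. Qed.
Lemma ReM z w : complex.Re (z * w) =
  complex.Re z * complex.Re w - complex.Im z * complex.Im w.
Proof. by case: z; case: w. Qed.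
Lemma ImM z w : complex.Im (z * w) =
  complex.Re z * complex.Im w + complex.Im z * complex.Re w.
Proof. by case: z; case: w. Qed.

Lemma complex_ext z w : complex.Re z = complex.Re w ->
  complex.Im z = complex.Im w -> z = w.
Proof. by case: z; case: w => /= ? ? ? ? -> ->. Qed.

(** The complex derivative in terms of [normc]: the norm of the numeric field [C] takes its values
    in [C], while all the estimates below are made in [R]. *)
Definition cdiff f z d := forall e, 0 < e -> exists2 r, 0 < r &
  forall h, normc h < r -> normc (f (z + h) - f z - d * h) <= e * normc h.

Lemma cdiff_bound f z d : cdiff f z d -> exists2 r, 0 < r &
  forall h, normc h < r -> normc (f (z + h) - f z) <= (normc d + 1) * normc h.
Proof.
move=> D; have [r r0 H] := D 1 ltr01; exists r => // h hr.
rewrite -(subrK (d * h) (f (z + h) - f z)) (le_trans (ler_normcD _ _))//.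
by rewrite normcM mulrDl addrC lerD2l H.
Qed.

Lemma cdiff_comp f g z d (e : C) : cdiff f (g z) d -> cdiff g z e ->
  cdiff (f \o g) z (d * e).
Proof.
move=> Df Dg eps eps0.
have [r1 r10 B] := cdiff_bound Dg.
have nd : 0 < normc d + 1 by rewrite ltr_wpDl ?normc_ge0.
have ne : 0 < normc e + 1 by rewrite ltr_wpDl ?normc_ge0.
have [r2 r20 F] := Df (eps / 2 / (normc e + 1)) ltac:(by rewrite !divr_gt0).
have [r3 r30 G] := Dg (eps / 2 / (normc d + 1)) ltac:(by rewrite !divr_gt0).
exists (Num.min r1 (Num.min r3 (r2 / (normc e + 1)))).
  by rewrite !lt_min r10 r30 divr_gt0.
move=> h; rewrite !lt_min => /and3P[h1 h3 h2] /=.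
pose k := g (z + h) - g z.
have kE : g (z + h) = g z + k by rewrite /k [RHS]addrC subrK.
have kb : normc k <= (normc e + 1) * normc h by exact: B.
rewrite kE.
have -> : f (g z + k) - f (g z) - d * e * h =
  (f (g z + k) - f (g z) - d * k) + d * (k - e * h) by ring.
rewrite (le_trans (ler_normcD _ _))// (splitr eps) mulrDl lerD//.
  apply: (le_trans (F k _)).
    by apply: (le_lt_trans kb); rewrite mulrC -ltr_pdivlMr.
  rewrite -mulrA ler_wpM2l ?divr_ge0// ?(ltW eps0)//.
  by rewrite mulrC ler_pdivrMr// mulrC.
rewrite normcM (le_trans (ler_wpM2l (normc_ge0 _) (G h h3)))//.
rewrite mulrA ler_wpM2r ?normc_ge0// mulrCA ler_piMr//.
  by rewrite divr_ge0// ltW.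
by rewrite ler_pdivrMr// mul1r lerDl.
Qed.

Lemma cdiffM f g z d (e : C) : cdiff f z d -> cdiff g z e ->
  cdiff (fun w => f w * g w) z (d * g z + f z * e).
Proof.
move=> Df Dg eps eps0.
have [r1 r10 B] := cdiff_bound Dg.
pose K := normc (g z) + (normc e + 1); pose L := normc (f z) + 1.
pose M := normc d * (normc e + 1) + 1.
have e0 : 0 < normc e + 1 by rewrite ltr_wpDl ?normc_ge0.
have K0 : 0 < K by rewrite ltr_wpDl ?normc_ge0.
have L0 : 0 < L by rewrite ltr_wpDl ?normc_ge0.
have M0 : 0 < M by rewrite ltr_wpDl// mulr_ge0 ?normc_ge0 ?ltW.
have [r2 r20 F] := Df (eps / 3 / K) ltac:(by rewrite !divr_gt0).
have [r3 r30 G] := Dg (eps / 3 / L) ltac:(by rewrite !divr_gt0).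
exists (Num.min (Num.min r1 1) (Num.min (Num.min r2 r3) (eps / 3 / M))).
  by rewrite !lt_min r10 r20 r30 ltr01 !divr_gt0.
move=> h; rewrite !lt_min => /andP[/andP[h1 h11] /andP[/andP[h2 h3] h4]].
have h0 := normc_ge0 h.
have gb := B h h1.
have gK : normc (g (z + h)) <= K.
  rewrite -(subrK (g z) (g (z + h))) (le_trans (ler_normcD _ _))//.
  rewrite addrC lerD2l (le_trans gb)// ler_piMr// ?(ltW e0)//.
  exact: ltW.
have -> : f (z + h) * g (z + h) - f z * g z - (d * g z + f z * e) * h =
  (f (z + h) - f z - d * h) * g (z + h) + f z * (g (z + h) - g z - e * h) +
  d * h * (g (z + h) - g z) by ring.
have -> : eps = eps / 3 + eps / 3 + eps / 3 by field.
rewrite (le_trans (ler_normcD _ _))// [leRHS]mulrDl lerD//.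
  rewrite (le_trans (ler_normcD _ _))// [leRHS]mulrDl lerD// normcM.
    apply: (le_trans (y := eps / 3 / K * normc h * K)).
      by rewrite ler_pM ?normc_ge0 ?F.
    by rewrite mulrAC divfK// gt_eqF.
  apply: (le_trans (y := L * (eps / 3 / L * normc h))).
    by rewrite ler_pM ?normc_ge0 ?G// lerDl.
  by rewrite mulrA [L * _]mulrC divfK// gt_eqF.
rewrite !normcM.
apply: (le_trans (y := normc d * normc h * ((normc e + 1) * normc h))).
  by rewrite ler_wpM2l// mulr_ge0// normc_ge0.
rewrite mulrACA mulrA ler_wpM2r//.
apply: (le_trans (y := M * (eps / 3 / M))).
  by rewrite ler_pM ?mulr_ge0 ?normc_ge0 ?(ltW e0)// ?(ltW h4)// lerDl.
by rewrite mulrC divfK// gt_eqF.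
Qed.

Lemma cdiff_cst (c z : C) : cdiff (fun=> c) z 0.
Proof.
move=> e e0; exists 1 => // h _.
by rewrite subrr mul0r subr0 normc0 mulr_ge0 ?normc_ge0// ltW.
Qed.

Lemma cdiff_addl (a z : C) : cdiff (fun w => a + w) z 1.
Proof.
move=> e e0; exists 1 => // h _.
rewrite [X in normc X](_ : _ = 0) ?normc0 ?mulr_ge0 ?normc_ge0 ?ltW//.
by ring.
Qed.

Lemma cdiff_mull (a z : C) : cdiff (fun w => a * w) z a.
Proof.
move=> e e0; exists 1 => // h _.
rewrite [X in normc X](_ : _ = 0) ?normc0 ?mulr_ge0 ?normc_ge0 ?ltW//.
by ring.
Qed.

Definition cexp z : C := expR (complex.Re z) * cos (complex.Im z) +i*
  (expR (complex.Re z) * sin (complex.Im z)).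

Definition cis t : C := cos t +i* sin t.

Lemma cexpD z w : cexp (z + w) = cexp z * cexp w.
Proof.
rewrite /cexp ReD ImD expRD cosD sinD; apply: complex_ext => /=; ring.
Qed.

Lemma cexp0 : cexp 0 = 1.
Proof. by rewrite /cexp /= expR0 cos0 sin0 mulr0 mul1r. Qed.

Lemma normc_cexp z : normc (cexp z) = expR (complex.Re z).
Proof.
rewrite /= !exprMn -mulrDr cos2Dsin2 mulr1 sqrtr_sqr.
by rewrite ger0_norm// expR_ge0.
Qed.

Lemma normc_cis t : normc (cis t) = 1.
Proof. by rewrite /= cos2Dsin2 sqrtr1. Qed.

Lemma cexp_neq0 z : cexp z != 0.
Proof.
apply/eqP => z0; have := normc_cexp z; rewrite z0 normc0 => /esym/eqP.
by rewrite expR_eq0.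
Qed.

Lemma cexpN z : cexp (- z) = (cexp z)^-1.
Proof.
by apply: (mulfI (cexp_neq0 z)); rewrite -cexpD subrr cexp0 divff// cexp_neq0.
Qed.

Lemma derive_near (u : R -> R) (a du : R) : is_derive a 1 u du ->
  forall e, 0 < e -> exists2 r, 0 < r &
  forall h : R, `|h| < r -> `|u (a + h) - u a - du * h| <= e * `|h|.
Proof.
move=> [dv dE] e e0.
have : h^-1 *: (u (h *: 1 + a) - u a) @[h --> (0:R)^'] --> du.
  by rewrite -dE; exact: dv.
move=> /cvgrPdist_le /(_ e e0) [r /= r0 H]; exists r => // h hr.
have [->|h0] := eqVneq h 0; first by rewrite addr0 mulr0 subr0 subrr normr0 mulr0.
have := H h; rewrite /= sub0r normrN => /(_ hr h0).
rewrite /GRing.scale /= mulr1 => B.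
have -> : u (a + h) - u a - du * h = - (du - h^-1 * (u (h + a) - u a)) * h.
  by rewrite (addrC h) mulNr mulrBl mulrAC mulVf// mul1r; ring.
by rewrite normrM normrN ler_wpM2r.
Qed.

(** The expansions of [expR], [cos] and [sin] at 0 leave four errors, bounded by [e / 8],
    [2 * (e / 8)], [2 * (e / 8)] and [e / 8] times the modulus of [h]. The factors 2 come from
    [expR a <= 2]. *)
Lemma cdiff_cexp0 : cdiff cexp 0 1.
Proof.
move=> e e0; pose e4 := Num.min (e / 8) 1.
have e40 : 0 < e4 by rewrite lt_min divr_gt0//=.
have [r1 r10 E] := derive_near (is_derive_expR (0:R)) e40.
have [r2 r20 Cs] := derive_near (is_derive_cos (0:R)) e40.
have [r3 r30 Sn] := derive_near (is_derive_sin (0:R)) e40.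
(* The radius [1 / 4] ensures [expR a <= 2]; the radius [e / 16] controls the quadratic cross term
   [b * (expR a - 1)]. *)
exists (Num.min (Num.min r1 r2) (Num.min r3 (Num.min (1 / 4) (e / 16)))).
  by rewrite !lt_min r10 r20 r30 !divr_gt0.
move=> h; rewrite !lt_min => /andP[/andP[h1 h2] /and3P[h3 h4 h5]].
rewrite add0r cexp0 mul1r.
have := le_lt_trans (normc_Re h) h1; have := le_lt_trans (normc_Im h) h2.
have := le_lt_trans (normc_Im h) h3; have := normc_Re h; have := normc_Im h.
case: h {h1 h2 h3} h4 h5 => a b; set n := normc _; rewrite /cexp /= => n1 n2.
move=> bn an b3 b2 a1.
have := E a a1; have := Cs b b2; have := Sn b b3.
rewrite !add0r expR0 cos0 sin0 oppr0 mul0r !mul1r !subr0 addr0 => S B A.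
apply: (le_trans (normc_le_ReIm (_ +i* _))) => /=.
have q1 : e4 <= e / 8 by rewrite ge_min lexx.
have q2 : e4 <= 1 by rewrite ge_min lexx orbT.
have n0 : 0 <= n by exact: (normc_ge0 (a +i* b)).
have Ea : expR a <= 2.
  have : expR a - 1 - a <= `|a|.
    by rewrite (le_trans (ler_norm _))// (le_trans A)// ler_piMl.
  by have := ler_norm a; lra.
have Ea0 := expR_ge0 a.
have Em : `|expR a - 1| <= 2 * n.
  have -> : expR a - 1 = (expR a - 1 - a) + a by ring.
  rewrite (le_trans (ler_normD _ _))//.
  have : e4 * `|a| <= `|a| by rewrite ler_piMl.
  lra.
have -> : expR a * cos b - 1 - a = (expR a - 1 - a) + expR a * (cos b - 1) by ring.
have -> : expR a * sin b + 0 - b = expR a * (sin b - b) + b * (expR a - 1) by ring.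
have t1 : `|expR a - 1 - a| <= e / 8 * n.
  by apply: (le_trans A); rewrite ler_pM// ltW.
have t2 : `|expR a * (cos b - 1)| <= 2 * (e4 * n).
  rewrite normrM (ger0_norm Ea0) ler_pM//.
  by apply: (le_trans B); rewrite ler_wpM2l// ltW.
have t3 : `|expR a * (sin b - b)| <= 2 * (e4 * n).
  rewrite normrM (ger0_norm Ea0) ler_pM//.
  by apply: (le_trans S); rewrite ler_wpM2l// ltW.
have t4 : `|b * (expR a - 1)| <= e / 8 * n.
  rewrite normrM mulrC (le_trans (y := 2 * n * n))//.
    by rewrite ler_pM.
  by rewrite ler_wpM2r//; move: n2; clear; lra.
have t5 := ler_normD (expR a - 1 - a) (expR a * (cos b - 1)).
have t6 := ler_normD (expR a * (sin b - b)) (b * (expR a - 1)).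
have t7 : e4 * n <= e / 8 * n by rewrite ler_wpM2r.
have t8 : 0 <= e / 8 * n by rewrite mulr_ge0// divr_ge0// ltW.
move: t1 t2 t3 t4 t5 t6 t7 t8; clear; lra.
Qed.

End complex_derivative.

(** * Integrals of complex-valued functions *)

Section complex_integral.
Context {R : realType} d {T : measurableType d} (mu : {measure set T -> \bar R}).
Local Notation C := R[i].
Variables (D : set T) (mD : measurable D).
Implicit Types (f g : T -> C) (c : C) (G : T -> R).

Definition cint f : C := (\int[mu]_(x in D) complex.Re (f x)) +i*
  (\int[mu]_(x in D) complex.Im (f x)).

Definition cintegrable f :=
  mu.-integrable D (EFin \o (fun x => complex.Re (f x))) /\
  mu.-integrable D (EFin \o (fun x => complex.Im (f x))).

Lemma integrableZr (k : R) (u : T -> R) : mu.-integrable D (EFin \o u) ->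
  mu.-integrable D (EFin \o (fun x => k * u x)).
Proof. by move=> iu; exact: (integrableZl mD k iu). Qed.

Lemma integrableDr (u v : T -> R) : mu.-integrable D (EFin \o u) ->
  mu.-integrable D (EFin \o v) -> mu.-integrable D (EFin \o (fun x => u x + v x)).
Proof. by move=> iu iv; exact: (integrableD mD iu iv). Qed.

Lemma integrableBr (u v : T -> R) : mu.-integrable D (EFin \o u) ->
  mu.-integrable D (EFin \o v) -> mu.-integrable D (EFin \o (fun x => u x - v x)).
Proof. by move=> iu iv; exact: (integrableB mD iu iv). Qed.

Lemma cintegrableD f g : cintegrable f -> cintegrable g ->
  cintegrable (fun x => f x + g x).
Proof.
move=> [f1 f2] [g1 g2]; split.
  by under [X in EFin \o X]funext do rewrite ReD; exact: integrableDr.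
by under [X in EFin \o X]funext do rewrite ImD; exact: integrableDr.
Qed.

Lemma cintegrableZ c f : cintegrable f -> cintegrable (fun x => c * f x).
Proof.
move=> [f1 f2]; split.
  under [X in EFin \o X]funext do rewrite ReM.
  by apply: integrableBr; exact: integrableZr.
under [X in EFin \o X]funext do rewrite ImM.
by apply: integrableDr; exact: integrableZr.
Qed.

Lemma cintD f g : cintegrable f -> cintegrable g ->
  cint (fun x => f x + g x) = cint f + cint g.
Proof.
move=> [f1 f2] [g1 g2]; apply: complex_ext; rewrite ?ReD ?ImD /=.
  by rewrite -RintegralD//; apply: eq_Rintegral => x _; rewrite ReD.
by rewrite -RintegralD//; apply: eq_Rintegral => x _; rewrite ImD.
Qed.

Lemma cintZ c f : cintegrable f -> cint (fun x => c * f x) = c * cint f.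
Proof.
move=> [f1 f2]; apply: complex_ext; rewrite ?ReM ?ImM /=.
  rewrite -!RintegralZl// -RintegralB//; [|exact: integrableZr..].
  by apply: eq_Rintegral => x _; rewrite ReM.
rewrite -!RintegralZl// -RintegralD//; [|exact: integrableZr..].
by apply: eq_Rintegral => x _; rewrite ImM.
Qed.

Lemma cintN f : cintegrable f -> cint (fun x => - f x) = - cint f.
Proof.
by move=> fi; rewrite -mulN1r -cintZ//; congr cint; apply/funext => x; rewrite mulN1r.
Qed.

Lemma cintegrableN f : cintegrable f -> cintegrable (fun x => - f x).
Proof.
move=> /(cintegrableZ (-1)); congr cintegrable; apply/funext => x.
by rewrite mulN1r.
Qed.

Lemma cintB f g : cintegrable f -> cintegrable g ->
  cint (fun x => f x - g x) = cint f - cint g.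
Proof. by move=> fi gi; rewrite cintD ?cintN//; exact: cintegrableN. Qed.

Lemma cintegrableB f g : cintegrable f -> cintegrable g ->
  cintegrable (fun x => f x - g x).
Proof. by move=> fi gi; apply: cintegrableD => //; exact: cintegrableN. Qed.

Lemma cintegrable_sum (I : eqType) (r : seq I) (F : I -> T -> C) :
  (forall i, cintegrable (F i)) -> cintegrable (fun x => \sum_(i <- r) F i x).
Proof.
move=> Fi; elim: r => [|i r IH].
  have -> : (fun x => \sum_(i <- [::]) F i x) = (fun=> 0).
    by apply/funext => x; rewrite big_nil.
  by split; exact: integrable0.
have -> : (fun x => \sum_(j <- i :: r) F j x) =
    (fun x => F i x + \sum_(j <- r) F j x).
  by apply/funext => x; rewrite big_cons.
exact: cintegrableD.
Qed.

Lemma cint_sum (I : eqType) (r : seq I) (F : I -> T -> C) :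
  (forall i, cintegrable (F i)) ->
  cint (fun x => \sum_(i <- r) F i x) = \sum_(i <- r) cint (F i).
Proof.
move=> Fi; elim: r => [|i r IH].
  have -> : (fun x => \sum_(i <- [::]) F i x) = (fun=> 0).
    by apply/funext => x; rewrite big_nil.
  by rewrite big_nil; apply: complex_ext; rewrite /= /Rintegral integral0.
rewrite big_cons -IH -cintD//; last exact: cintegrable_sum.
by congr cint; apply/funext => x; rewrite big_cons.
Qed.

(** Multiplication by the unimodular [u] that rotates the integral onto its modulus reduces the
    bound to that of the integral of a real part. *)
Lemma normc_cint f G : cintegrable f -> mu.-integrable D (EFin \o G) ->
  (forall x, D x -> normc (f x) <= G x) ->
  normc (cint f) <= \int[mu]_(x in D) G x.
Proof.
move=> fi Gi fG; have [w0|w0] := eqVneq (cint f) 0.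
  rewrite w0 normc0; apply: Rintegral_ge0 => x Dx.
  by rewrite (le_trans _ (fG x Dx))// normc_ge0.
have nw : 0 < normc (cint f).
  by rewrite lt_neqAle normc_ge0 andbT eq_sym; apply: contra_neq w0; exact: eq0_normc.
pose u : C := (normc (cint f))^-1%:C * (cint f)^*.
have uw : u * cint f = (normc (cint f))%:C.
  rewrite /u -mulrA (mulrC _^*) -sqr_normc normc_def -/(normc _).
  have -> : Num.sqrt (complex.Re (cint f) ^+ 2 + complex.Im (cint f) ^+ 2) =
     normc (cint f) by [].
  by rewrite -rmorphXn -rmorphM /= expr2 mulKf// gt_eqF.
have nu : normc u = 1.
  apply: (mulIf (x := normc (cint f))); first by rewrite gt_eqF.
  by rewrite -normcM uw mul1r normc_real ger0_norm// normc_ge0.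
have -> : normc (cint f) = complex.Re (u * cint f) by rewrite uw.
rewrite -cintZ//=; have [ui _] := cintegrableZ u fi.
apply: le_Rintegral => // x Dx.
rewrite (le_trans (ler_norm _))// (le_trans (normc_Re _))//.
by rewrite normcM nu mul1r fG.
Qed.

End complex_integral.

(** * Circle means and Cauchy's formula for the derivative *)

Section cauchy.
Context {R : realType}.
Local Notation C := R[i].
Implicit Types (z w h d c : C) (f g : C -> C) (x y s t : R) (u : R -> C).

Definition ccontinuous u := continuous (fun t => complex.Re (u t)) /\
  continuous (fun t => complex.Im (u t)).

Definition cmean u : C :=
  ((2 * pi)^-1)%:C * cint lebesgue_measure `[0, 2 * pi] u.

Lemma twopi_gt0 : 0 < 2 * pi :> R. Proof. by rewrite mulr_gt0// pi_gt0. Qed.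

Lemma ccontinuous_integrable u a b : ccontinuous u ->
  cintegrable lebesgue_measure `[a, b] u.
Proof. by move=> [c1 c2]; split; exact: continuous_integrable_seg. Qed.

Lemma normc_cmean u (M : R) : ccontinuous u -> (forall t, normc (u t) <= M) ->
  normc (cmean u) <= M.
Proof.
move=> cu uM; rewrite /cmean normcM normc_real ger0_norm; last first.
  by rewrite invr_ge0 ltW// twopi_gt0.
rewrite mulrC ler_pdivrMr ?twopi_gt0//.
have := @seg_cst _ M 0 (2 * pi) (ltW twopi_gt0); rewrite subr0 => <-.
apply: normc_cint => //; first exact: ccontinuous_integrable.
by apply: continuous_integrable_seg => ?; exact: cvg_cst.
Qed.

Lemma cmeanZ c u : ccontinuous u -> cmean (fun t => c * u t) = c * cmean u.
Proof.
by move=> cu; rewrite /cmean cintZ// ?(mulrCA c)//; exact: ccontinuous_integrable.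
Qed.

Lemma cmeanB u (v : R -> C) : ccontinuous u -> ccontinuous v ->
  cmean (fun t => u t - v t) = cmean u - cmean v.
Proof.
by move=> cu cv; rewrite /cmean cintB// ?mulrBr//; exact: ccontinuous_integrable.
Qed.

Lemma cmean_sum (I : eqType) (r : seq I) (F : I -> R -> C) :
  (forall i, ccontinuous (F i)) ->
  cmean (fun t => \sum_(i <- r) F i t) = \sum_(i <- r) cmean (F i).
Proof.
move=> cF; rewrite /cmean cint_sum//; last first.
  by move=> i; exact: ccontinuous_integrable.
by rewrite mulr_sumr.
Qed.

Variables (f f' : C -> C) (df : forall z, cdiff f z (f' z)).

Lemma cdiff_cexp w : cdiff cexp w (cexp w).
Proof.
move=> e e0; have Ew := expR_gt0 (complex.Re w).
have [r r0 H] := cdiff_cexp0 (R := R) (divr_gt0 e0 Ew).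
exists r => // h hr; have := H h hr; rewrite add0r cexp0 mul1r => B.
have -> : cexp (w + h) - cexp w - cexp w * h = cexp w * (cexp h - 1 - h).
  by rewrite cexpD; ring.
rewrite normcM normc_cexp (le_trans (ler_wpM2l (ltW Ew) B))//.
by rewrite mulrA (mulrC _ (e / _)) divfK// gt_eqF.
Qed.

(* [logpolar f] is [2 i pi]-periodic, so by Goursat its mean over a vertical period does
   not depend on the abscissa; at [-oo] this mean tends to the derivative of [f] at [0]. *)
Definition logpolar f w : C := f (cexp w) * cexp (- w).

Lemma cdiff_logpolar w : exists d, cdiff (logpolar f) w d.
Proof.
eexists; apply: cdiffM.
  by apply: cdiff_comp; [exact: df|exact: cdiff_cexp].
apply: (@cdiff_comp _ cexp -%R); first exact: cdiff_cexp.
have -> : -%R = (fun w : C => -1 * w) by apply/funext => z; rewrite mulN1r.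
exact: cdiff_mull.
Qed.

(** One half of the Cauchy-Riemann equations: the real part of [d * (h +i* k)] is
    [Re d * h - Im d * k]. The radius is halved because the modulus of the increment is bounded by
    the sum of those of [h] and [k]. *)
Lemma cdiff_diff2_Re g x y d : cdiff g (x +i* y) d ->
  diff2 (fun s t => complex.Re (g (s +i* t))) x y (complex.Re d) (- complex.Im d).
Proof.
move=> D e e0; have [r r0 H] := D e e0.
exists (r / 2); first by rewrite divr_gt0.
move=> h k hr kr.
have hk : normc (h +i* k) <= `|h| + `|k| by exact: normc_le_ReIm.
have /H B : normc (h +i* k) < r.
  by rewrite (le_lt_trans hk)// (splitr r) ltrD.
rewrite (le_trans _ (le_trans B _)) ?ler_wpM2l ?(ltW e0)//.
rewrite (le_trans _ (normc_Re _))// !ReB ReM /=.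
by rewrite le_eqVlt; apply/orP; left; apply/eqP; congr `|_|; ring.
Qed.

Lemma cdiff_diff2_Im g x y d : cdiff g (x +i* y) d ->
  diff2 (fun s t => complex.Im (g (s +i* t))) x y (complex.Im d) (complex.Re d).
Proof.
move=> D e e0; have [r r0 H] := D e e0.
exists (r / 2); first by rewrite divr_gt0.
move=> h k hr kr.
have hk : normc (h +i* k) <= `|h| + `|k| by exact: normc_le_ReIm.
have /H B : normc (h +i* k) < r.
  by rewrite (le_lt_trans hk)// (splitr r) ltrD.
rewrite (le_trans _ (le_trans B _)) ?ler_wpM2l ?(ltW e0)//.
rewrite (le_trans _ (normc_Im _))// !ImB ImM /=.
by rewrite le_eqVlt; apply/orP; left; apply/eqP; congr `|_|; ring.
Qed.

Lemma diff2N P x y (a b : R) : diff2 P x y a b ->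
  diff2 (fun s t => - P s t) x y (- a) (- b).
Proof.
move=> D e e0; have [r r0 H] := D e e0; exists r => // h k hr kr.
have := H h k hr kr; rewrite -normrN => B; apply: le_trans B.
by rewrite le_eqVlt; apply/orP; left; apply/eqP; congr `|_|; ring.
Qed.

(** On a rectangle whose height is a period the two horizontal sides cancel in Goursat's theorem, so
    the two vertical integrals agree. *)
Lemma periodic_closed_form P Q x (l p : R) :
  (forall x y, exists a b c : R, diff2 P x y a b /\ diff2 Q x y b c) ->
  (forall x y, P x (y + p) = P x y) -> 0 <= l -> 0 <= p ->
  seg (Q (x + l)) 0 p = seg (Q x) 0 p.
Proof.
move=> D per l0 p0.
have cP y : continuous (P ^~ y).
  apply/econt_continuous/diff2_econtl => s.
  by have [a [b [c [+ _]]]] := D s y; exists a, b.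
have cQ s : continuous (Q s).
  apply/econt_continuous/diff2_econtr => t.
  by have [a [b [c [_ +]]]] := D s t; exists b, c.
have := goursat cP cQ D x 0 l0 p0.
rewrite /bdry add0r.
have -> : P ^~ p = P ^~ 0 by apply/funext => s /=; rewrite -[RHS]per add0r.
by rewrite subrr add0r => /eqP; rewrite subr_eq0 => /eqP.
Qed.

Lemma cexp_periodic x y : cexp (x +i* (y + 2 * pi)) = cexp (x +i* y).
Proof. by rewrite /cexp /= [2 * pi]mulrC mulr_natr cosD2pi sinD2pi. Qed.

Lemma logpolar_periodic x y :
  logpolar f (x +i* (y + 2 * pi)) = logpolar f (x +i* y).
Proof. by rewrite /logpolar !cexpN cexp_periodic. Qed.

Definition polar_int f x : C :=
  cint lebesgue_measure `[0, 2 * pi] (fun t => logpolar f (x +i* t)).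

Lemma polar_intE x (l : R) : 0 <= l -> polar_int f (x + l) = polar_int f x.
Proof.
move=> l0.
(* For [g = u + i v] the two closed forms are [Im (g dz) = v dx + u dy] and
   [- Re (g dz) = - u dx + v dy]. Their coefficients of [dy] are the real and the imaginary part of
   [g]. *)
apply: complex_ext.
- apply: (@periodic_closed_form
    (fun s t => complex.Im (logpolar f (s +i* t)))
    (fun s t => complex.Re (logpolar f (s +i* t)))) => //.
  + move=> s t; have [d D] := cdiff_logpolar (s +i* t).
    exists (complex.Im d), (complex.Re d), (- complex.Im d); split.
      exact: cdiff_diff2_Im.
    exact: cdiff_diff2_Re.
  + by move=> s t; rewrite logpolar_periodic.
  + exact/ltW/twopi_gt0.
- apply: (@periodic_closed_form
    (fun s t => - complex.Re (logpolar f (s +i* t)))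
    (fun s t => complex.Im (logpolar f (s +i* t)))) => //.
  + move=> s t; have [d D] := cdiff_logpolar (s +i* t).
    exists (- complex.Re d), (complex.Im d), (complex.Re d); split.
      by rewrite -[X in diff2 _ _ _ _ X]opprK; apply: diff2N; exact: cdiff_diff2_Re.
    exact: cdiff_diff2_Im.
  + by move=> s t; rewrite logpolar_periodic.
  + exact/ltW/twopi_gt0.
Qed.

Lemma ccontinuous_logpolar x : ccontinuous (fun t => logpolar f (x +i* t)).
Proof.
split; apply: econt_continuous.
  apply: (@diff2_econtr _ (fun s t => complex.Re (logpolar f (s +i* t)))) => y.
  have [d D] := cdiff_logpolar (x +i* y).
  by exists (complex.Re d), (- complex.Im d); exact: cdiff_diff2_Re.
apply: (@diff2_econtr _ (fun s t => complex.Im (logpolar f (s +i* t)))) => y.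
have [d D] := cdiff_logpolar (x +i* y).
by exists (complex.Im d), (complex.Re d); exact: cdiff_diff2_Im.
Qed.

End cauchy.

Section cauchy_formula.
Context {R : realType}.
Local Notation C := R[i].
Implicit Types (z w h d c : C) (f g : C -> C) (x y s t : R).

(** Moving the abscissa by 1 multiplies the integrand [c * cexp (- w)] by [expR (-1)], yet
    [polar_intE] says that the integral does not change; so it is 0. *)
Lemma polar_int_cst c x : polar_int (fun=> c) x = 0.
Proof.
have dc (z : C) : cdiff (fun=> c) z ((fun=> 0) z) by exact: cdiff_cst.
have E : polar_int (fun=> c) (x + 1) = (expR (-1))%:C * polar_int (fun=> c) x.
  rewrite /polar_int -cintZ//; last first.
    exact/ccontinuous_integrable/(ccontinuous_logpolar dc).
  congr cint; apply/funext => t; rewrite /logpolar mulrCA; congr (_ * _).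
  have -> : - ((x + 1) +i* t) = (-1)%:C + - (x +i* t).
    by apply: complex_ext => /=; ring.
  rewrite cexpD; congr (_ * _); rewrite /cexp /= cos0 sin0 mulr0 mulr1.
  by [].
have := polar_intE dc x ler01; rewrite E => /eqP.
rewrite -subr_eq0 -{2}[polar_int _ _]mul1r -mulrBl mulf_eq0 => /orP[|/eqP//].
rewrite subr_eq0 => /eqP/(congr1 (@complex.Re R)) /= k1.
by have := expR_lt1 (-1 : R); rewrite k1 ltxx ltrN10.
Qed.

Theorem cauchy_derivative0 f f' : (forall z, cdiff f z (f' z)) ->
  cmean (fun t => f (cis t) * cis (- t)) = f' 0.
Proof.
move=> df.
have P0 : polar_int f 0 = cint lebesgue_measure `[0, 2 * pi] (fun t => f (cis t) * cis (- t)).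
  congr cint; apply/funext => t; rewrite /logpolar /cexp /cis /= oppr0 expR0.
  by rewrite !mul1r.
rewrite /cmean -P0; apply/eqP; rewrite -subr_eq0; apply/eqP/eq0_normc/eqP.
rewrite eq_le normc_ge0 andbT; apply/ler_addgt0Pr => e e0; rewrite add0r.
have [r r0 H] := df 0 e e0.
(* The abscissa is nonpositive, so that [polar_intE] compares it with 0, and low enough for the
   circle of radius [expR x] to lie where the expansion of [f] at 0 is valid. *)
pose x := Num.min 0 (ln (r / 2)).
have x0 : x <= 0 by rewrite ge_min lexx.
have xr : expR x < r.
  apply: (@le_lt_trans _ _ (r / 2)); last by rewrite ltr_pdivrMr// ltr_pMr// ltr1n.
  by rewrite -[leRHS]lnK ?posrE ?divr_gt0// ler_expR ge_min lexx orbT.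
have <- : polar_int f x = polar_int f 0.
  by rewrite -[0 in RHS](subrr x) (polar_intE df)// oppr_ge0.
have dc c (z : C) : cdiff (fun=> c) z ((fun=> 0) z) by exact: cdiff_cst.
(* Subtracting the mean of the constant [f 0], which is 0, turns the integrand into the first-order
   remainder of [f] at 0 divided by [cexp w]. *)
have -> : ((2 * pi)^-1)%:C * polar_int f x - f' 0 =
    cmean (fun t => logpolar f (x +i* t) - logpolar (fun=> f 0) (x +i* t) - f' 0).
  have cl := ccontinuous_logpolar df x.
  have cc := ccontinuous_logpolar (dc (f 0)) x.
  have c0 : ccontinuous (fun=> f' 0) by split=> ?; exact: cvg_cst.
  rewrite cmeanB//; last first.
    split=> t.
      by under eq_fun do rewrite ReB; apply: cvgB; [exact: cl.1|exact: cc.1].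
    by under eq_fun do rewrite ImB; apply: cvgB; [exact: cl.2|exact: cc.2].
  rewrite cmeanB// [X in _ - X - _]/cmean -/(polar_int _ _) polar_int_cst.
  rewrite mulr0 subr0; congr (_ - _).
  rewrite /cmean /cint /= -!/(seg _ _ _) !seg_cst ?subr0 ?(ltW twopi_gt0)//.
  have tp := lt0r_neq0 (twopi_gt0 (R := R)).
  by apply: complex_ext => /=; rewrite mul0r ?subr0 ?addr0 mulrCA mulVf ?mulr1.
apply: normc_cmean.
  have cl := ccontinuous_logpolar df x.
  have cc := ccontinuous_logpolar (dc (f 0)) x.
  split=> t.
    under eq_fun do rewrite !ReB.
    apply: cvgB; last exact: cvg_cst.
    by apply: cvgB; [exact: cl.1|exact: cc.1].
  under eq_fun do rewrite !ImB.
  apply: cvgB; last exact: cvg_cst.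
  by apply: cvgB; [exact: cl.2|exact: cc.2].
move=> t; rewrite /logpolar; set w := x +i* t.
have nw : normc (cexp w) = expR x by rewrite normc_cexp.
have := H (cexp w); rewrite nw add0r => /(_ xr) B.
have -> : f (cexp w) * cexp (- w) - f 0 * cexp (- w) - f' 0 =
  (f (cexp w) - f 0 - f' 0 * cexp w) * cexp (- w).
  by rewrite cexpN !mulrBl mulfK// cexp_neq0.
rewrite normcM cexpN normcV nw.
by rewrite ler_pdivrMr ?expR_gt0.
Qed.

Theorem cauchy_derivative f f' z : (forall z, cdiff f z (f' z)) ->
  cmean (fun t => f (z + cis t) * cis (- t)) = f' z.
Proof.
move=> df; rewrite -[in RHS](addr0 z).
apply: (@cauchy_derivative0 (fun w => f (z + w)) (fun w => f' (z + w))) => w.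
rewrite -[f' _]mulr1; apply: (@cdiff_comp _ f (fun w => z + w)); first exact: df.
exact: cdiff_addl.
Qed.

End cauchy_formula.

(** * Mean value and second-order estimates in one complex variable *)

Section second_order.
Context {R : realType}.
Local Notation C := R[i].
Implicit Types (z w h d c a b : C) (f g : C -> C) (x y s t : R) (u v : R -> C).

Lemma near_derive (u : R -> R) (x du : R) :
  (forall e, 0 < e -> exists2 r, 0 < r &
     forall h : R, `|h| < r -> `|u (x + h) - u x - du * h| <= e * `|h|) ->
  is_derive x 1 u du.
Proof.
move=> H.
have cv : h^-1 *: (u (h *: 1 + x) - u x) @[h --> (0:R)^'] --> du.
  apply/cvgrPdist_le => e e0; have [r r0 B] := H e e0.
  exists r => //= h; rewrite /= sub0r normrN => hr h0.
  rewrite -(ler_pM2r (_ : 0 < `|h|)) ?normr_gt0// -normrM.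
  apply: le_trans (B h hr).
  rewrite -normrN /GRing.scale /= mulr1 (addrC x h) le_eqVlt; apply/orP; left.
  by apply/eqP; congr `|_|; rewrite mulrBl mulrAC mulVf// mul1r; ring.
by split; [apply/cvg_ex; exists du|exact/cvg_lim].
Qed.

Definition ucont u := forall t e, 0 < e -> exists2 r, 0 < r &
  forall h : R, `|h| < r -> normc (u (t + h) - u t) <= e.

Lemma ucont_ccontinuous u : ucont u -> ccontinuous u.
Proof.
move=> cu; split; apply: econt_continuous => t e e0.
  have [r r0 H] := cu t e e0; exists r => // h hr.
  by rewrite -ReB (le_trans (normc_Re _))// H.
have [r r0 H] := cu t e e0; exists r => // h hr.
by rewrite -ImB (le_trans (normc_Im _))// H.
Qed.

Lemma normcB_cis t (h : R) : normc (cis (t + h) - cis t) <= normc (cis h - 1).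
Proof.
have -> : cis (t + h) = cis t * cis h.
  by rewrite /cis cosD sinD; apply: complex_ext => /=; ring.
by rewrite -{2}[cis t]mulr1 -mulrBr normcM normc_cis mul1r.
Qed.

Lemma ucont_cis : ucont (@cis R).
Proof.
move=> t e e0; have e2 : 0 < Num.min (e / 4) 1 by rewrite lt_min divr_gt0/=.
have [r1 r10 Cs] := derive_near (is_derive_cos (0:R)) e2.
have [r2 r20 Sn] := derive_near (is_derive_sin (0:R)) e2.
exists (Num.min (Num.min r1 r2) (Num.min (e / 4) 1)).
  by rewrite lt_min e2 lt_min r10 r20.
move=> h; rewrite lt_min => /andP[]; rewrite lt_min => /andP[/Cs A /Sn B] he.
rewrite (le_trans (normcB_cis _ _))// (le_trans (normc_le_ReIm _))//=.
move: A B; rewrite !add0r cos0 sin0 oppr0 mul0r !subr0 addr0 mul1r => A B.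
set k := Num.min (e / 4) 1 in e2 he A B.
have k1 : k <= 1 by rewrite ge_min lexx orbT.
have k2 : k <= e / 4 by rewrite ge_min lexx.
have A' : k * `|h| <= `|h| by rewrite ler_piMl.
have -> : sin h = (sin h - h) + h by ring.
have := ler_normD (sin h - h) h; lra.
Qed.

Lemma ucontM u v : ucont u -> ucont v -> ucont (fun t => u t * v t).
Proof.
move=> cu cv t e e0.
pose a := normc (u t) + 1; pose b := normc (v t) + 1.
have a0 : 0 < a by rewrite ltr_wpDl ?normc_ge0.
have b0 : 0 < b by rewrite ltr_wpDl ?normc_ge0.
have [r1 r10 A] := cu t (Num.min 1 (e / 2 / b)) ltac:(by rewrite lt_min ltr01 !divr_gt0).
have [r2 r20 B] := cv t (e / 2 / a) ltac:(by rewrite !divr_gt0).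
exists (Num.min r1 r2); first by rewrite lt_min r10.
move=> h; rewrite lt_min => /andP[/A A1 /B B1].
have -> : u (t + h) * v (t + h) - u t * v t =
  u (t + h) * (v (t + h) - v t) + (u (t + h) - u t) * v t by ring.
rewrite (le_trans (ler_normcD _ _))// !normcM (splitr e) lerD//.
  have ua : normc (u (t + h)) <= a.
    rewrite -(subrK (u t) (u (t + h))) (le_trans (ler_normcD _ _))// addrC.
    by rewrite lerD2l (le_trans A1)// ge_min lexx.
  apply: (le_trans (y := a * (e / 2 / a))).
    by rewrite ler_pM ?normc_ge0.
  by rewrite mulrC divfK// gt_eqF.
apply: (le_trans (y := e / 2 / b * b)).
  rewrite ler_pM ?normc_ge0//; last by rewrite lerDl.
  by rewrite (le_trans A1)// ge_min lexx orbT.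
by rewrite divfK// gt_eqF.
Qed.

Lemma ucont_cisN : ucont (fun t => cis (- t)).
Proof.
move=> t e e0; have [r r0 H] := ucont_cis (- t) e0.
by exists r => // h hr; rewrite opprD H// normrN.
Qed.

Lemma ucontB u v : ucont u -> ucont v -> ucont (fun t => u t - v t).
Proof.
move=> cu cv t e e0; have e2 : 0 < e / 2 by rewrite divr_gt0.
have [r1 r10 A] := cu t _ e2; have [r2 r20 B] := cv t _ e2.
exists (Num.min r1 r2); first by rewrite lt_min r10.
move=> h; rewrite lt_min => /andP[/A A1 /B B1].
have -> : u (t + h) - v (t + h) - (u t - v t) =
  (u (t + h) - u t) + - (v (t + h) - v t) by ring.
by rewrite (le_trans (ler_normcD _ _))// normcN (splitr e) lerD.
Qed.

Lemma ucont_comp f u : (forall z, exists d, cdiff f z d) -> ucont u ->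
  ucont (fun t => f (u t)).
Proof.
move=> df cu t e e0; have [d /cdiff_bound[r r0 B]] := df (u t).
have d0 : 0 < normc d + 1 by rewrite ltr_wpDl ?normc_ge0.
have k0 : 0 < Num.min (r / 2) (e / (normc d + 1)) by rewrite lt_min !divr_gt0.
have [r1 r10 A] := cu t _ k0; exists r1 => // h /A A1.
have -> : f (u (t + h)) = f (u t + (u (t + h) - u t)) by congr f; ring.
apply: (le_trans (B _ _)).
  apply: (le_lt_trans A1); rewrite (@le_lt_trans _ _ (r / 2))//.
    by rewrite ge_min lexx.
  by rewrite ltr_pdivrMr// ltr_pMr// ltr1n.
rewrite mulrC -ler_pdivlMr// (le_trans A1)//.
by rewrite ge_min lexx orbT.
Qed.

Lemma ucont_addl z u : ucont u -> ucont (fun t => z + u t).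
Proof.
move=> cu t e e0; have [r r0 H] := cu t e e0; exists r => // h /H.
by congr (normc _ <= _); ring.
Qed.

Variables (f fd : C -> C) (df : forall z, cdiff f z (fd z)).

Lemma ucont_cauchy z : ucont (fun t => f (z + cis t) * cis (- t)).
Proof.
apply: ucontM; last exact: ucont_cisN.
apply: ucont_comp; first by move=> w; exists (fd w).
exact/ucont_addl/ucont_cis.
Qed.

Lemma cauchy_bound z (M : R) : (forall w, normc w <= 1 -> normc (f (z + w)) <= M) ->
  normc (fd z) <= M.
Proof.
move=> fM; rewrite -(cauchy_derivative z df); apply: normc_cmean.
  exact/ucont_ccontinuous/ucont_cauchy.
by move=> t; rewrite normcM normc_cis mulr1 fM// normc_cis.
Qed.

(** The real mean value theorem is applied to the real and the imaginary part along the segment. The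
    two intermediate points differ, which costs the factor 2. *)
Lemma complex_MVT a b (K : R) :
  (forall t, 0 <= t <= 1 -> normc (fd (b + t%:C * (a - b))) <= K) ->
  normc (f a - f b) <= 2 * K * normc (a - b).
Proof.
move=> fK; pose g t := b + t%:C * (a - b).
have dg t : cdiff (fun w => f (b + w * (a - b))) t%:C (fd (g t) * (a - b)).
  apply: (@cdiff_comp _ f (fun w => b + w * (a - b))); first exact: df.
  rewrite -[X in cdiff _ _ X]mul1r.
  apply: (@cdiff_comp _ (fun w => b + w) (fun w => w * (a - b))).
    exact: cdiff_addl.
  under [X in cdiff X]funext do rewrite mulrC; exact: cdiff_mull.
have K0 : 0 <= K by apply: le_trans (fK 0 _); rewrite ?normc_ge0// lexx ler01.
have dR t : is_derive t 1 (fun s => complex.Re (f (g s))) (complex.Re (fd (g t) * (a - b))).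
  apply: near_derive => e e0; have [r r0 H] := dg t e e0.
  exists r => // h hr; have := H h%:C; rewrite normc_real => /(_ hr) B.
  rewrite (le_trans _ B)// (le_trans _ (normc_Re _))//.
  rewrite /g !ReB (ReM _ h%:C) /= mulr0 subr0.
  by rewrite (_ : (t + h)%:C = t%:C + h%:C)// rmorphD.
have dI t : is_derive t 1 (fun s => complex.Im (f (g s))) (complex.Im (fd (g t) * (a - b))).
  apply: near_derive => e e0; have [r r0 H] := dg t e e0.
  exists r => // h hr; have := H h%:C; rewrite normc_real => /(_ hr) B.
  rewrite (le_trans _ B)// (le_trans _ (normc_Im _))//.
  rewrite /g !ImB (ImM _ h%:C) /= mulr0 add0r.
  by rewrite (_ : (t + h)%:C = t%:C + h%:C)// rmorphD.
have cdv (q dq : R -> R) : (forall t, is_derive t 1 q (dq t)) ->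
    {within `[0, 1], continuous q}.
  move=> dq'; apply: continuous_subspaceT => t.
  by have [dv _] := dq' t; exact/differentiable_continuous/derivable1_diffP.
have [s1 s1P E1] := MVT_segment ler01 (fun x _ => dR x) (cdv _ _ dR).
have [s2 s2P E2] := MVT_segment ler01 (fun x _ => dI x) (cdv _ _ dI).
move: E1 E2; rewrite /g !subr0 !mulr1 !mul1r !mul0r !addr0 subrKC -ReB -ImB.
move=> E1 E2; rewrite (le_trans (normc_le_ReIm _))// E1 E2.
rewrite -mulrA mulrDl mul1r lerD//.
  by rewrite (le_trans (normc_Re _))// normcM ler_wpM2r ?normc_ge0// fK//.
by rewrite (le_trans (normc_Im _))// normcM ler_wpM2r ?normc_ge0// fK//.
Qed.

End second_order.

Section quadratic_bound.
Context {R : realType}.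
Local Notation C := R[i].
Implicit Types (z w h d c a b : C) (x y s t : R).
Variables (f fd : C -> C) (df : forall z, cdiff f z (fd z)).

Lemma normc_convex a b t (r : R) : 0 <= t <= 1 -> normc a <= r -> normc b <= r ->
  normc (b + t%:C * (a - b)) <= r.
Proof.
move=> /andP[t0 t1] ar br.
have -> : b + t%:C * (a - b) = (1 - t)%:C * b + t%:C * a.
  by rewrite rmorphB rmorph1; ring.
rewrite (le_trans (ler_normcD _ _))// !normcM !normc_real.
rewrite !ger0_norm// ?subr_ge0//.
have -> : r = (1 - t) * r + t * r by ring.
by rewrite lerD// ler_wpM2l// subr_ge0.
Qed.

(** Cauchy's formula takes the place of a second derivative: differences of [fd] are circle means of
    differences of [f], so [fd] is Lipschitz as soon as [f] is. The radii 4, 3 and 2 are those on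
    which [f] is bounded, [f] is Lipschitz, and [fd] is compared with [fd 0]; each circle mean costs
    one unit. *)
Lemma quadratic_bound h (M : R) : (forall w, normc w <= 4 -> normc (f w) <= M) ->
  normc h <= 1 -> normc (f h - f 0 - fd 0 * h) <= 4 * M * normc h ^+ 2.
Proof.
move=> fM h1.
have M0 : 0 <= M by apply: le_trans (fM 0 _); rewrite ?normc_ge0// normc0.
have fd3 w : normc w <= 3 -> normc (fd w) <= M.
  move=> w3; apply: (cauchy_bound df) => v v1; apply: fM.
  rewrite (le_trans (ler_normcD _ _))//; lra.
have lip a b : normc a <= 3 -> normc b <= 3 ->
    normc (f a - f b) <= 2 * M * normc (a - b).
  move=> a3 b3; apply: (complex_MVT df) => t t01.
  by apply: fd3; exact: normc_convex.
have lipd a : normc a <= 2 -> normc (fd a - fd 0) <= 2 * M * normc a.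
  move=> a2; rewrite -(cauchy_derivative a df) -(cauchy_derivative 0 df).
  have c1 := ucont_cauchy df a; have c2 := ucont_cauchy df 0.
  rewrite -cmeanB; [|exact: ucont_ccontinuous..].
  apply: normc_cmean; first exact/ucont_ccontinuous/ucontB.
  move=> t; rewrite -mulrBl normcM normc_cis mulr1.
  have -> : normc a = normc (a + cis t - (0 + cis t)) by congr normc; ring.
  apply: lip; rewrite (le_trans (ler_normcD _ _))// normc_cis ?normc0; lra.
(* Without its linear part the function has derivative [fd z - fd 0], which is of order [normc h]
   along the segment; the mean value estimate supplies the second factor [normc h]. *)
have dg (z : C) : cdiff (fun w => f w - fd 0 * w) z (fd z - fd 0).
  move=> e e0; have [r r0 H] := df z e0; exists r => // k /H.
  by congr (normc _ <= _); ring.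
have := complex_MVT dg (a := h) (b := 0) (K := 2 * M * normc h).
rewrite mulr0 !subr0 expr2.
have -> : f h - fd 0 * h - f 0 = f h - f 0 - fd 0 * h by ring.
have -> : 2 * (2 * M * normc h) * normc h = 4 * M * (normc h * normc h) by ring.
apply=> t /andP[t0 t1]; rewrite add0r.
have nt : normc (t%:C * h) <= normc h.
  by rewrite normcM normc_real ger0_norm// ler_piMl// normc_ge0.
rewrite (le_trans (lipd _ _))//.
  by rewrite (le_trans nt)// (le_trans h1)// ler1n.
by rewrite ler_wpM2l// mulr_ge0.
Qed.

End quadratic_bound.

(** * Entire functions of exponential type *)

Section several_variables.
Context {R : realType} (m : nat).
Local Notation C := R[i].
Local Notation V := 'rV[C]_m.
Implicit Types (z h v : V) (F : V -> C) (D : 'I_m -> V -> C) (j k : 'I_m).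
Implicit Types (w : C) (t : R).

Lemma normr_normc w : `|w| = (normc w)%:C.
Proof. by rewrite normc_def; case: w. Qed.

(** Passes from the differential over the field [C] to derivatives along complex lines, where the
    one-variable Cauchy formula applies. *)
Lemma entire_line F : entire F -> exists L : V -> V -> C,
  (forall z h, L z h = \sum_j h 0 j * L z (delta_mx 0 j)) /\
  (forall z v w, cdiff (fun w => F (z + w *: v)) w (L (z + w *: v) v)).
Proof.
move=> eF; pose G : 'rV[C^o]_m -> C^o := F.
exists (fun z h => 'd G (z : 'rV[C^o]_m) (h : 'rV[C^o]_m)); split.
  move=> z h; rewrite {1}(row_sum_delta h) linear_sum; apply: eq_bigr => j _.
  by rewrite linearZ.
move=> z v w e e0.
have dG := eF (z + w *: v); have := @diff_derivable _ _ _ G (z + w *: v) v dG.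
move=> /cvg_ex[l lP]; have := @deriveE _ _ _ G (z + w *: v) v dG.
rewrite /derive (cvg_lim _ lP)// => El.
have e0' : 0 < (e%:C : C) by rewrite ltcR.
move: lP => /cvgrPdist_le /(_ _ e0') [r /= r0 H].
(* The radius is an element of [C]; being positive there, it has imaginary part 0. *)
move: r0 H; case: r => r ri; rewrite ltcE /= => /andP[/eqP -> r0] H.
exists r => // h hr; rewrite -El.
have [->|h0] := eqVneq h 0.
  by rewrite addr0 mulr0 subr0 subrr normc0 mulr0.
have /H : ball_ Num.Def.normr (0 : C) (r +i* 0) h.
  by rewrite /ball_ /= sub0r normrN normr_normc ltcR.
move=> /(_ h0) B.
have nh : 0 < normc h by rewrite lt_neqAle normc_ge0 andbT eq_sym; apply: contra_neq h0; exact: eq0_normc.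
have {}B : normc (l - h^-1 * (F (h *: v + (z + w *: v)) - F (z + w *: v))) <= e.
  by move: B; rewrite normr_normc lecR.
rewrite -ler_pdivrMr// -normcV -normcM; apply: le_trans B.
rewrite -normcN le_eqVlt; apply/orP; left; apply/eqP; congr normc.
rewrite scalerDl (addrC (h *: v)) addrA [_ / h]mulrC mulrBr (mulrCA _ l) mulVf// mulr1.
by ring.
Qed.

Definition norm1 z : R := \sum_(j < m) normc (z 0 j).

Lemma norm1_ge0 z : 0 <= norm1 z.
Proof. by apply: sumr_ge0 => j _; exact: normc_ge0. Qed.

Lemma norm1_0 : norm1 0 = 0.
Proof. by rewrite /norm1 big1// => j _; rewrite mxE normc0. Qed.

Lemma ler_norm1D z h : norm1 (z + h) <= norm1 z + norm1 h.
Proof.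
by rewrite -big_split; apply: ler_sum => j _; rewrite mxE; exact: ler_normcD.
Qed.

Lemma norm1Z w z : norm1 (w *: z) = normc w * norm1 z.
Proof. by rewrite mulr_sumr; apply: eq_bigr => j _; rewrite mxE normcM. Qed.

Lemma normc_le_norm1 z j : normc (z 0 j) <= norm1 z.
Proof.
by rewrite /norm1 (bigD1 j)//= lerDl sumr_ge0// => k _; exact: normc_ge0.
Qed.

Lemma norm1_delta j : norm1 (delta_mx 0 j) = 1.
Proof.
rewrite /norm1 (bigD1 j)//= mxE !eqxx normc1 big1 ?addr0// => k kj.
by rewrite mxE eqxx (negbTE kj) normc0.
Qed.

Lemma norm1_cis t j : norm1 (cis t *: delta_mx 0 j) = 1.
Proof. by rewrite norm1Z normc_cis norm1_delta mulr1. Qed.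

Lemma norm1_eq0 z : norm1 z = 0 -> z = 0.
Proof.
move=> z0; apply/rowP => j; rewrite mxE; apply: eq0_normc; apply/eqP.
by rewrite eq_le normc_ge0 -z0 normc_le_norm1.
Qed.

Lemma cnorm2_le_norm1 z : cnorm2 z <= norm1 z.
Proof.
rewrite -(@ler_pXn2r _ 2) ?nnegrE ?sqrtr_ge0 ?norm1_ge0//.
rewrite sqr_sqrtr ?sumr_ge0// => [|j _]; last exact: sqr_ge0.
rewrite expr2 /norm1 mulr_suml; apply: ler_sum => j _.
by rewrite expr2 ler_wpM2l ?normc_ge0// normc_le_norm1.
Qed.

(* Growth and a quantitative first-order expansion at once: both survive
   averaging over the circle, which makes the class closed under
   differentiation. *)
Definition expansion F D := exists A K : R, [/\ 0 <= A, 0 <= K,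
  (forall z, normc (F z) <= A * expR (K * norm1 z)) &
  forall z h, norm1 h <= 1 ->
    normc (F (z + h) - F z - \sum_j h 0 j * D j z) <=
    A * expR (K * norm1 z) * norm1 h ^+ 2].

(** Restrict [F] to the complex line through [z] in the direction [h / norm1 h] and apply
    [quadratic_bound]. The type condition at [eps = 1] gives the rate 2; on the disc of radius 4
    this produces [expR 8], while the factor 4 is that of [quadratic_bound]. *)
Lemma entire_expansion F : entire F -> spherical_type 1 F ->
  exists D, expansion F D.
Proof.
move=> eF sF; have [L [L1 L2]] := entire_line eF.
have [C0 C0P] := sF 1 ltr01.
have C00 : 0 <= C0.
  have := C0P 0; rewrite /cnorm2 big1 ?sqrtr0 ?mulr0 ?expR0 ?mulr1.
    by apply: le_trans; exact: normc_ge0.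
  by move=> j _; rewrite mxE normc0 expr0n.
have B z : normc (F z) <= C0 * expR (2 * norm1 z).
  rewrite (le_trans (C0P z))// ler_wpM2l// ler_expR mul1r.
  by rewrite ler_pM// ?cnorm2_le_norm1// sqrtr_ge0.
exists (fun j z => L z (delta_mx 0 j)), (4 * (C0 * expR 8)), 2.
have A0 : 0 <= 4 * (C0 * expR 8) by rewrite !mulr_ge0// expR_ge0.
split => // [z|z h h1].
  rewrite (le_trans (B z))// ler_wpM2r ?expR_ge0//.
  have : 1 <= expR 8 :> R by rewrite -expR0 ler_expR.
  by move=> e8; have : C0 * 1 <= C0 * expR 8 by [rewrite ler_wpM2l]; lra.
have [h0|h0] := eqVneq h 0.
  rewrite h0 norm1_0 expr0n mulr0 addr0 subrr sub0r big1 ?oppr0 ?normc0//.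
  by move=> j _; rewrite mxE mul0r.
have nh : 0 < norm1 h.
  by rewrite lt_neqAle norm1_ge0 andbT eq_sym; apply: contra_neq h0; exact: norm1_eq0.
pose v := (norm1 h)^-1%:C *: h.
have hv : (norm1 h)%:C *: v = h.
  by rewrite /v scalerA -rmorphM /= divff ?gt_eqF// scale1r.
have nv : norm1 v = 1.
  by rewrite /v norm1Z normc_real ger0_norm ?mulVf ?gt_eqF// invr_ge0 ltW.
have := @quadratic_bound _ (fun w => F (z + w *: v)) (fun w => L (z + w *: v) v)
  (L2 z v) (norm1 h)%:C (C0 * expR (2 * (norm1 z + 4))).
rewrite normc_real ger0_norm ?norm1_ge0// hv scale0r addr0 => H.
have -> : \sum_j h 0 j * L z (delta_mx 0 j) = L z v * (norm1 h)%:C.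
  rewrite -L1 L1 [in RHS]L1 mulr_suml; apply: eq_bigr => j _.
  by rewrite -{1}hv mxE; ring.
apply: (le_trans (H _ h1)).
  move=> w w4; rewrite (le_trans (B _))// ler_wpM2l// ler_expR ler_wpM2l//.
  by rewrite (le_trans (ler_norm1D _ _))// lerD2l norm1Z nv mulr1.
rewrite ler_wpM2r ?sqr_ge0// mulrDr expRD.
rewrite (_ : 2 * 4 = 8 :> R); last by ring.
by rewrite le_eqVlt; apply/orP; left; apply/eqP; ring.
Qed.

Lemma expansion_cdiff F D : expansion F D -> forall z j w,
  cdiff (fun w => F (z + w *: delta_mx 0 j)) w (D j (z + w *: delta_mx 0 j)).
Proof.
move=> [A [K [A0 K0 _ H]]] z j w e e0.
set z' := z + w *: _; pose M := A * expR (K * norm1 z') + 1.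
have M0 : 0 < M by rewrite ltr_wpDl// mulr_ge0// expR_ge0.
exists (Num.min 1 (e / M)); first by rewrite lt_min ltr01 divr_gt0.
move=> h; rewrite lt_min => /andP[h1 h2].
have := H z' (h *: delta_mx 0 j); rewrite norm1Z norm1_delta mulr1.
move=> /(_ (ltW h1)).
rewrite scalerDl addrA -/z'.
rewrite (bigD1 j)//= !mxE !eqxx mulr1 big1 ?addr0; last first.
  by move=> k kj; rewrite !mxE (negbTE kj) andbF mulr0 mul0r.
move=> B; rewrite (mulrC (D j z')) (le_trans B)//.
rewrite expr2 mulrA ler_wpM2r ?normc_ge0//.
rewrite mulrC (le_trans (y := normc h * M))//.
  by rewrite ler_wpM2l ?normc_ge0// lerDl.
by rewrite -ler_pdivlMr// ltW.
Qed.

(** Since each [D j] is a circle mean of [F], its growth, continuity and expansion follow by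
    averaging those of [F]. The unit circle raises [norm1] by at most 1, whence the factors [expR K]
    in the estimates below. *)
Lemma expansion_cauchy F D : expansion F D -> forall z j,
  D j z = cmean (fun t => F (z + cis t *: delta_mx 0 j) * cis (- t)).
Proof.
move=> FD z j; have := expansion_cdiff FD z j => dF.
have := cauchy_derivative 0 dF; rewrite scale0r addr0 => <-.
by congr cmean; apply/funext => t; rewrite (add0r (cis t)).
Qed.

Definition mcont F := forall z e, 0 < e -> exists2 r, 0 < r &
  forall h, norm1 h < r -> normc (F (z + h) - F z) <= e.

Lemma ucont_mcont F z j : mcont F ->
  ucont (fun t => F (z + cis t *: delta_mx 0 j)).
Proof.
move=> cF t e e0; have [r r0 H] := cF (z + cis t *: delta_mx 0 j) e e0.
have r2 : 0 < r / 2 by rewrite divr_gt0.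
have [s s0 S] := ucont_cis t r2.
exists s => // h /S hs.
have -> : z + cis (t + h) *: delta_mx 0 j =
    z + cis t *: delta_mx 0 j + (cis (t + h) - cis t) *: delta_mx 0 j.
  by rewrite -addrA -scalerDl; congr (_ + _ *: _); ring.
apply: H; rewrite norm1Z norm1_delta mulr1.
by rewrite (le_lt_trans hs)// ltr_pdivrMr// ltr_pMr// ltr1n.
Qed.

Lemma local_lip_mcont F (A K : R) : 0 <= A ->
  (forall z h, norm1 h <= 1 -> normc (F (z + h) - F z) <=
     A * expR (K * norm1 z) * norm1 h) -> mcont F.
Proof.
move=> A0 H z e e0; pose M := A * expR (K * norm1 z) + 1.
have M0 : 0 < M by rewrite ltr_wpDl// mulr_ge0// expR_ge0.
exists (Num.min 1 (e / M)); first by rewrite lt_min ltr01 divr_gt0.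
move=> h; rewrite lt_min => /andP[h1 h2]; rewrite (le_trans (H _ _ (ltW h1)))//.
apply: (le_trans (y := M * norm1 h)); first by rewrite ler_wpM2r ?norm1_ge0// lerDl.
by rewrite mulrC -ler_pdivlMr// ltW.
Qed.

Lemma expansion_partial_bound F D : expansion F D -> exists A K : R,
  [/\ 0 <= A, 0 <= K & forall z j, normc (D j z) <= A * expR (K * norm1 z)].
Proof.
move=> FD; have [A [K [A0 K0 F1 F2]]] := FD.
exists (A * expR K), K; split => //; first by rewrite mulr_ge0 ?expR_ge0.
move=> z j.
have := cauchy_bound (expansion_cdiff FD z j) (z := 0) (M := A * expR K * expR (K * norm1 z)).
rewrite scale0r addr0; apply => w w1; rewrite add0r (le_trans (F1 _))//.
rewrite -mulrA -expRD ler_wpM2l// ler_expR -[X in _ <= X + _]mulr1 -mulrDr ler_wpM2l//.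
by rewrite (le_trans (ler_norm1D _ _))// addrC lerD2r norm1Z norm1_delta mulr1.
Qed.

Lemma expansion_lip F D : expansion F D -> exists A K : R, [/\ 0 <= A, 0 <= K &
  forall z h, norm1 h <= 1 -> normc (F (z + h) - F z) <=
     A * expR (K * norm1 z) * norm1 h].
Proof.
move=> FD; have [A [K [A0 K0 F1 F2]]] := FD.
have [B [L [B0 L0 D1]]] := expansion_partial_bound FD.
exists (A + B), (K + L); split; rewrite ?addr_ge0// => z h h1.
have nh := norm1_ge0 h.
have eK : expR (K * norm1 z) <= expR ((K + L) * norm1 z).
  by rewrite ler_expR ler_wpM2r ?norm1_ge0// lerDl.
have eL : expR (L * norm1 z) <= expR ((K + L) * norm1 z).
  by rewrite ler_expR ler_wpM2r ?norm1_ge0// lerDr.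
rewrite -(subrK (\sum_j h 0 j * D j z) (_ - F z)) (le_trans (ler_normcD _ _))//.
rewrite (mulrDl A B) (mulrDl (A * _)) lerD//.
  rewrite (le_trans (F2 z h h1))// expr2 mulrA ler_wpM2r//.
  rewrite (le_trans (y := A * expR (K * norm1 z)))//.
    by rewrite ler_piMr// mulr_ge0// expR_ge0.
  exact: ler_wpM2l.
apply: (le_trans (y := \sum_j normc (h 0 j * D j z))).
  elim/big_ind2 : _ => //; first by rewrite normc0.
  by move=> a b c d ab cd; rewrite (le_trans (ler_normcD _ _))// lerD.
rewrite [leRHS]mulrC [X in X * _]/norm1 mulr_suml; apply: ler_sum => j _.
rewrite normcM ler_wpM2l ?normc_ge0// (le_trans (D1 _ _))//.
exact: ler_wpM2l.
Qed.

Lemma expansion_mcont F D : expansion F D -> mcont F.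
Proof. by move=> /expansion_lip[A [K [A0 _ H]]]; exact: local_lip_mcont H. Qed.

Lemma expansion_partial_mcont F D : expansion F D -> forall j, mcont (D j).
Proof.
move=> FD j; have [A [K [A0 K0 H]]] := expansion_lip FD.
have cF := expansion_mcont FD.
apply: (@local_lip_mcont _ (A * expR K) K); first by rewrite mulr_ge0 ?expR_ge0.
move=> z h h1; rewrite !(expansion_cauchy FD).
have uc z' : ucont (fun t => F (z' + cis t *: delta_mx 0 j) * cis (- t)).
  by apply: ucontM; [exact: ucont_mcont|exact: ucont_cisN].
rewrite -cmeanB; [|exact/ucont_ccontinuous..].
apply: normc_cmean; first exact/ucont_ccontinuous/ucontB.
move=> t; rewrite -mulrBl normcM normc_cis mulr1 addrAC (le_trans (H _ _ h1))//.
rewrite ler_wpM2r ?norm1_ge0// -mulrA -expRD ler_wpM2l// ler_expR.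
rewrite -[X in _ <= X + _]mulr1 -mulrDr ler_wpM2l//.
by rewrite (le_trans (ler_norm1D _ _))// norm1_cis addrC.
Qed.

(** The expansion of [D j] is the circle mean of that of [F]. Accordingly its coefficients are the
    circle means of the [D k] in direction [j], that is, the mixed second derivatives. *)
Theorem expansion_partial F D : expansion F D -> forall j, exists D',
  expansion (D j) D'.
Proof.
move=> FD j; have [A [K [A0 K0 F1 F2]]] := FD.
have [B [L [B0 L0 D1]]] := expansion_partial_bound FD.
have cF := expansion_mcont FD.
exists (fun k z => cmean (fun t => D k (z + cis t *: delta_mx 0 j) * cis (- t))).
exists (B + A * expR K), (L + K); split.
- by rewrite addr_ge0// mulr_ge0// expR_ge0.
- by rewrite addr_ge0.
- move=> z; rewrite (le_trans (D1 _ _))// ler_pM ?expR_ge0//.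
    by rewrite lerDl mulr_ge0 ?expR_ge0.
  by rewrite ler_expR ler_wpM2r ?norm1_ge0// lerDl.
move=> z h h1; rewrite !(expansion_cauchy FD).
have uc G z' : mcont G -> ucont (fun t => G (z' + cis t *: delta_mx 0 j) * cis (- t)).
  by move=> cG; apply: ucontM; [exact: ucont_mcont|exact: ucont_cisN].
have cD k := expansion_partial_mcont FD k.
have uS : forall k, ucont (fun t => h 0 k * (D k (z + cis t *: delta_mx 0 j) * cis (- t))).
  move=> k; apply: ucontM; last exact: uc.
  by move=> t e e0; exists 1 => // ? _; rewrite subrr normc0 ltW.
have uSS : ucont (fun t => \sum_k h 0 k * (D k (z + cis t *: delta_mx 0 j) * cis (- t))).
  move: (index_enum _) => r; elim: r => [|k r IH].
    move=> t e e0; exists 1 => // ? _.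
    by rewrite !big_nil subrr normc0 ltW.
  move=> t e e0; have e2 : 0 < e / 2 by rewrite divr_gt0.
  have [r1 r10 R1] := uS k t _ e2; have [r2 r20 R2] := IH t _ e2.
  exists (Num.min r1 r2); first by rewrite lt_min r10.
  move=> s; rewrite lt_min => /andP[/R1 s1 /R2 s2]; rewrite !big_cons.
  rewrite (opprD (h 0 k * _)) addrACA (le_trans (ler_normcD _ _))// (splitr e).
  exact: lerD.
have -> : \sum_k h 0 k * cmean (fun t => D k (z + cis t *: delta_mx 0 j) * cis (- t)) =
    cmean (fun t => \sum_k h 0 k * (D k (z + cis t *: delta_mx 0 j) * cis (- t))).
  rewrite cmean_sum; last by move=> k; exact/ucont_ccontinuous.
  by apply: eq_bigr => k _; rewrite cmeanZ//; exact/ucont_ccontinuous/uc.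
rewrite -cmeanB; [|exact/ucont_ccontinuous/uc..].
rewrite -cmeanB; [|apply: ucont_ccontinuous..]; [|by apply: ucontB; exact: uc|exact: uSS].
apply: normc_cmean; first by apply/ucont_ccontinuous/ucontB => //; apply: ucontB; exact: uc.
move=> t; set z' := z + cis t *: _.
have -> : F (z + h + cis t *: delta_mx 0 j) * cis (- t) - F z' * cis (- t) -
    \sum_k h 0 k * (D k z' * cis (- t)) =
    (F (z' + h) - F z' - \sum_k h 0 k * D k z') * cis (- t).
  rewrite !mulrBl mulr_suml; congr (_ - _); first by rewrite /z' addrAC.
  by apply: eq_bigr => k _; rewrite mulrA.
rewrite normcM normc_cis mulr1 (le_trans (F2 _ _ h1))// ler_wpM2r ?sqr_ge0//.
apply: (le_trans (y := A * expR K * expR (K * norm1 z))).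
  rewrite -mulrA -expRD ler_wpM2l// ler_expR -[X in _ <= X + _]mulr1 -mulrDr ler_wpM2l//.
  by rewrite (le_trans (ler_norm1D _ _))// norm1_cis addrC.
rewrite ler_pM ?expR_ge0 ?mulr_ge0 ?expR_ge0//.
  by rewrite lerDr.
by rewrite ler_expR ler_wpM2r ?norm1_ge0// lerDr.
Qed.

End several_variables.

(** * Lebesgue measure on tuples and the polar formula *)

Section lebesgue_tuple_integral.
Context {R : realType}.
Local Notation T := (measurableTypeR R).
Local Notation leb := (@lebesgue_measure R).

(** Both sides are measures in [A], so half-open intervals suffice. For negative [s] the preimage is
    closed at the other end, with the same length. *)
Lemma lebesgue_affine (s v : R) (A : set R) : s != 0 -> measurable A ->
  leb A = (`|s|%:E * leb ((fun x => (s * x + v)%R) @^-1` A))%E.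
Proof.
move=> s0 mA.
have mf : measurable_fun setT (fun x : T => (s * x + v)%R : T).
  by apply: measurable_funD => //; exact: measurable_funM.
pose pm : {measure set T -> \bar R} :=
  measure_function_pushforward__canonical__measure_function_Measure leb mf.
pose c : {nonneg R} := NngNum (normr_ge0 s).
rewrite (@lebesgue_measure_unique _ (mscale c pm)) => // _ [[a b]] _ <-.
rewrite [RHS](_ : _ =
  (`|s|%:E * leb ((fun x : R => s * x + v)%R @^-1` `]a, b]%classic))%E)//.
have [s_gt0|s_lt0] : (0 < s)%R \/ (s < 0)%R by case: (ltrgtP 0%R s) s0; auto.
  have -> : (fun x : R => s * x + v)%R @^-1` `]a, b]%classic =
      `](a - v) / s, (b - v) / s]%classic.
    apply/seteqP; split => x /=; rewrite !in_itv/= ltr_pdivrMr// ler_pdivlMr//;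
      rewrite ltrBlDr lerBrDr (mulrC x) => //.
  rewrite !lebesgue_measure_itv/= !lte_fin ltr_pM2r ?invr_gt0// ltrD2r.
  case: ifPn => [ab|]; last by rewrite mule0.
  rewrite -!EFinB -EFinM gtr0_norm//; congr EFin.
  by rewrite -mulrBl opprB addrA subrK mulrCA divff// mulr1.
have -> : (fun x : R => s * x + v)%R @^-1` `]a, b]%classic =
    `[(b - v) / s, (a - v) / s[%classic.
  apply/seteqP; split => x /=; rewrite !in_itv/= ltr_ndivlMr// ler_ndivrMr//;
    by rewrite ltrBlDr lerBrDr (mulrC x) andbC.
rewrite !lebesgue_measure_itv/= !lte_fin ltr_nM2r ?invr_lt0// ltrD2r.
case: ifPn => [ab|]; last by rewrite mule0.
rewrite -!EFinB -EFinM ltr0_norm//; congr EFin.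
rewrite -mulrBl opprB addrA subrK mulrCA mulNr divff// mulrN1 opprB.
by [].
Qed.

Local Open Scope ereal_scope.

Lemma integral_affine (s v : R) (h : T -> \bar R) : s != 0%R ->
  measurable_fun setT h -> (forall x, 0 <= h x) ->
  \int[leb]_x h (s * x + v)%R = (`|s|^-1)%:E * \int[leb]_x h x.
Proof.
move=> s0 mh h0.
have mf : measurable_fun setT (fun x : T => (s * x + v)%R : T).
  by apply: measurable_funD => //; exact: measurable_funM.
pose pm : {measure set T -> \bar R} :=
  measure_function_pushforward__canonical__measure_function_Measure leb mf.
pose c : {nonneg R} := NngNum (normr_ge0 s).
have -> : \int[leb]_x h x = \int[mscale c pm]_x h x.
  apply: eq_measure_integral => A mA _.
  exact: (lebesgue_affine v s0 mA).
rewrite ge0_integral_mscale//= muleA -EFinM mulVf ?normr_eq0// mul1e.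
by rewrite /pm ge0_integral_pushforward.
Qed.

Variable n : nat.
Implicit Types (h : n.+1.-tuple T -> \bar R).

Lemma integral_tupleS h : measurable_fun setT h -> (forall t, 0 <= h t) ->
  \int[lebesgue_tuple n.+1]_t h t =
  \int[leb]_x \int[lebesgue_tuple n]_t h (tcons (x, t)).
Proof.
move=> mh h0.
have -> : \int[lebesgue_tuple n.+1]_t h t =
  \int[(leb \x lebesgue_tuple n)]_x (h \o @tcons R n) x.
  have := @ge0_integral_pushforward _ _ _ _ _ _ (@measurable_tcons R n)
    (leb \x lebesgue_tuple n) setT h measurableT mh.
  rewrite preimage_setT => <- //.
rewrite fubini_tonelli1; [by []| |by move=> x; exact: h0].
by apply: measurableT_comp => //; exact: measurable_tcons.
Qed.

Lemma measurable_inner h : measurable_fun setT h -> (forall t, 0 <= h t) ->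
  measurable_fun setT (fun x : T => \int[lebesgue_tuple n]_t h (tcons (x, t))).
Proof.
move=> mh h0.
apply: (@measurable_fun_fubini_tonelli_F _ _ _ _ _ (lebesgue_tuple n)
  (fun xt : T * n.-tuple T => h (tcons xt))) => //.
by apply: measurableT_comp => //; exact: measurable_tcons.
Qed.

End lebesgue_tuple_integral.

Section affine_tuple.
Context {R : realType}.
Local Notation T := (measurableTypeR R).
Local Notation leb := (@lebesgue_measure R).
Local Open Scope ereal_scope.

Definition aff n (s : R) (v : 'I_n -> R) (t : n.-tuple T) : n.-tuple T :=
  [tuple (s * tnth t i + v i)%R | i < n].

Lemma measurable_aff n s v : measurable_fun setT (@aff n s v).
Proof.
apply/measurable_fun_tnthP => i.
rewrite (_ : _ \o _ = fun t => s * tnth t i + v i)%R; last first.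
  by apply/funext => t /=; rewrite tnth_mktuple.
apply: measurable_funD => //; apply: measurable_funM => //.
exact: measurable_tnth.
Qed.

(** The map acts on each coordinate separately, so Tonelli peels off one coordinate at a time, each
    contributing the factor of [integral_affine]. *)
Lemma integral_aff n (s : R) (v : 'I_n -> R) (h : n.-tuple T -> \bar R) :
  s != 0%R -> measurable_fun setT h -> (forall t, 0 <= h t) ->
  \int[lebesgue_tuple n]_t h (aff s v t) =
  (`|s|^-1 ^+ n)%:E * \int[lebesgue_tuple n]_t h t.
Proof.
move=> s0; elim: n v h => [|n IH] v h mh h0.
  rewrite expr0 mul1e; apply: eq_integral => t _.
  by rewrite (tuple0 t) (tuple0 (aff _ _ _)).
have sn : 0 <= (`|s|^-1 ^+ n)%:E by rewrite lee_fin exprn_ge0// invr_ge0.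
rewrite !integral_tupleS//; last first.
  by apply: measurableT_comp => //; exact: measurable_aff.
transitivity (\int[leb]_x ((`|s|^-1 ^+ n)%:E *
    \int[lebesgue_tuple n]_t h (tcons ((s * x + v ord0)%R, t)))).
  apply: eq_integral => x _.
  rewrite -(IH (fun i => v (lift ord0 i)))//; last first.
    apply: (measurableT_comp mh); apply: (measurable_cons (f := fun=> _)) => //=; exact: measurable_id.
  apply: eq_integral => t _; congr (h _); apply: eq_from_tnth => i.
  rewrite tnth_mktuple; case: (unliftP ord0 i) => [j ->|->].
    by rewrite !tnthS tnth_mktuple.
  by rewrite !tnth0.
have mI := measurable_inner mh h0.
have I0 x : 0 <= \int[lebesgue_tuple n]_t h (tcons (x, t)) by exact: integral_ge0.
have mI' : measurable_fun setT (fun x : T =>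
    \int[lebesgue_tuple n]_t h (tcons ((s * x + v ord0)%R, t))).
  apply: (@measurableT_comp _ _ _ _ _ _ (fun x : T => \int[lebesgue_tuple n]_t h (tcons (x, t)))) => //.
  by apply: measurable_funD => //; exact: measurable_funM.
rewrite (ge0_integralZl leb measurableT mI' (fun x _ => I0 _) sn).
rewrite (integral_affine _ s0 mI)// muleA -EFinM -exprSr.
by [].
Qed.

Lemma integral_prod_tuple n (u : T -> R) : measurable_fun setT u ->
  (forall x, (0 <= u x)%R) ->
  \int[lebesgue_tuple n]_t (\prod_(i < n) u (tnth t i))%:E =
  (\int[leb]_x (u x)%:E) ^+ n.
Proof.
move=> mu_ u0; elim: n => [|n IH].
  under eq_integral do rewrite big_ord0.
  rewrite integral_cst// mul1e expe0.
  by rewrite /lebesgue_tuple/= /lebesgue_tuple0 diracT.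
have m_ k : measurable_fun setT (fun t : k.-tuple T => (\prod_(i < k) u (tnth t i))%:E).
  apply/measurable_EFinP; apply: measurable_prod => i _.
  by apply: measurableT_comp => //; exact: measurable_tnth.
rewrite integral_tupleS//; last by move=> t; rewrite lee_fin prodr_ge0.
transitivity (\int[leb]_x ((u x)%:E * (\int[leb]_x (u x)%:E) ^+ n)).
  apply: eq_integral => x _.
  have p0 (t : n.-tuple T) : setT t -> 0 <= (\prod_(i < n) u (tnth t i))%:E.
    by move=> _; rewrite lee_fin prodr_ge0.
  have ux : 0 <= (u x)%:E by rewrite lee_fin.
  rewrite -IH -(ge0_integralZl _ measurableT (m_ n) p0 ux).
  apply: eq_integral => t _; rewrite big_ord_recl tnth0 EFinM.
  by congr (_ * (_)%:E); apply: eq_bigr => i _; rewrite tnthS.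
rewrite ge0_integralZr//; last 3 first.
- exact/measurable_EFinP.
- by move=> x _; rewrite lee_fin.
- by rewrite expe_ge0// integral_ge0// => x _; rewrite lee_fin.
by rewrite expeS.
Qed.

Lemma lebesgue_tuple_cube n (t0 : n.-tuple T) (r : R) : (0 < r)%R ->
  lebesgue_tuple n [set t | forall i, (`|tnth t i - tnth t0 i| < r)%R] > 0.
Proof.
move=> r0.
pose A i : set T := `](tnth t0 i - r)%R, (tnth t0 i + r)%R[%classic.
have -> : [set t : n.-tuple T | forall i, (`|tnth t i - tnth t0 i| < r)%R] =
    [set t | forall i, A i (tnth t i)].
  by apply/seteqP; split => t /= H i; have := H i; rewrite /A /= in_itv/= ltr_distl.
have mA i : measurable (A i) by exact: measurable_itv.
rewrite lebesgue_tuple_box//; apply: (big_ind (fun x => 0 < x)) => // [a b|i _].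
  exact: mule_gt0.
by rewrite lebesgue_measure_itv/= lte_fin ifT -?EFinB ?lte_fin; lra.
Qed.

(** The dimension is a successor because in dimension 0 the measure is a Dirac mass at the only
    point. *)
Lemma lebesgue_tuple_point n (t0 : n.+1.-tuple T) : lebesgue_tuple n.+1 [set t0] = 0.
Proof.
pose A i : set T := [set tnth t0 i].
have -> : [set t0] = [set t : n.+1.-tuple T | forall i, A i (tnth t i)].
  apply/seteqP; split => t /=; first by move=> ->.
  by move=> H; apply: eq_from_tnth.
have mA i : measurable (A i) by exact: measurable_set1.
rewrite lebesgue_tuple_box// big_ord_recl.
by rewrite lebesgue_measure_set1 mul0e.
Qed.

End affine_tuple.

Section continuous_measurable.
Context {R : realType} d {X : measurableType d} (m : nat).
Implicit Types (f : 'rV[R]_m -> R) (u : 'I_m -> X -> R).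

Definition rcont f := forall (x : 'rV[R]_m) (e : R), 0 < e -> exists2 r : R, 0 < r &
  forall y : 'rV[R]_m, (forall j, `|y 0 j - x 0 j| < r) -> `|f y - f x| <= e.

(** Rounding the arguments down to the grid of mesh [1 / (n + 1)] gives functions with countably
    many level sets, which are measurable; by continuity of [f] they converge pointwise. *)
Lemma measurable_rcont f u : rcont f -> (forall j, measurable_fun setT (u j)) ->
  measurable_fun setT (fun x => f (\row_j u j x)).
Proof.
move=> cf mu_.
pose N n x : 'rV[int]_m := \row_j Num.floor (u j x * n.+1%:R).
pose g n (k : 'rV[int]_m) : R := f (\row_j ((k 0 j)%:~R / n.+1%:R)).
apply: (measurable_fun_cvg (h := fun n x => g n (N n x))).
  move=> n; move=> _ Y mY; rewrite setTI.
  pose F (k : 'rV[int]_m) := if g n k \in Y then N n @^-1` [set k] else set0.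
  have -> : (fun x => g n (N n x)) @^-1` Y = \bigcup_k F k.
    apply/seteqP; split => [x Yx|x [k _]].
      by exists (N n x) => //; rewrite /F ifT//; exact/mem_set.
    by rewrite /F; case: ifPn => // /set_mem gk /= ->.
  apply: countable_bigcupT_measurable; first exact: countableP.
  move=> k; rewrite /F; case: ifPn => // _.
  have -> : N n @^-1` [set k] = \bigcap_(j in [set: 'I_m])
      ((u j) @^-1` `[(k 0 j)%:~R / n.+1%:R, (k 0 j + 1)%:~R / n.+1%:R[%classic).
    apply/seteqP; split => x.
      move=> <- j _ /=; rewrite in_itv/= mxE ler_pdivrMr// ltr_pdivlMr//.
      exact: real_floor_itv (num_real _).
    move=> H; apply/rowP => j; rewrite mxE; apply: floor_def.
    by have := H j Logic.I; rewrite /= in_itv/= ler_pdivrMr// ltr_pdivlMr.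
  apply: fin_bigcap_measurable => // j _.
  by rewrite -[_ @^-1` _]setTI; exact: mu_.
move=> x _; apply/cvgrPdist_le => e e0.
have [r r0 H] := cf (\row_j u j x) e e0.
near=> n; rewrite distrC; apply: H => j; rewrite !mxE.
have n0 : 0 < n.+1%:R :> R by [].
have -> : (Num.floor (u j x * n.+1%:R))%:~R / n.+1%:R - u j x =
    - (u j x * n.+1%:R - (Num.floor (u j x * n.+1%:R))%:~R) / n.+1%:R.
  by rewrite opprB mulrBl mulfK// gt_eqF.
rewrite normrM normrN [X in _ * X]gtr0_norm ?invr_gt0// ltr_pdivrMr//.
rewrite ger0_norm ?subr_ge0 ?(real_floor_le (num_real _))//.
apply: (@lt_le_trans _ _ 1).
  by have := real_floorD1_gt (num_real (u j x * n.+1%:R)); rewrite intrD; lra.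
near: n.
exists (Num.bound r^-1) => // n /= nr.
rewrite mulrC -ler_pdivrMr// mul1r ltW//.
apply: (lt_le_trans (archi_boundP _)); first by rewrite invr_ge0 ltW.
by rewrite ler_nat (leq_trans nr).
Unshelve. all: by end_near. Qed.

End continuous_measurable.

Section measurable_tools.
Context {R : realType} d {X : measurableType d}.
Implicit Types f g : X -> R.

Lemma measurable_inv_ge0 f : measurable_fun setT f -> (forall x, 0 <= f x) ->
  measurable_fun setT (fun x => (f x)^-1).
Proof.
move=> mf f0.
have -> : (fun x => (f x)^-1) = (fun x => f x `^ (-1)).
  by apply/funext => x; rewrite powR_inv1.
exact: (measurableT_comp (@measurable_powR R _) mf).
Qed.

Lemma measurable_sqrt f : measurable_fun setT f ->
  measurable_fun setT (fun x => Num.sqrt (f x)).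
Proof.
move=> mf; apply: (measurableT_comp _ mf).
by apply: continuous_measurable_fun; exact: sqrt_continuous.
Qed.

Lemma measurable_expR_comp f : measurable_fun setT f ->
  measurable_fun setT (fun x => expR (f x)).
Proof. by move=> mf; apply: (measurableT_comp _ mf). Qed.

Lemma measurable_powR_comp f p : measurable_fun setT f ->
  measurable_fun setT (fun x => f x `^ p).
Proof. by move=> mf; exact: (measurableT_comp (@measurable_powR R _) mf). Qed.

Lemma measurable_norm_comp f : measurable_fun setT f ->
  measurable_fun setT (fun x => `|f x|).
Proof. by move=> mf; apply: (measurableT_comp _ mf). Qed.

Lemma measurable_pos f : measurable_fun setT f ->
  measurable_fun setT (fun x => (0 < f x)%R%:R : R).
Proof.
move=> mf.
have -> : (fun x => (0 < f x)%R%:R : R) = \1_(f @^-1` `]0, +oo[%classic).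
  apply/funext => x; rewrite indicE; congr (nat_of_bool _)%:R.
  by apply/idP/idP; rewrite inE /= in_itv /= andbT.
apply: measurable_indic; rewrite -[_ @^-1` _]setTI; exact: mf.
Qed.

End measurable_tools.

Section euclidean_norm.
Context {R : realType} (n : nat).
Local Notation T := (measurableTypeR R).
Implicit Types (s r : R) (t y : n.-tuple T).

Definition tsq t : R := \sum_(i < n) tnth t i ^+ 2.
Definition tnorm t : R := Num.sqrt (tsq t).
Definition tscale s t : n.-tuple T := [tuple s * tnth t i | i < n].
(** The direction of [t]; at the origin [0^-1 = 0] makes it the zero vector. *)
Definition tunit t : n.-tuple T := tscale (tnorm t)^-1 t.
Definition gw t : R := expR (- tsq t).

Lemma tsq_ge0 t : 0 <= tsq t.
Proof. by apply: sumr_ge0 => i _; exact: sqr_ge0. Qed.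

Lemma tnorm_ge0 t : 0 <= tnorm t. Proof. exact: sqrtr_ge0. Qed.

Lemma sqr_tnorm t : tnorm t ^+ 2 = tsq t.
Proof. by rewrite sqr_sqrtr// tsq_ge0. Qed.

Lemma tsqZ s t : tsq (tscale s t) = s ^+ 2 * tsq t.
Proof.
by rewrite /tsq mulr_sumr; apply: eq_bigr => i _; rewrite tnth_mktuple exprMn.
Qed.

Lemma tnormZ s t : tnorm (tscale s t) = `|s| * tnorm t.
Proof. by rewrite /tnorm tsqZ sqrtrM ?sqr_ge0// sqrtr_sqr. Qed.

Lemma tscaleA s r t : tscale s (tscale r t) = tscale (s * r) t.
Proof. by apply: eq_from_tnth => i; rewrite !tnth_mktuple mulrA. Qed.

Lemma tscale1 t : tscale 1 t = t.
Proof. by apply: eq_from_tnth => i; rewrite tnth_mktuple mul1r. Qed.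

Lemma gw_ge0 t : 0 <= gw t. Proof. exact: expR_ge0. Qed.

Lemma tscale_aff s t : tscale s t = aff s (fun=> 0) t.
Proof. by apply: eq_from_tnth => i; rewrite !tnth_mktuple addr0. Qed.

Definition tzero : n.-tuple T := [tuple 0 | i < n].

Lemma tnorm_eq0 t : (tnorm t == 0) = (t == tzero).
Proof.
apply/idP/idP => [|/eqP->].
  rewrite sqrtr_eq0 => t0; apply/eqP/eq_from_tnth => i; rewrite tnth_mktuple.
  apply/eqP; rewrite -sqrf_eq0 eq_le sqr_ge0 andbT (le_trans _ t0)//.
  rewrite /tsq (bigD1 i)//= lerDl sumr_ge0// => j _; exact: sqr_ge0.
rewrite /tnorm /tsq big1 ?sqrtr0// => i _.
by rewrite tnth_mktuple expr0n.
Qed.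

Lemma tunitK t : t != tzero -> tscale (tnorm t) (tunit t) = t.
Proof.
by rewrite -tnorm_eq0 => t0; rewrite /tunit tscaleA divff// tscale1.
Qed.

Lemma tnorm_unit t : t != tzero -> tnorm (tunit t) = 1.
Proof.
rewrite -tnorm_eq0 => t0; rewrite tnormZ ger0_norm ?invr_ge0 ?tnorm_ge0//.
by rewrite mulVf.
Qed.

Lemma measurable_tsq : measurable_fun setT tsq.
Proof.
apply: measurable_sum => i; apply: measurable_funX; exact: measurable_tnth.
Qed.

Lemma measurable_tnorm : measurable_fun setT tnorm.
Proof. by apply: measurable_sqrt; exact: measurable_tsq. Qed.

Lemma measurable_gw : measurable_fun setT gw.
Proof.
apply: measurable_expR_comp; apply: measurable_funN; exact: measurable_tsq.
Qed.

Lemma measurable_tscale_comp d (X : measurableType d) (u : X -> R)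
    (v : X -> n.-tuple T) : measurable_fun setT u -> measurable_fun setT v ->
  measurable_fun setT (fun x => tscale (u x) (v x)).
Proof.
move=> mu mv; apply/measurable_fun_tnthP => i.
rewrite (_ : _ \o _ = fun x => u x * tnth (v x) i); last first.
  by apply/funext => x /=; rewrite tnth_mktuple.
apply: measurable_funM => //.
exact: (measurableT_comp (@measurable_tnth _ _ _ i) mv).
Qed.

Lemma measurable_tunit : measurable_fun setT tunit.
Proof.
apply: measurable_tscale_comp => //.
by apply: measurable_inv_ge0; [exact: measurable_tnorm|exact: tnorm_ge0].
Qed.

Local Open Scope ereal_scope.

Lemma integral_tscale (s : R) (h : n.-tuple T -> \bar R) : (0 < s)%R ->
  measurable_fun setT h -> (forall t, 0 <= h t) ->
  \int[lebesgue_tuple n]_t h (tscale s t) =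
  (s ^- n)%:E * \int[lebesgue_tuple n]_t h t.
Proof.
move=> s0 mh h0; under eq_integral do rewrite tscale_aff.
by rewrite integral_aff ?gt_eqF// gtr0_norm// exprVn.
Qed.

Lemma integral_gw : \int[lebesgue_tuple n]_t (gw t)%:E = (Num.sqrt pi ^+ n)%:E.
Proof.
transitivity (\int[@lebesgue_tuple R n]_t (\prod_(i < n) gauss_fun (tnth t i))%:E).
  apply: eq_integral => t _; by rewrite /gw /tsq -sumrN expR_sum.

rewrite integral_prod_tuple ?integralT_gauss ?EFin_expe//.
  exact: measurable_gauss_fun.
by move=> x; exact: gauss_fun_ge0.
Qed.

End euclidean_norm.

Section half_line.
Context {R : realType}.
Local Notation T := (measurableTypeR R).
Local Notation leb := (@lebesgue_measure R).
Implicit Types (F : R -> R) (c s : R).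
Local Open Scope ereal_scope.

(** The half line is encoded by a factor of the integrand, so that the affine change of variables
    and Tonelli's theorem apply to integrals over the whole line. *)
Definition pos s : R := (0 < s)%R%:R.

Definition half_int F := \int[leb]_s (pos s * F s)%:E.

Lemma pos_ge0 s : (0 <= pos s)%R. Proof. by rewrite /pos; case: (0 < s)%R. Qed.

Lemma posT s : (0 < s)%R -> pos s = 1%R. Proof. by rewrite /pos => ->. Qed.

Lemma posF s : (s <= 0)%R -> pos s = 0%R.
Proof. by rewrite /pos leNgt => /negbTE ->. Qed.

Lemma posM_ge0 s (a : R) : (0 < s -> 0 <= a)%R -> (0 <= pos s * a)%R.
Proof.
by case: (ltP 0%R s) => [s0 /(_ isT) a0|/posF ->]; rewrite ?posT ?mul1r ?mul0r.
Qed.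

Lemma half_intE F : half_int F = \int[leb]_(s in `]0%R, +oo[) (F s)%:E.
Proof.
rewrite [RHS]integral_mkcond; apply: eq_integral => s _.
rewrite patchE; case: ifPn; rewrite ?inE ?notin_setE /= in_itv /= andbT.
  by move=> s0; rewrite posT// mul1r.
by move=> /negP; rewrite -leNgt => s0; rewrite posF// mul0r.
Qed.

Lemma half_int_scale c F : (0 < c)%R -> measurable_fun setT F ->
  (forall s, 0 < s -> 0 <= F s)%R ->
  half_int (fun s => F (c * s))%R = (c^-1)%:E * half_int F.
Proof.
move=> c0 mF F0; rewrite /half_int.
have mh : measurable_fun setT (fun s : T => (pos s * F s)%:E).
  apply/measurable_EFinP; apply: measurable_funM => //.
  exact: measurable_pos.
have h0 s : 0 <= (pos s * F s)%:E.
  by rewrite lee_fin posM_ge0// => /F0.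
have := @integral_affine _ c 0 _ (lt0r_neq0 c0) mh h0.
rewrite gtr0_norm// => <-; apply: eq_integral => s _.
by rewrite addr0 /pos pmulr_rgt0.
Qed.

Lemma half_intZ c F : (0 <= c)%R -> measurable_fun setT F ->
  (forall s, 0 < s -> 0 <= F s)%R ->
  half_int (fun s => c * F s)%R = c%:E * half_int F.
Proof.
move=> c0 mF F0; rewrite /half_int -ge0_integralZl//.
- by apply: eq_integral => s _; rewrite -EFinM mulrCA.
- apply/measurable_EFinP; apply: measurable_funM => //; exact: measurable_pos.
- by move=> s _; rewrite lee_fin posM_ge0// => /F0.
Qed.

Lemma eq_half_int F G : (forall s, 0 < s -> F s = G s)%R ->
  half_int F = half_int G.
Proof.
move=> FG; apply: eq_integral => s _; congr EFin.
by case: (ltP 0%R s) => [/FG ->//|/posF ->]; rewrite !mul0r.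
Qed.

End half_line.

Section polar.
Context {R : realType} (n : nat).
Local Notation T := (measurableTypeR R).
Local Notation leb := (@lebesgue_measure R).
Local Notation mu := (lebesgue_tuple n.+1).
Implicit Types (h : n.+1.-tuple T -> R) (t y : n.+1.-tuple T) (r s : R).
Local Open Scope ereal_scope.

Lemma tonelli_half (F : R -> n.+1.-tuple T -> R) :
  measurable_fun setT (fun z : T * n.+1.-tuple T => F z.1 z.2) ->
  (forall s y, 0 < s -> 0 <= F s y)%R ->
  \int[leb]_s \int[mu]_y (pos s * F s y)%:E = \int[mu]_y half_int (F ^~ y).
Proof.
move=> mF F0.
rewrite (@fubini_tonelli _ _ _ _ _ leb mu (fun z => (pos z.1 * F z.1 z.2)%:E))//.
  apply/measurable_EFinP; apply: measurable_funM => //.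
  exact: (@measurable_pos _ _ _ fst).
by move=> [s y]; rewrite lee_fin posM_ge0// => /F0.
Qed.

Lemma half_int_int (F : R -> n.+1.-tuple T -> R) :
  measurable_fun setT (fun z : T * n.+1.-tuple T => F z.1 z.2) ->
  (forall s y, 0 < s -> 0 <= F s y)%R ->
  \int[leb]_s ((pos s)%:E * \int[mu]_y (F s y)%:E) = \int[mu]_y half_int (F ^~ y).
Proof.
move=> mF F0; rewrite -tonelli_half//; apply: eq_integral => s _.
case: (ltP 0%R s) => [/posT|/posF] ->.
  by rewrite mul1e; apply: eq_integral => y _; rewrite mul1r.
by rewrite mul0e integral0_eq// => y _; rewrite mul0r.
Qed.

(* A Gaussian vector has a uniform direction, so this is, up to a constant, the mean of [h]
   over the sphere of radius [r]; no surface measure is needed. *)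
Definition sphere_int h r := \int[mu]_y (gw y * h (tscale r (tunit y)))%:E.

Lemma not_tzero_ae (P : n.+1.-tuple T -> Prop) :
  (forall y, y != tzero n.+1 -> P y) -> {ae mu, forall y, P y}.
Proof.
move=> H; exists [set tzero n.+1]; split.
- have -> : [set tzero n.+1] = [set t : n.+1.-tuple T | tnorm t = 0%R].
    apply/seteqP; split => t /= /eqP; rewrite -?tnorm_eq0 => /eqP //.
    by move=> /eqP; rewrite tnorm_eq0 => /eqP.
  have -> : [set t : n.+1.-tuple T | tnorm t = 0%R] = tnorm (n:=n.+1) @^-1` [set 0%R] by [].
  by rewrite -[_ @^-1` _]setTI; apply: measurable_tnorm.
- exact: lebesgue_tuple_point.
- by move=> y /= nP; apply/eqP; apply/negP => /negP /H.
Qed.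

End polar.

(** * The polar formula *)

Section polar_formula.
Context {R : realType} (n : nat).
Local Notation T := (measurableTypeR R).
Local Notation leb := (@lebesgue_measure R).
Local Notation mu := (@lebesgue_tuple R n.+1).
Implicit Types (h : n.+1.-tuple T -> R) (t y : n.+1.-tuple T) (r s : R).

Lemma measurable_inv d (X : measurableType d) (f : X -> R) :
  measurable_fun setT f -> measurable_fun setT (fun x => (f x)^-1).
Proof.
move=> mf; have -> : (fun x => (f x)^-1) = (fun x => f x * (f x ^+ 2)^-1).
  apply/funext => x; have [->|f0] := eqVneq (f x) 0; first by rewrite invr0 mul0r.
  by rewrite expr2 invfM mulrA divff// mul1r.
apply: measurable_funM => //; apply: measurable_inv_ge0.
  exact: measurable_funX.
by move=> x; exact: sqr_ge0.
Qed.

Lemma measurable_half_int (F : R -> n.+1.-tuple T -> R) :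
  measurable_fun setT (fun z : T * n.+1.-tuple T => F z.1 z.2) ->
  (forall s y, 0 < s -> 0 <= F s y) ->
  measurable_fun setT (fun y => half_int (F ^~ y)).
Proof.
move=> mF F0.
apply: (@measurable_fun_fubini_tonelli_G _ _ _ _ _ leb
  (fun z : T * n.+1.-tuple T => (pos z.1 * F z.1 z.2)%:E)).
  apply/measurable_EFinP; apply: measurable_funM => //.
  exact: (@measurable_pos _ _ _ fst).
by move=> [s y]; rewrite lee_fin posM_ge0// => /F0.
Qed.

Lemma half_int_ge0 (F : R -> R) : (forall s, 0 < s -> 0 <= F s) ->
  (0 <= half_int F)%E.
Proof.
by move=> F0; apply: integral_ge0 => s _; rewrite lee_fin posM_ge0// => /F0.
Qed.

Lemma sphere_int_ge0 h r : (forall t, 0 <= h t) -> (0 <= sphere_int h r)%E.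
Proof.
by move=> h0; apply: integral_ge0 => y _; rewrite lee_fin mulr_ge0// gw_ge0.
Qed.

Definition sphere_meas d (X : measurableType d) (u : X -> R) (v : X -> n.+1.-tuple T) h :
  measurable_fun setT u -> measurable_fun setT v -> measurable_fun setT h ->
  measurable_fun setT (fun x => h (tscale (u x) (v x))).
Proof.
move=> mu_ mv mh.
apply: (measurableT_comp (f := h) (g := fun x => tscale (u x) (v x)) mh).
exact: measurable_tscale_comp.
Qed.

(** The function of [s] that remains once both scalings are done; [polar_kappaG] evaluates its
    integral. *)
Let G s := s^-1 * (expR (- s^-1 ^+ 2) * s^-1 ^+ n.+1).

Lemma polar_measurable_G : measurable_fun setT G.
Proof.
have mi : measurable_fun setT (fun s : T => s^-1 : T) by exact: measurable_inv.
apply: measurable_funM => //; apply: measurable_funM.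
  apply: measurable_expR_comp; apply: measurable_funN; exact: measurable_funX.
exact: measurable_funX.
Qed.

Section fixed_function.
Variable h : n.+1.-tuple T -> R.
Hypothesis mh : measurable_fun setT h.
Hypothesis h0 : forall t, 0 <= h t.

(** [A] is the integrand of the polar formula; scaling [s] by [tnorm y] turns it into [B], scaling
    [y] by [s^-1] turns [B] into [C], and in [C] the function [h] is evaluated at [y] alone. *)
Let A s y := s ^+ n * (gw y * h (tscale s (tunit y))).
Let B s y := s ^+ n * (gw y * tnorm y ^+ n.+1 * h (tscale s y)).
Let C s y := h y * (s^-1 * (gw (tscale s^-1 y) * tnorm (tscale s^-1 y) ^+ n.+1)).

Lemma polar_m1 : measurable_fun setT (fst : T * n.+1.-tuple T -> T).
Proof. exact: measurable_fst. Qed.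

Lemma polar_m2 : measurable_fun setT (snd : T * n.+1.-tuple T -> n.+1.-tuple T).
Proof. exact: measurable_snd. Qed.

Lemma polar_mA : measurable_fun setT (fun z : T * n.+1.-tuple T => A z.1 z.2).
Proof.
apply: measurable_funM; first exact: (measurable_funX n polar_m1).
apply: measurable_funM.
  by apply: (measurableT_comp (f := @gw R n.+1) _ polar_m2); exact: measurable_gw.
apply: sphere_meas => //.
by apply: (measurableT_comp (f := @tunit R n.+1) _ polar_m2); exact: measurable_tunit.
Qed.

Lemma polar_mB : measurable_fun setT (fun z : T * n.+1.-tuple T => B z.1 z.2).
Proof.
apply: measurable_funM; first exact: (measurable_funX n polar_m1).
apply: measurable_funM.
  apply: measurable_funM.
    by apply: (measurableT_comp (f := @gw R n.+1) _ polar_m2); exact: measurable_gw.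
  apply: measurable_funX.
  by apply: (measurableT_comp (f := @tnorm R n.+1) _ polar_m2); exact: measurable_tnorm.
exact: sphere_meas.
Qed.

Lemma polar_mC : measurable_fun setT (fun z : T * n.+1.-tuple T => C z.1 z.2).
Proof.
have mi : measurable_fun setT (fun z : T * n.+1.-tuple T => z.1^-1 : R).
  exact: measurable_inv.
apply: measurable_funM; first exact: (measurableT_comp (f := h) mh polar_m2).
apply: measurable_funM => //; apply: measurable_funM.
  by apply: sphere_meas => //; exact: measurable_gw.
by apply: measurable_funX; apply: sphere_meas => //; exact: measurable_tnorm.
Qed.

Lemma polar_A0 s y : 0 < s -> 0 <= A s y.
Proof. by move=> s0; rewrite !mulr_ge0 ?exprn_ge0 ?gw_ge0// ltW. Qed.

Lemma polar_B0 s y : 0 < s -> 0 <= B s y.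
Proof.
by move=> s0; rewrite !mulr_ge0 ?exprn_ge0 ?gw_ge0 ?tnorm_ge0// ltW.
Qed.

Lemma polar_C0 s y : 0 < s -> 0 <= C s y.
Proof.
move=> s0.
by rewrite !mulr_ge0 ?exprn_ge0 ?gw_ge0 ?tnorm_ge0 ?invr_ge0// ltW.
Qed.

Local Open Scope ereal_scope.

(* Polar coordinates from scalings only: compute the integral of [B] over [s] and [y],
   once with [s = r / tnorm y] and once with [y] replaced by [y / s]. *)
Lemma polar_AB : \int[mu]_y half_int (A ^~ y) = \int[mu]_y half_int (B ^~ y).
Proof.
apply: ge0_ae_eq_integral => //.
- exact: (measurable_half_int polar_mA polar_A0).
- exact: (measurable_half_int polar_mB polar_B0).
- by move=> y _; apply: half_int_ge0 => s; exact: polar_A0.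
- by move=> y _; apply: half_int_ge0 => s; exact: polar_B0.
apply: not_tzero_ae => y y0 _.
have ty : (0 < tnorm y)%R by rewrite lt_neqAle tnorm_ge0 eq_sym tnorm_eq0 y0.
have mAy : measurable_fun setT (A ^~ y).
  exact: (measurableT_comp (f := fun z : T * n.+1.-tuple T => A z.1 z.2) polar_mA (pair2_measurable y)).
have mAy' : measurable_fun setT (fun s : T => A (tnorm y * s)%R y).
  by apply: (measurableT_comp (f := A ^~ y) mAy); exact: measurable_funM.
have E := half_int_scale ty mAy (fun s => @polar_A0 s y).
have -> : half_int (A ^~ y) = (tnorm y)%:E * half_int (fun s => A (tnorm y * s)%R y).
  by rewrite E muleA -EFinM divff ?gt_eqF// mul1e.
rewrite -half_intZ//; first last.
- by move=> s s0; apply: polar_A0; rewrite mulr_gt0.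
- exact: ltW.
apply: eq_half_int => s s0; rewrite /A /B.
rewrite [in RHS](_ : tscale s y = tscale (tnorm y * s)%R (tunit y)); last first.
  by rewrite mulrC -tscaleA tunitK.
by rewrite exprMn exprSr; ring.
Qed.

Lemma polar_BC : \int[leb]_s ((pos s)%:E * \int[mu]_y (B s y)%:E) =
  \int[leb]_s ((pos s)%:E * \int[mu]_y (C s y)%:E).
Proof.
apply: eq_integral => s _; case: (ltP 0%R s) => [s0|/posF -> //]; last by rewrite !mul0e.
congr (_ * _).
pose K y : R := (s ^+ n * (gw (tscale s^-1 y) * tnorm (tscale s^-1 y) ^+ n.+1 * h y))%R.
have mK : measurable_fun setT (fun y => (K y)%:E).
  apply/measurable_EFinP; apply: measurable_funM => //; apply: measurable_funM => //.
  apply: measurable_funM.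
    by apply: sphere_meas => //; exact: measurable_gw.
  by apply: measurable_funX; apply: sphere_meas => //; exact: measurable_tnorm.
have K0 y : 0 <= (K y)%:E.
  by rewrite lee_fin !mulr_ge0 ?exprn_ge0 ?gw_ge0 ?tnorm_ge0// ltW.
transitivity (\int[mu]_y (K (tscale s y))%:E).
  apply: eq_integral => y _; congr EFin; rewrite /B /K tscaleA mulVf ?gt_eqF//.
  by rewrite tscale1.
rewrite (integral_tscale s0 mK K0) -ge0_integralZl//; last first.
  by rewrite lee_fin invr_ge0 exprn_ge0// ltW.
apply: eq_integral => y _; rewrite -EFinM; congr EFin; rewrite /K /C exprS.
have sn0 : (s ^+ n != 0)%R by rewrite expf_neq0// gt_eqF.
by field; rewrite sn0 gt_eqF.
Qed.

(** Off the origin [C s y = h y / tnorm y * G (s / tnorm y)], so scaling [s] by [tnorm y] removes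
    [y] from the integral over [s]. *)
Lemma polar_CG : \int[mu]_y half_int (C ^~ y) = half_int G * \int[mu]_y (h y)%:E.
Proof.
have G0 s : (0 < s -> 0 <= G s)%R.
  by move=> s0; rewrite !mulr_ge0 ?expR_ge0 ?exprn_ge0 ?invr_ge0// ltW.
rewrite -ge0_integralZl//; first last.
- exact: half_int_ge0.
- by move=> y _; rewrite lee_fin.
- exact/measurable_EFinP.
apply: ge0_ae_eq_integral => //.
- exact: (measurable_half_int polar_mC polar_C0).
- by apply: emeasurable_funM => //; exact/measurable_EFinP.
- by move=> y _; apply: half_int_ge0 => s; exact: polar_C0.
- by move=> y _; rewrite mule_ge0 ?half_int_ge0// lee_fin.
apply: not_tzero_ae => y y0 _.
have ty : (0 < tnorm y)%R by rewrite lt_neqAle tnorm_ge0 eq_sym tnorm_eq0 y0.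
have ti : (0 < (tnorm y)^-1)%R by rewrite invr_gt0.
have mG' : measurable_fun setT (fun s : T => G ((tnorm y)^-1 * s)%R).
  by apply: (measurableT_comp (f := G) polar_measurable_G); exact: measurable_funM.
have E := half_int_scale ti polar_measurable_G G0.
transitivity (half_int (fun s => (h y * (tnorm y)^-1) * G ((tnorm y)^-1 * s)))%R.
  apply: eq_half_int => s s0; rewrite /C /G /gw tsqZ -sqr_tnorm tnormZ.
  rewrite ger0_norm ?invr_ge0 ?(ltW s0)// invfM invrK -exprMn (mulrC (tnorm y)).
  have := lt0r_neq0 ty; have := lt0r_neq0 s0 => s1 t1.
  by move: (expR _) (_ ^+ n.+1)%R => a b; field; rewrite ?s1 ?t1.
rewrite half_intZ//; first last.
- by move=> s s0; apply: G0; rewrite mulr_gt0.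
- by rewrite mulr_ge0// ltW.
rewrite E invrK muleA -EFinM -mulrA mulVf ?gt_eqF// mulr1.
by rewrite muleC.
Qed.

Lemma polar_aux :
  \int[leb]_r ((pos r * r ^+ n)%:E * sphere_int h r) =
  half_int G * \int[mu]_y (h y)%:E.
Proof.
rewrite -polar_CG -(half_int_int polar_mC polar_C0) -polar_BC (half_int_int polar_mB polar_B0) -polar_AB.
rewrite -(half_int_int polar_mA polar_A0); apply: eq_integral => r _.
case: (ltP 0%R r) => [r0|/posF ->]; last by rewrite !mul0r !mul0e.
rewrite posT// mul1r mul1e -ge0_integralZl//; first last.
- by rewrite lee_fin exprn_ge0// ltW.
- by move=> y _; rewrite lee_fin mulr_ge0// gw_ge0.
apply/measurable_EFinP; apply: measurable_funM; first exact: measurable_gw.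
by apply: sphere_meas => //; exact: measurable_tunit.
Qed.

End fixed_function.

Local Open Scope ereal_scope.

(** Mathematically [Gamma ((n + 1) / 2) / 2], where [n + 1] is the dimension. *)
Definition kappa : \bar R := half_int (fun r => r ^+ n * expR (- r ^+ 2))%R.

(** The constant is found by testing [polar_aux] on the Gaussian itself, which is radial and whose
    finite positive mass cancels from both sides. *)
Lemma polar_kappaG : half_int G = kappa.
Proof.
pose c : R := (Num.sqrt pi ^+ n.+1)%R.
have c0 : (0 < c)%R by rewrite exprn_gt0// sqrtr_gt0 pi_gt0.
have mg : measurable_fun setT (fun y : n.+1.-tuple T => (gw y)%:E : \bar R).
  by apply/measurable_EFinP; exact: measurable_gw.
have g0 (y : n.+1.-tuple T) : setT y -> 0 <= (gw y)%:E by rewrite lee_fin gw_ge0.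
have E r : sphere_int (@gw R n.+1) r = (expR (- r ^+ 2))%:E * c%:E.
  have e0 : 0 <= (expR (- r ^+ 2))%:E by rewrite lee_fin expR_ge0.
  rewrite /c -integral_gw -(ge0_integralZl _ measurableT mg g0 e0).
  apply: ge0_ae_eq_integral => //.
  - apply/measurable_EFinP; apply: measurable_funM; first exact: measurable_gw.
    by apply: sphere_meas => //; [exact: measurable_tunit|exact: measurable_gw].
  - by apply: measurable_funeM; apply/measurable_EFinP; exact: measurable_gw.
  - by move=> y _; rewrite lee_fin mulr_ge0// gw_ge0.
  - by move=> y _; apply: mule_ge0 => //; exact: g0.
  apply: not_tzero_ae => y y0 _; rewrite -EFinM; congr EFin.
  by rewrite mulrC {1}/gw tsqZ -sqr_tnorm tnorm_unit// expr1n mulr1.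
have := @polar_aux _ (@measurable_gw R n.+1) (@gw_ge0 R n.+1).
rewrite integral_gw -/c => P.
have K0 r : setT r -> 0 <= (pos r * (r ^+ n * expR (- r ^+ 2)))%:E.
  move=> _; rewrite lee_fin posM_ge0// => r0.
  by rewrite mulr_ge0 ?expR_ge0// exprn_ge0// ltW.
have mK : measurable_fun setT (fun r : T => (pos r * (r ^+ n * expR (- r ^+ 2)))%:E).
  apply/measurable_EFinP; apply: measurable_funM; first exact: measurable_pos.
  apply: measurable_funM; first exact: exprn_measurable.
  by apply: measurable_expR_comp; apply: measurable_funN; exact: measurable_funX.
have c0' : 0 <= c%:E by rewrite lee_fin ltW.
have : kappa * c%:E = half_int G * c%:E.
  rewrite -P -(ge0_integralZr _ measurableT mK K0 c0').
  by apply: eq_integral => r _; rewrite E muleA -EFinM mulrA.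
move=> /(congr1 (fun x => x * (c^-1)%:E)).
by rewrite -!muleA -!EFinM divff ?gt_eqF// !mule1.
Qed.

Lemma polar h : measurable_fun setT h -> (forall t, 0 <= h t)%R ->
  \int[leb]_r ((pos r * r ^+ n)%:E * sphere_int h r) =
  kappa * \int[mu]_y (h y)%:E.
Proof. by move=> mh h0; rewrite polar_aux// polar_kappaG. Qed.

End polar_formula.

(** * Gaussian domination and the value of the radial constant *)

Section gaussian_moments.
Context {R : realType}.
Local Notation T := (measurableTypeR R).
Local Notation leb := (@lebesgue_measure R).

(** The two terms of the constant come from [x ^+ k <= 1 + (x ^+ k) ^+ 2] and from the term of order
    [k] in the exponential series at [x ^+ 2 / 2]. *)
Lemma pow_le_expR k : exists2 C : R, 0 < C &
  forall x : R, 0 <= x -> x ^+ k <= C * expR (x ^+ 2 / 2).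
Proof.
exists (1 + 2 ^+ k * k`!%:R); first by rewrite ltr_pwDl// mulr_ge0// exprn_ge0.
move=> x x0; have y0 : 0 <= x ^+ 2 / 2 by rewrite divr_ge0// sqr_ge0.
have e1 : 1 <= expR (x ^+ 2 / 2) by rewrite -[leLHS]expR0 ler_expR.
have E : (x ^+ 2 / 2) ^+ k / k`!%:R <= expR (x ^+ 2 / 2).
  case: k => [|k]; first by rewrite expr0 fact0 divr1.
  by rewrite (le_trans _ (expR_ge1Dxn k y0))// lerDr.
have f0 : 0 < k`!%:R :> R by rewrite ltr0n fact_gt0.
have xk : x ^+ k <= 1 + x ^+ k ^+ 2.
  have := sqr_ge0 (x ^+ k - 1); have := sqr_ge0 (x ^+ k + 1).
  by rewrite !expr2; lra.
rewrite (le_trans xk)// mulrDl mul1r lerD// -exprM mulnC exprM.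
move: E; rewrite ler_pdivrMr// expr_div_n ler_pdivrMr ?exprn_gt0//.
by move=> /le_trans; apply; rewrite le_eqVlt; apply/orP; left; apply/eqP; ring.
Qed.

Local Open Scope ereal_scope.

Lemma integral_gauss_half :
  \int[leb]_x (expR (- (x ^+ 2 / 2)))%:E = (Num.sqrt 2 * Num.sqrt pi)%:E.
Proof.
have s0 : (0 < Num.sqrt 2 :> R)%R by rewrite sqrtr_gt0.
have si : ((Num.sqrt 2)^-1 != 0 :> R)%R by rewrite invr_neq0// gt_eqF.
have mg : measurable_fun setT (EFin \o (@gauss_fun R)).
  by apply/measurable_EFinP; exact: measurable_gauss_fun.
have g0 (x : T) : 0 <= (EFin \o @gauss_fun R) x by rewrite lee_fin gauss_fun_ge0.
have := integral_affine 0 si mg g0; rewrite /= integralT_gauss.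
rewrite ger0_norm ?invr_ge0 ?(ltW s0)// invrK -EFinM => <-.
apply: eq_integral => x _; congr EFin.
by rewrite addr0 /gauss_fun exprMn exprVn sqr_sqrtr// mulrC.
Qed.

Lemma integral_gw_half n :
  \int[@lebesgue_tuple R n]_t (expR (- (tsq t / 2)))%:E =
  ((Num.sqrt 2 * Num.sqrt pi) ^+ n)%:E.
Proof.
transitivity (\int[@lebesgue_tuple R n]_t (\prod_(i < n) expR (- (tnth t i ^+ 2 / 2)))%:E).
  by apply: eq_integral => t _; rewrite -expR_sum sumrN -mulr_suml.
rewrite (@integral_prod_tuple R n (fun x => expR (- (x ^+ 2 / 2)))).
- by rewrite integral_gauss_half EFin_expe.
- apply: measurable_expR_comp; apply: measurable_funN.
  by apply: measurable_funM => //; exact: exprn_measurable.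
- by move=> x; exact: expR_ge0.
Qed.

(** By [(a - tnorm t) ^+ 2 >= 0], half of the Gaussian exponent absorbs [expR (a * tnorm t)] at the
    cost of the constant [expR (a ^+ 2 / 2)]. This is the integrability criterion for all the
    Gaussian integrals below. *)
Lemma gw_integrable n (f : n.-tuple T -> R) (C a : R) :
  measurable_fun setT f -> (forall t, `|f t| <= C * expR (a * tnorm t))%R ->
  (@lebesgue_tuple R n).-integrable setT (EFin \o (fun t => gw t * f t)%R).
Proof.
move=> mf fC.
have C0 : (0 <= C)%R.
  have := fC (@tzero R n).
  have -> : tnorm (@tzero R n) = 0%R by apply/eqP; rewrite tnorm_eq0.
  by rewrite mulr0 expR0 mulr1; apply: le_trans.
have mh : measurable_fun setT (fun t : n.-tuple T => expR (- (tsq t / 2)) : R).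
  apply: measurable_expR_comp; apply: measurable_funN.
  by apply: measurable_funM => //; exact: measurable_tsq.
pose K := (C * expR (a ^+ 2 / 2))%R.
have iK : (@lebesgue_tuple R n).-integrable setT
    (EFin \o (fun t => K * expR (- (tsq t / 2)))%R).
  apply: integrableZr => //; apply/integrableP; split; first exact/measurable_EFinP.
  under eq_integral do rewrite /= ger0_norm ?expR_ge0//.
  by rewrite integral_gw_half ltry.
apply: (le_integrable _ _ _ iK) => //.
  by apply/measurable_EFinP; apply: measurable_funM => //; exact: measurable_gw.
move=> t _ /=; rewrite lee_fin [leRHS]ger0_norm; last first.
  by rewrite !mulr_ge0 ?expR_ge0.
rewrite normrM (ger0_norm (gw_ge0 t)).
apply: (@le_trans _ _ (gw t * (C * expR (a * tnorm t)))%R).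
  by rewrite ler_wpM2l ?gw_ge0.
rewrite mulrCA /K -mulrA ler_wpM2l// /gw -!expRD ler_expR -sqr_tnorm.
by have := sqr_ge0 (a - tnorm t); rewrite !expr2; lra.
Qed.

End gaussian_moments.

Section kappa_value.
Context {R : realType}.
Local Notation T := (measurableTypeR R).
Local Notation leb := (@lebesgue_measure R).
Local Open Scope ereal_scope.

Lemma half_int_itvc (f : R -> R) : measurable_fun setT f ->
  half_int f = \int[leb]_(x in `[0%R, +oo[) (f x)%:E.
Proof.
move=> mf; rewrite half_intE integral_itv_obnd_cbnd//.
by apply/measurable_EFinP; apply: measurable_funTS.
Qed.

Lemma measurable_moment k : measurable_fun setT (fun r : R => r ^+ k * expR (- r ^+ 2))%R.
Proof.
apply: measurable_funM; first exact: exprn_measurable.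
by apply: measurable_expR_comp; apply: measurable_funN; exact: exprn_measurable.
Qed.

Lemma kappa_fin n : @kappa R n \is a fin_num.
Proof.
have [D D0 HD] := pow_le_expR (R := R) n.
rewrite ge0_fin_numE; last first.
  apply: half_int_ge0 => s s0; rewrite mulr_ge0 ?expR_ge0// exprn_ge0//.
  exact: ltW.
apply: (@le_lt_trans _ _ (\int[leb]_x (D%:E * (expR (- (x ^+ 2 / 2)))%:E))).
  apply: ge0_le_integral => //.
  - move=> s _; rewrite lee_fin posM_ge0// => s0.
    by rewrite mulr_ge0 ?expR_ge0// exprn_ge0// ltW.
  - apply/measurable_EFinP; apply: measurable_funM; first exact: measurable_pos.
    exact: (@measurable_moment n).
  - apply: measurable_funeM; apply/measurable_EFinP; apply: measurable_expR_comp.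
    apply: measurable_funN; apply: measurable_funM => //.
  - move=> s _; rewrite -EFinM lee_fin.
    case: (ltP 0%R s) => [s0|/posF ->]; last first.
      by rewrite mul0r mulr_ge0 ?expR_ge0// ltW.
    rewrite posT// mul1r (le_trans (ler_wpM2r (expR_ge0 _) (HD _ (ltW s0))))//.
    rewrite -mulrA -expRD le_eqVlt; apply/orP; left; apply/eqP.
    by congr (_ * expR _)%R; field.
have mE : measurable_fun setT (fun x : T => (expR (- (x ^+ 2 / 2)))%:E : \bar R).
  apply/measurable_EFinP; apply: measurable_expR_comp.
  by apply: measurable_funN; apply: measurable_funM.
have E0 (x : T) : setT x -> 0 <= (expR (- (x ^+ 2 / 2)))%:E by rewrite lee_fin expR_ge0.
have D0' : 0 <= D%:E by rewrite lee_fin ltW.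
rewrite (ge0_integralZl leb measurableT mE E0 D0').
by rewrite integral_gauss_half -EFinM ltry.
Qed.

(** The substitution by the square is made on bounded intervals, and [N] then tends to infinity; the
    intervals [[0, N ^ 2]] exhaust the half line as well. *)
Lemma integral_sqr_subst (G : R -> R) k : continuous G -> (forall x, 0 <= G x)%R ->
  (forall x : R, 0 <= x -> G (x ^+ 2) = x ^+ k * expR (- x ^+ 2))%R ->
  half_int G = 2%:E * @kappa R k.+1.
Proof.
move=> cG G0 GE.
have mG : measurable_fun setT G by exact: continuous_measurable_fun.
(* The absolute value makes [H] nonnegative on the whole line, as the monotone limit over [[0, N]]
   asks; it disappears on the half line. *)
pose H (x : R) : R := (2 * (`|x| ^+ k.+1 * expR (- x ^+ 2)))%R.
have mH : measurable_fun setT H.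
  apply: measurable_funM => //; apply: measurable_funM.
    apply: measurable_funX; exact: measurable_norm_comp.
  by apply: measurable_expR_comp; apply: measurable_funN; exact: exprn_measurable.
have H0 x : (0 <= H x)%R by rewrite !mulr_ge0 ?exprn_ge0 ?expR_ge0.
have <- : half_int H = 2%:E * @kappa R k.+1.
  rewrite /kappa -half_intZ//; last 2 first.
  - exact: (@measurable_moment k.+1).
  - by move=> s s0; rewrite mulr_ge0 ?expR_ge0// exprn_ge0// ltW.
  by apply: eq_half_int => s s0; rewrite /H gtr0_norm.
rewrite !half_int_itvc//.
have cvG := @ge0_cvgn_integral R leb _ G0 mG.
have cvH := @ge0_cvgn_integral R leb _ H0 mH.
have dE : derive1 (fun x : R => x ^+ 2)%R = (fun x : R => x *+ 2)%R.
  by apply/funext => z; rewrite exp_derive1 expr1 scaler_nat.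
have E N : \int[leb]_(x in `[0%R, (N ^ 2)%:R]) (G x)%:E =
    \int[leb]_(x in `[0%R, N%:R]) (H x)%:E.
  have := @integration_by_substitution_increasing R (fun x => x ^+ 2)%R G 0 N%:R (ler0n _ _).
  rewrite expr0n /= -natrX => ->.
  - apply: eq_integral => x; rewrite inE /= in_itv /= => /andP[x0 _].
    congr EFin; rewrite fctE /= exp_derive1 expr1.
    rewrite (GE x x0) /H ger0_norm//.
    have -> : (2 *: x = 2 * x :> R)%R by [].
    rewrite (exprS x k).
    by ring.
  - move=> x y; rewrite !in_itv /= => /andP[x0 _] /andP[y0 _] xy.
    by rewrite ltrXn2r.
  - move=> x _.
    rewrite dE.
    by apply: cvgMn; exact: cvg_id.
  - rewrite dE.
    by apply/cvg_ex; exists (0 *+ 2)%R; apply: cvgMn; exact: cvg_at_right_filter.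
  - rewrite dE.
    by apply/cvg_ex; exists (N%:R *+ 2)%R; apply: cvgMn; exact: cvg_at_left_filter.
  - split.
    + by move=> x _.
    + by apply: cvg_at_right_filter; exact: exprn_continuous.
    + by apply: cvg_at_left_filter; exact: exprn_continuous.
  - by apply: continuous_subspaceT.
have cvG2 : \int[leb]_(x in `[0%R, (N ^ 2)%:R]) (G x)%:E @[N --> \oo] -->
    \int[leb]_(x in `[0%R, +oo[) (G x)%:E.
  apply: cvg_trans cvG => /=.
  move=> U [M _ MU]; exists M => // N /= MN; apply: MU => /=.
  by rewrite (leq_trans MN)//; case: N {MN} => // N; rewrite expnS expn1 leq_pmulr.
move: cvG2; rewrite (_ : (fun N : nat => _) =
    (fun N : nat => \int[leb]_(x in `[0%R, N%:R]) (H x)%:E)); last first.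
  by apply/funext => N; exact: E.
by move=> cvG2; exact: (cvg_unique _ cvG2 cvH).
Qed.

(** Dimension 1 is read off the Gauss integral: there the Gamma integrand [t^(-1/2) exp(-t)] is
    unbounded at 0, whereas [integral_sqr_subst] takes a continuous function. *)
Lemma kappa0 : @kappa R 0 = (Num.sqrt pi / 2)%:E.
Proof.
rewrite -integral0y_gauss /kappa half_int_itvc; last exact: (@measurable_moment 0).
by apply: eq_integral => x _; rewrite expr0 mul1r.
Qed.

Lemma Gamma_kappa k : Gamma (k.+2%:R / 2 : R) = (2 * fine (@kappa R k.+1))%R.
Proof.
pose G (x : R) : R := (Num.sqrt x ^+ k * expR (- x))%R.
have cG : continuous G.
  move=> x; apply: cvgM.
    apply: (continuous_comp (f := @Num.sqrt R) (g := (fun y : R => y ^+ k)%R)).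
      exact: sqrt_continuous.
    exact: exprn_continuous.
  apply: (continuous_comp (f := (fun y : R => - y)%R) (g := @expR R)).
    by apply: cvgN; exact: cvg_id.
  exact: continuous_expR.
have G0 x : (0 <= G x)%R by rewrite mulr_ge0 ?exprn_ge0 ?expR_ge0 ?sqrtr_ge0.
have GE x : (0 <= x -> G (x ^+ 2) = x ^+ k * expR (- x ^+ 2))%R.
  by move=> x0; rewrite /G sqrtr_sqr ger0_norm.
have E := integral_sqr_subst cG G0 GE.
rewrite /Gamma /Rintegral.
transitivity (fine (half_int G)).
  rewrite half_intE; congr fine; apply: eq_integral => x.
  rewrite inE /= in_itv /= andbT => x0; congr EFin; rewrite /G; congr (_ * _)%R.
  have -> : (k.+2%:R / 2 - 1 = 2^-1 * k%:R :> R)%R.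
    by rewrite -addn2 natrD; field.
  by rewrite powRrM powR12_sqrt ?(ltW x0)// powR_mulrn// sqrtr_ge0.
rewrite E fineM//; exact: kappa_fin.
Qed.

Lemma kappa_gt0 n : (0 < fine (@kappa R n))%R.
Proof.
have F0 (s : R) : setT s -> (0 <= pos s * (s ^+ n * expR (- s ^+ 2)))%R.
  by move=> _; apply: posM_ge0 => s0; rewrite mulr_ge0 ?expR_ge0// exprn_ge0// ltW.
have mF : measurable_fun setT (fun s : T => (pos s * (s ^+ n * expR (- s ^+ 2)))%:E : \bar R).
  apply/measurable_EFinP; apply: measurable_funM; first exact: measurable_pos.
  exact: (@measurable_moment n).
suff : (expR (- 4))%:E <= @kappa R n.
  by move: (kappa_fin n); case: kappa => // r _; rewrite lee_fin; apply: lt_le_trans; exact: expR_gt0.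
apply: (@le_trans _ _ (\int[leb]_(x in `[1%R, 2%R]) (expR (- 4))%:E)).
  rewrite integral_cst//= lebesgue_measure_itv/= lte_fin ltr1n -EFinB -EFinM lee_fin.
  by rewrite (_ : 2 - 1 = 1 :> R)%R ?mulr1//; lra.
apply: (@le_trans _ _ (\int[leb]_(x in `[1%R, 2%R]) (pos x * (x ^+ n * expR (- x ^+ 2)))%:E)).
  apply: ge0_le_integral => //.
  - exact: measurable_funTS.
  - move=> x; rewrite /= in_itv /= => /andP[x1 x2].
    have x0 : (0 < x)%R by lra.
    rewrite lee_fin posT// mul1r.
    apply: (@le_trans _ _ (1 * expR (- x ^+ 2))%R).
      by rewrite mul1r ler_expR lerN2 expr2; nra.
    by rewrite ler_wpM2r ?expR_ge0// exprn_ege1.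
exact: ge0_subset_integral.
Qed.

End kappa_value.

(** * The Euler-Poisson-Darboux identity *)

Section real_expansion.
Context {R : realType} (m : nat).
Local Notation V := 'rV[R]_m.
Implicit Types (x y h : V) (f : V -> R) (g : 'I_m -> V -> R) (j k : 'I_m) (s : R).

Definition rnorm1 x : R := \sum_(j < m) `|x 0 j|.

Definition emb x : 'rV[R[i]]_m := map_mx (real_complex R) x.

Lemma norm1_emb x : norm1 (emb x) = rnorm1 x.
Proof. by apply: eq_bigr => j _; rewrite mxE normc_real. Qed.

Lemma embD x h : emb (x + h) = emb x + emb h.
Proof. by apply/rowP => j; rewrite !mxE rmorphD. Qed.

Lemma rnorm1_ge0 x : 0 <= rnorm1 x.
Proof. by apply: sumr_ge0. Qed.

(** The counterpart of [expansion] for the real and imaginary parts on R^m. The real analysis that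
    leads to the Euler-Poisson-Darboux identity rests on it. *)
Definition rexpansion f g := exists A K : R, [/\ 0 <= A, 0 <= K,
  (forall x, `|f x| <= A * expR (K * rnorm1 x)) &
  forall x h, rnorm1 h <= 1 ->
    `|f (x + h) - f x - \sum_j h 0 j * g j x| <=
    A * expR (K * rnorm1 x) * rnorm1 h ^+ 2].

Lemma Re_sum (I : Type) (r : seq I) (F : I -> R[i]) :
  complex.Re (\sum_(i <- r) F i) = \sum_(i <- r) complex.Re (F i).
Proof. by elim/big_rec2 : _ => // i a b _ <-; rewrite ReD. Qed.

Lemma rexpansion_lip f g : rexpansion f g -> forall B : R, exists L : R,
  0 <= L /\ forall x y, rnorm1 x <= B -> rnorm1 y <= B ->
  `|f y - f x| <= L * rnorm1 (y - x).
Proof.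
move=> [A [K [A0 K0 F1 F2]]] B.
pose M := A * expR (K * B).
have M0 : 0 <= M by rewrite mulr_ge0 ?expR_ge0.
(* The coefficient [g j x] is bounded through the expansion at the unit increment [delta_mx 0 j],
   all of whose other terms are values of [f] or the remainder. *)
have g1 j x : rnorm1 x <= B -> `|g j x| <= A * expR (K * (B + 1)) + 2 * M.
  move=> xB; have d1 : rnorm1 (delta_mx 0 j) = 1.
    rewrite /rnorm1 (bigD1 j)//= mxE !eqxx normr1 big1 ?addr0// => k kj.
    by rewrite mxE eqxx (negbTE kj) normr0.
  have := F2 x (delta_mx 0 j); rewrite d1 lexx expr1n mulr1 => /(_ isT).
  rewrite (bigD1 j)//= mxE !eqxx mul1r big1 ?addr0; last first.
    by move=> k kj; rewrite mxE eqxx (negbTE kj) mul0r.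
  have e1 : A * expR (K * rnorm1 x) <= M by rewrite ler_wpM2l// ler_expR ler_wpM2l.
  have := F1 x; have : `|f (x + delta_mx 0 j)| <= A * expR (K * (B + 1)).
    rewrite (le_trans (F1 _))// ler_wpM2l// ler_expR ler_wpM2l//.
    apply: (@le_trans _ _ (rnorm1 x + rnorm1 (delta_mx 0 j))).
      by rewrite -big_split ler_sum// => k _; rewrite mxE ler_normD.
    by rewrite d1 lerD2r.
  by move: e1; clear; rewrite !ler_norml; lra.
pose G := A * expR (K * (B + 1)) + 2 * M.
have G0 : 0 <= G by rewrite addr_ge0 ?mulr_ge0 ?expR_ge0.
exists (G + 2 * M); split; first by rewrite addr_ge0// mulr_ge0.
move=> x y xB yB; have fM z : rnorm1 z <= B -> `|f z| <= M.
  by move=> zB; rewrite (le_trans (F1 _))// ler_wpM2l// ler_expR ler_wpM2l.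
have n0 := rnorm1_ge0 (y - x).
have [h1|h1] := leP (rnorm1 (y - x)) 1.
  have := F2 x (y - x) h1; rewrite subrKC => E.
  have S : `|\sum_j (y - x) 0 j * g j x| <= G * rnorm1 (y - x).
    rewrite (le_trans (ler_norm_sum _ _ _))// /rnorm1 mulr_sumr ler_sum// => j _.
    by rewrite normrM mulrC ler_wpM2r// g1.
  have E' : `|f y - f x - \sum_j (y - x) 0 j * g j x| <= M * rnorm1 (y - x).
    rewrite (le_trans E)// expr2 mulrA ler_wpM2r//.
    rewrite (@le_trans _ _ (A * expR (K * rnorm1 x)))//.
      by rewrite ler_piMr// mulr_ge0 ?expR_ge0.
    by rewrite ler_wpM2l// ler_expR ler_wpM2l.
  have Mn : 0 <= M * rnorm1 (y - x) by rewrite mulr_ge0.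
  by move: S E' Mn; clear; rewrite !ler_norml; lra.
(* Beyond increments of norm 1 the crude bound [2 * M] on the difference is enough. *)
have := fM _ xB; have := fM _ yB => fy fx.
have Gn : 0 <= G * rnorm1 (y - x) by rewrite mulr_ge0.
have Mn : M <= M * rnorm1 (y - x) by rewrite ler_peMr// ltW.
by move: fx fy Gn Mn; clear; rewrite !ler_norml; lra.
Qed.

Lemma rexpansion_rcont f g : rexpansion f g -> rcont f.
Proof.
move=> fg x e e0; have [L [L0 H]] := rexpansion_lip fg (rnorm1 x + m%:R).
have Lm : 0 < L * m%:R + 1 by rewrite ltr_wpDl// mulr_ge0.
exists (Num.min 1 (e / (L * m%:R + 1))); first by rewrite lt_min ltr01 divr_gt0.
move=> y yx.
have bnd (r : R) : (forall j, `|y 0 j - x 0 j| < r) -> rnorm1 (y - x) <= m%:R * r.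
  move=> yr; rewrite -[m in m%:R]card_ord -sumr_const mulr_suml ler_sum// => j _.
  by rewrite !mxE mul1r ltW.
have y1 : rnorm1 (y - x) <= m%:R.
  rewrite -[leRHS]mulr1 bnd// => j; rewrite (lt_le_trans (yx j))//.
  by rewrite ge_min lexx.
rewrite (le_trans (H x y _ _))//.
- by rewrite lerDl.
- apply: (@le_trans _ _ (rnorm1 x + rnorm1 (y - x))); last by rewrite lerD2l.
  rewrite -big_split ler_sum// => j _ /=; rewrite !mxE.
  by rewrite (le_trans _ (ler_normD _ _))// subrKC.
apply: (@le_trans _ _ (L * (m%:R * (e / (L * m%:R + 1))))).
  rewrite ler_wpM2l// bnd// => j; rewrite (lt_le_trans (yx j))//.
  by rewrite ge_min lexx orbT.
by rewrite mulrA mulrA ler_pdivrMr// mulrC ler_wpM2l ?(ltW e0)// lerDl.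
Qed.

(** Serves two curves: the straight lines that define partial derivatives, and the normalized
    direction of a translated vector. *)
Lemma rexpansion_chain f g (u : R -> V) (du : V) (s0 : R) : rexpansion f g ->
  (forall j, is_derive s0 1 (fun s => u s 0 j) (du 0 j)) ->
  is_derive s0 1 (fun s => f (u s)) (\sum_j du 0 j * g j (u s0)).
Proof.
move=> [A [K [A0 K0 F1 F2]]] dU; apply: near_derive => e e0.
pose x := u s0; pose M := A * expR (K * rnorm1 x).
have M0 : 0 <= M by rewrite mulr_ge0 ?expR_ge0.
pose N := rnorm1 du + m%:R.
have N0 : 0 <= N by rewrite addr_ge0// rnorm1_ge0.
pose S := \sum_j `|g j x|.
have S0 : 0 <= S by apply: sumr_ge0.
(* The second bound makes the linearization errors of the coordinates cost [e / 2] in total; the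
   bound 1 makes the increment of [u] at most [N] times that of the parameter. *)
pose e1 := Num.min 1 (e / 2 / (S + 1)).
have S1 : 0 < S + 1 by rewrite ltr_wpDl.
have e10 : 0 < e1 by rewrite lt_min ltr01 !divr_gt0.
have /choice[r rP] : forall j, exists r : R, 0 < r /\ forall h : R, `|h| < r ->
    `|u (s0 + h) 0 j - u s0 0 j - du 0 j * h| <= e1 * `|h|.
  by move=> j; have [r r0 H] := derive_near (dU j) e10; exists r.
pose r0 := \big[Num.min/1]_j r j.
have r00 : 0 < r0 by apply: lt_bigmin => // j _; have [] := rP j.
have rle j : r0 <= r j by exact: bigmin_le_cond.
have MN : 0 < M * N ^+ 2 + 1 by rewrite ltr_wpDl// mulr_ge0// sqr_ge0.
have N1 : 0 < N + 1 by rewrite ltr_wpDl.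
exists (Num.min r0 (Num.min (N + 1)^-1 (e / 2 / (M * N ^+ 2 + 1)))).
  by rewrite !lt_min r00 invr_gt0 N1 !divr_gt0.
move=> h; rewrite !lt_min => /and3P[h1 h2 h3].
have Hj j : `|u (s0 + h) 0 j - u s0 0 j - du 0 j * h| <= e1 * `|h|.
  by have [_] := rP j; apply; rewrite (lt_le_trans h1).
have dx : rnorm1 (u (s0 + h) - x) <= N * `|h|.
  rewrite /N mulrDl /rnorm1 -[m in m%:R]card_ord -sumr_const !mulr_suml -big_split.
  apply: ler_sum => j _ /=; rewrite !mxE mul1r.
  have := Hj j; have e11 : e1 * `|h| <= `|h|.
    by rewrite ler_piMl// ge_min lexx.
  rewrite -normrM; move: e11; set a := u _ 0 j - x 0 j => e11 B.
  rewrite -(subrK (du 0 j * h) a) (le_trans (ler_normD _ _))// [leRHS]addrC lerD2r.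
  exact: le_trans e11.
have dx1 : rnorm1 (u (s0 + h) - x) <= 1.
  rewrite (le_trans dx)// (@le_trans _ _ ((N + 1) * `|h|))//.
    by rewrite ler_wpM2r// lerDl.
  by rewrite mulrC -ler_pdivlMr// mul1r ltW.
have := F2 x _ dx1; rewrite subrKC -/M => B.
have B' : `|f (u (s0 + h)) - f x - \sum_j (u (s0 + h) - x) 0 j * g j x| <= e / 2 * `|h|.
  rewrite (le_trans B)// (@le_trans _ _ (M * (N * `|h|) ^+ 2))//.
    by rewrite ler_wpM2l// lerXn2r// ?nnegrE ?rnorm1_ge0// mulr_ge0.
  rewrite exprMn mulrA expr2 mulrA ler_wpM2r//.
  rewrite (@le_trans _ _ ((M * N ^+ 2 + 1) * `|h|))//.
    by rewrite ler_wpM2r// lerDl.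
  by rewrite mulrC -ler_pdivlMr// ltW.
have C : `|\sum_j (u (s0 + h) - x) 0 j * g j x - (\sum_j du 0 j * g j x) * h| <=
    e / 2 * `|h|.
  rewrite mulr_suml -sumrB (le_trans (ler_norm_sum _ _ _))//.
  rewrite (@le_trans _ _ (\sum_j e1 * `|h| * `|g j x|))//.
    by apply: ler_sum => j _; rewrite !mxE (mulrAC (du 0 j)) -mulrBl normrM ler_wpM2r.
  rewrite -mulr_sumr -/S mulrAC ler_wpM2r//.
  rewrite (@le_trans _ _ (e / 2 / (S + 1) * (S + 1)))//.
    by rewrite ler_pM ?(ltW e10)// ?lerDl// ge_min lexx orbT.
  by rewrite divfK// gt_eqF.
rewrite (splitr e) mulrDl.
rewrite -/x (_ : f _ - f x - _ = (f (u (s0 + h)) - f x -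
  \sum_j (u (s0 + h) - x) 0 j * g j x) + (\sum_j (u (s0 + h) - x) 0 j * g j x -
  (\sum_j du 0 j * g j x) * h)); last by ring.
by rewrite (le_trans (ler_normD _ _))// lerD.
Qed.

End real_expansion.

Section real_integral_tools.
Context {R : realType} d {X : measurableType d} (mu : {measure set X -> \bar R}).

Lemma integrable_sumr (I : eqType) (r : seq I) (F : I -> X -> R) :
  (forall i, mu.-integrable setT (EFin \o F i)) ->
  mu.-integrable setT (EFin \o (fun x => \sum_(i <- r) F i x)).
Proof.
move=> Fi; elim: r => [|i r IH].
  by under [X in EFin \o X]funext do rewrite big_nil; exact: integrable0.
by under [X in EFin \o X]funext do rewrite big_cons; exact: integrableDr.
Qed.

Lemma Rintegral_sum (I : eqType) (r : seq I) (F : I -> X -> R) :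
  (forall i, mu.-integrable setT (EFin \o F i)) ->
  \int[mu]_x (\sum_(i <- r) F i x) = \sum_(i <- r) \int[mu]_x F i x.
Proof.
move=> Fi; elim: r => [|i r IH].
  under eq_Rintegral do rewrite big_nil.
  by rewrite big_nil /Rintegral integral0.
rewrite big_cons -IH -RintegralD//; last exact: integrable_sumr.
by apply: eq_Rintegral => x _; rewrite big_cons.
Qed.

Lemma Rdominated_convergence (F : nat -> X -> R) (f G : X -> R) :
  (forall k, measurable_fun setT (F k)) -> measurable_fun setT f ->
  mu.-integrable setT (EFin \o G) -> (forall k x, `|F k x| <= G x) ->
  {ae mu, forall x, F k x @[k --> \oo] --> f x} ->
  mu.-integrable setT (EFin \o f) /\
  \int[mu]_x F k x @[k --> \oo] --> \int[mu]_x f x.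
Proof.
move=> mF mf iG FG Ff.
have [] := @dominated_convergence _ _ _ mu _ measurableT
  (fun k x => (F k x)%:E) (EFin \o f) (EFin \o G).
- by move=> k; apply/measurable_EFinP.
- exact/measurable_EFinP.
- apply: filterS Ff => x Fx _; apply: cvg_EFin; [exact: nearW|exact: Fx].
- by [].
- by apply: aeW => x k _; rewrite lee_fin.
move=> fi _ cv; split => //.
have fin : (\int[mu]_x (f x)%:E)%E \is a fin_num by exact: integrable_fin_num.
by move: cv; rewrite -[X in _ --> X](fineK fin) => /fine_cvg.
Qed.

End real_integral_tools.

(** * Translations and Gaussian integration by parts *)

Section shift.
Context {R : realType} (n : nat).
Local Notation T := (measurableTypeR R).
Local Notation mu := (@lebesgue_tuple R n).
Implicit Types (y : n.-tuple T) (s : R) (j : 'I_n).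

(** The sign [e = 1] gives translation invariance and [e = -1] the reflection. The splitting into
    positive and negative parts extends [integral_aff] to integrands of any sign. *)
Lemma integral_isometry (e : R) (v : 'I_n -> R) (f : n.-tuple T -> \bar R) :
  `|e| = 1 -> measurable_fun setT f ->
  (\int[mu]_y f (aff e v y) = \int[mu]_y f y)%E.
Proof.
move=> e1 mf; rewrite integralE [RHS]integralE.
have e0 : e != 0 by rewrite -normr_eq0 e1 oner_neq0.
have a1 (h : n.-tuple T -> \bar R) : measurable_fun setT h ->
    (forall t, 0 <= h t)%E -> (\int[mu]_y h (aff e v y) = \int[mu]_y h y)%E.
  by move=> mh h0; rewrite integral_aff// e1 invr1 expr1n mul1e.
congr (_ - _)%E.
  rewrite -[RHS](a1 (f ^\+)%E); [by apply: eq_integral => y _; rewrite (funepos_comp f (aff e v))|exact: measurable_funepos|exact: funepos_ge0].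
rewrite -[RHS](a1 (f ^\-)%E); [by apply: eq_integral => y _; rewrite (funeneg_comp f (aff e v))|exact: measurable_funeneg|exact: funeneg_ge0].
Qed.

Definition shf j s y : n.-tuple T := aff 1 (fun i => s * (i == j)%:R) y.

Lemma tnth_shf j s y i : tnth (shf j s y) i = tnth y i + s * (i == j)%:R.
Proof. by rewrite tnth_mktuple mul1r. Qed.

Lemma shf0 j y : shf j 0 y = y.
Proof. by apply: eq_from_tnth => i; rewrite tnth_shf mul0r addr0. Qed.

Lemma shfD j s r y : shf j s (shf j r y) = shf j (s + r) y.
Proof. by apply: eq_from_tnth => i; rewrite !tnth_shf mulrDl addrA addrAC. Qed.

Lemma tsq_shf j s y : tsq (shf j s y) = tsq y + 2 * s * tnth y j + s ^+ 2.
Proof.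
rewrite /tsq (bigD1 j)//= tnth_shf eqxx mulr1 [in RHS](bigD1 j)//=.
rewrite (eq_bigr (fun i => tnth y i ^+ 2)).
  by rewrite sqrrD; ring.
by move=> i ij; rewrite tnth_shf (negbTE ij) mulr0 addr0.
Qed.

Lemma measurable_shf j s : measurable_fun setT (shf j s).
Proof. exact: measurable_aff. Qed.

Lemma tnth_le_tnorm y j : `|tnth y j| <= tnorm y.
Proof.
rewrite -(ler_pXn2r (ltn0Sn 1)) ?nnegrE ?tnorm_ge0// sqr_tnorm real_normK ?num_real//.
by rewrite /tsq (bigD1 j)//= lerDl sumr_ge0// => i _; exact: sqr_ge0.
Qed.

Lemma tnorm_shf j s y : `|tnorm (shf j s y) - tnorm y| <= `|s|.
Proof.
have H z r : tnorm (shf j r z) <= tnorm z + `|r|.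
  rewrite -(ler_pXn2r (ltn0Sn 1)) ?nnegrE ?tnorm_ge0 ?addr_ge0 ?tnorm_ge0//.
  rewrite sqr_tnorm tsq_shf sqrrD sqr_tnorm real_normK ?num_real// lerD2r lerD2l.
  rewrite -mulrA -[leRHS]mulr_natl ler_wpM2l// (le_trans (ler_norm _))//.
  by rewrite normrM mulrC ler_wpM2r// tnth_le_tnorm.
have := H y s; have := H (shf j s y) (- s).
rewrite shfD addNr shf0 normrN ler_norml; lra.
Qed.

Lemma gw_shf j s y : gw (shf j (- s) y) = gw y * expR (2 * s * tnth y j - s ^+ 2).
Proof. by rewrite /gw tsq_shf -expRD; congr expR; ring. Qed.

Lemma expR_sub1_le (a : R) : `|expR a - 1| <= `|a| * expR `|a|.
Proof.
have [a0|a0] := leP 0 a.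
  have e1 : 1 <= expR a by rewrite -[leLHS]expR0 ler_expR.
  rewrite (ger0_norm a0) ger0_norm ?subr_ge0//.
  have := expR_ge1Dx (- a); rewrite expRN => H.
  have ea := expR_gt0 a.
  have : (1 - a) * expR a <= 1 by rewrite -ler_pdivlMr// mul1r.
  by rewrite mulrBl mul1r; lra.
have e1 : expR a <= 1 by rewrite -[leRHS]expR0 ler_expR ltW.
rewrite (ltr0_norm a0) distrC ger0_norm ?subr_ge0//.
have H := expR_ge1Dx a.
have e2 : 1 <= expR (- a) by rewrite -[leLHS]expR0 ler_expR; lra.
have : - a * 1 <= - a * expR (- a) by rewrite ler_wpM2l//; lra.
by lra.
Qed.

End shift.

Section gaussian_parts.
Context {R : realType} (n : nat).
Local Notation T := (measurableTypeR R).
Local Notation mu := (@lebesgue_tuple R n.+1).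
Implicit Types (y : n.+1.-tuple T) (s : R) (j : 'I_n.+1).

(** Difference quotients are taken along the increments [1 / (k + 1)], so that dominated convergence
    for sequences applies to them. *)
Lemma harmonic_derive (u : R -> R) (du : R) : is_derive (0 : R) 1 u du ->
  (u k.+1%:R^-1 - u 0) / k.+1%:R^-1 @[k --> \oo] --> du.
Proof.
move=> D; apply/cvgrPdist_le => e e0.
have [r r0 H] := derive_near D e0.
near=> k.
have k0 : 0 < k.+1%:R^-1 :> R by rewrite invr_gt0.
have kr : `|k.+1%:R^-1| < r.
  rewrite gtr0_norm// invf_plt ?posrE//.
  near: k; exists (Num.bound r^-1) => // k /= kb.
  apply: (lt_le_trans (archi_boundP _)); first by rewrite invr_ge0 ltW.
  by rewrite ler_nat (leq_trans kb).
have := H _ kr; rewrite add0r => B.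
rewrite -(ler_pM2r (_ : 0 < `|k.+1%:R^-1 : R|)) ?normr_gt0 ?gt_eqF//.
rewrite -normrM (le_trans _ B)// -normrN le_eqVlt; apply/orP; left; apply/eqP.
congr `|_|; rewrite mulrBl divfK ?gt_eqF//; ring.
Unshelve. all: by end_near. Qed.

(* Differentiating at [s = 0] the translation invariance
   [\int U (y + s e_j) gw y = \int U y gw (y - s e_j)]. *)
Lemma gaussian_parts j (U D : n.+1.-tuple T -> R) (L C : R) :
  measurable_fun setT U -> measurable_fun setT D ->
  (forall y, `|U y| <= C * expR (tnorm y)) ->
  (forall y s, `|U (shf j s y) - U y| <= L * `|s|) ->
  (forall y, y != tzero n.+1 -> is_derive (0:R) 1 (fun s => U (shf j s y)) (D y)) ->
  \int[mu]_y (gw y * D y) = \int[mu]_y (gw y * (2 * tnth y j * U y)).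
Proof.
move=> mU mD UC UL UD.
have mg := @measurable_gw R n.+1.
have mj : measurable_fun setT (fun y : n.+1.-tuple T => tnth y j : R) by exact: measurable_tnth.
have mUs s : measurable_fun setT (fun y => U (shf j s y)).
  by apply: (measurableT_comp (f := U) mU); exact: measurable_shf.
have C0 : 0 <= C.
  have := UC (@tzero R n.+1); have : 0 < expR (tnorm (@tzero R n.+1)) by exact: expR_gt0.
  by move=> e0 H; rewrite -(pmulr_lge0 _ e0) (le_trans _ H).
pose s_ (k : nat) : R := k.+1%:R^-1.
have s0 k : 0 < s_ k by rewrite invr_gt0.
have s1 k : s_ k <= 1 by rewrite invf_le1// ler1n.
(* [X_ k] carries the difference quotient of [U] and [Y_ k] that of the Gaussian translated the
   other way; translation invariance gives them equal integrals. *)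
pose X_ k y := gw y * ((U (shf j (s_ k) y) - U y) / s_ k).
pose Y_ k y := gw y * ((expR (2 * s_ k * tnth y j - s_ k ^+ 2) - 1) / s_ k * U y).
have XY k : \int[mu]_y X_ k y = \int[mu]_y Y_ k y.
  have i1 : mu.-integrable setT (EFin \o (fun y => gw y * U y)).
    by apply: (gw_integrable (C := C) (a := 1)) => // t; rewrite mul1r.
  have i2 : mu.-integrable setT (EFin \o (fun y => gw y * U (shf j (s_ k) y))).
    apply: (gw_integrable (C := C * expR 1) (a := 1)) => // t.
    rewrite (le_trans (UC _))// -mulrA -expRD ler_wpM2l// ler_expR.
    have := tnorm_shf j (s_ k) t; rewrite [leRHS]gtr0_norm// ler_norml.
    by have := s1 k; lra.
  have Y2 : measurable_fun setT (fun y => (gw (shf j (- s_ k) y) * U y)%:E : \bar R).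
    apply/measurable_EFinP; apply: measurable_funM => //.
    by apply: (measurableT_comp (f := @gw R n.+1) mg); exact: measurable_shf.
  have E2 : \int[mu]_y (gw y * U (shf j (s_ k) y)) = \int[mu]_y (gw (shf j (- s_ k) y) * U y).
    congr fine; rewrite -(integral_isometry (fun i => s_ k * (i == j)%:R) (normr1 R) Y2).
    by apply: eq_integral => y _; rewrite -/(shf j (s_ k) y) shfD addNr shf0.
  have i3 : mu.-integrable setT (EFin \o (fun y => gw (shf j (- s_ k) y) * U y)).
    have -> : EFin \o (fun y => gw (shf j (- s_ k) y) * U y) =
      EFin \o (fun y => gw y * (expR (2 * s_ k * tnth y j - s_ k ^+ 2) * U y)).
      by apply/funext => y /=; rewrite gw_shf mulrA.
    apply: (gw_integrable (C := C) (a := 3)).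
      apply: measurable_funM => //; apply: measurable_expR_comp.
      by apply: measurable_funB => //; apply: measurable_funM.
    move=> t; rewrite normrM ger0_norm ?expR_ge0// mulrC.
    apply: (@le_trans _ _ (C * expR (tnorm t) * expR (2 * s_ k * tnth t j - s_ k ^+ 2))).
      by rewrite ler_wpM2r ?expR_ge0.
    rewrite -mulrA -expRD ler_wpM2l// ler_expR.
    have : 2 * s_ k * tnth t j <= 2 * tnorm t.
      rewrite -mulrA ler_wpM2l// (le_trans (ler_norm _))// normrM gtr0_norm//.
      by rewrite -[leRHS]mul1r; apply: ler_pM => //; [exact: ltW|exact: tnth_le_tnorm].
    by have := sqr_ge0 (s_ k); lra.
  rewrite /X_ /Y_.
  transitivity ((s_ k)^-1 * (\int[mu]_y (gw y * U (shf j (s_ k) y)) - \int[mu]_y (gw y * U y))).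
    rewrite -RintegralB// -RintegralZl//; last exact: integrableBr.
    by apply: eq_Rintegral => y _; ring.
  rewrite E2 -RintegralB// -RintegralZl//; last exact: integrableBr.
  by apply: eq_Rintegral => y _; rewrite gw_shf; ring.
have cX : \int[mu]_y X_ k y @[k --> \oo] --> \int[mu]_y (gw y * D y).
  have iL : mu.-integrable setT (EFin \o (fun y => gw y * L)).
    apply: (gw_integrable (C := `|L|) (a := 0)) => // t.
    by rewrite mul0r expR0 mulr1.
  have [] // := Rdominated_convergence _ _ iL (F := X_) (f := fun y => gw y * D y).
  - move=> k; apply: measurable_funM => //; apply: measurable_funM => //.
    exact: measurable_funB.
  - exact: measurable_funM.
  - move=> k y; rewrite /X_ normrM (ger0_norm (gw_ge0 y)) ler_wpM2l ?gw_ge0//.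
    rewrite normrM [X in _ * X]gtr0_norm ?invr_gt0// ler_pdivrMr//.
    by rewrite (le_trans (UL _ _))// gtr0_norm.
  - apply: not_tzero_ae => y y0; apply: cvgM; first exact: cvg_cst.
    have := harmonic_derive (UD y y0); rewrite shf0; exact.
have cY : \int[mu]_y Y_ k y @[k --> \oo] --> \int[mu]_y (gw y * (2 * tnth y j * U y)).
  (* The rate 5 is [4 + 1]: the quotient of the Gaussian factor grows at most like
     [expR (4 * tnorm y)], and [U] like [expR (tnorm y)]. *)
  pose G (y : n.+1.-tuple T) := C * expR 1 * expR (5 * tnorm y).
  have iG : mu.-integrable setT (EFin \o (fun y => gw y * G y)).
    apply: (gw_integrable (C := C * expR 1) (a := 5)).
      apply: measurable_funM => //; apply: measurable_expR_comp.
      by apply: measurable_funM => //; exact: measurable_tnorm.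
    by move=> t; rewrite ger0_norm// !mulr_ge0 ?expR_ge0.
  have [] // := Rdominated_convergence _ _ iG (F := Y_) (f := fun y => gw y * (2 * tnth y j * U y)).
  - move=> k; apply: measurable_funM => //; apply: measurable_funM => //.
    apply: measurable_funM => //; apply: measurable_funB => //.
    by apply: measurable_expR_comp; apply: measurable_funB => //; apply: measurable_funM.
  - by apply: measurable_funM => //; apply: measurable_funM => //; exact: measurable_funM.
  - move=> k y; rewrite /Y_ normrM (ger0_norm (gw_ge0 y)) ler_wpM2l ?gw_ge0//.
    set a := 2 * s_ k * tnth y j - _.
    have n0 := tnorm_ge0 y.
    have aB : `|a| <= s_ k * (2 * tnorm y + 1).
      have -> : a = s_ k * (2 * tnth y j - s_ k) by rewrite /a; ring.
      rewrite normrM gtr0_norm// ler_wpM2l ?(ltW (s0 k))//.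
      have := tnth_le_tnorm y j; have := s1 k; have := s0 k.
      by rewrite !ler_norml; lra.
    have aB1 : `|a| <= 2 * tnorm y + 1.
      by rewrite (le_trans aB)// ler_piMl//; lra.
    have E1 : `|(expR a - 1) / s_ k| <= (2 * tnorm y + 1) * expR (2 * tnorm y + 1).
      rewrite normrM [X in _ * X]gtr0_norm ?invr_gt0// ler_pdivrMr//.
      rewrite (le_trans (expR_sub1_le a))// mulrAC (mulrC (2 * tnorm y + 1)).
      by rewrite ler_pM ?expR_ge0// ler_expR.
    have E2 : (2 * tnorm y + 1) * expR (2 * tnorm y + 1) <= expR 1 * expR (4 * tnorm y).
      rewrite -expRD.
      apply: (@le_trans _ _ (expR (2 * tnorm y) * expR (2 * tnorm y + 1))).
        by rewrite ler_wpM2r ?expR_ge0// addrC expR_ge1Dx.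
      by rewrite -expRD ler_expR; lra.
    rewrite normrM (@le_trans _ _ (expR 1 * expR (4 * tnorm y) * (C * expR (tnorm y))))//.
      by rewrite ler_pM// (le_trans E1).
    rewrite /G le_eqVlt; apply/orP; left; apply/eqP.
    rewrite mulrCA mulrA -mulrA -[expR 1 * _ * _]mulrA -expRD mulrA.
    by congr (_ * expR _); ring.
  - apply: aeW => y; apply: cvgM; first exact: cvg_cst.
    apply: cvgM; last exact: cvg_cst.
    have : is_derive (0:R) 1 (fun s => expR (2 * s * tnth y j - s ^+ 2)) (2 * tnth y j).
      apply: is_derive_eq.
      rewrite /GRing.scale /= ?expr0n /= ?mulr0 ?mul0r ?subr0 ?expR0 ?mulr1 ?mul1r ?addr0 ?add0r.
      by ring.
    by move/harmonic_derive; rewrite mulr0 mul0r expr0n subr0 expR0.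
have := cvg_unique _ cX; apply => //.
by rewrite (_ : (fun k => _) = fun k => \int[mu]_y Y_ k y)//; apply/funext.
Qed.

End gaussian_parts.

(** * Weighted spherical integrals and their derivative in the radius *)

Section spherical_integral.
Context {R : realType} (n : nat).
Local Notation T := (measurableTypeR R).
Local Notation mu := (@lebesgue_tuple R n.+1).
Local Notation V := 'rV[R]_n.+1.
Implicit Types (y : n.+1.-tuple T) (r s : R) (j k : 'I_n.+1) (f : V -> R)
  (g : 'I_n.+1 -> V -> R) (c : n.+1.-tuple T -> R).

(* The unit vector of direction [y], with the junk value [0] at [y = 0]. *)
Definition urow y : V := \row_j ((tnorm y)^-1 * tnth y j).

Lemma urow_le1 y j : `|urow y 0 j| <= 1.
Proof.
rewrite mxE normrM ger0_norm ?invr_ge0 ?tnorm_ge0//.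
have := tnth_le_tnorm y j; have := tnorm_ge0 y.
rewrite le_eqVlt => /predU1P[<-|t0 H]; first by rewrite invr0 mul0r.
by rewrite mulrC ler_pdivrMr// mul1r.
Qed.

Lemma rnorm1_urow r y : rnorm1 (r *: urow y) <= `|r| * n.+1%:R.
Proof.
rewrite -[in leRHS](card_ord n.+1) -sumr_const mulr_sumr ler_sum// => j _.
have -> : (r *: urow y) 0 j = r * urow y 0 j by rewrite mxE.
by rewrite normrM mulr1 ler_piMr// urow_le1.
Qed.

Lemma urow_sqr y : y != tzero n.+1 -> \sum_j urow y 0 j ^+ 2 = 1.
Proof.
rewrite -tnorm_eq0 => y0.
under eq_bigr do rewrite mxE exprMn.
by rewrite -mulr_sumr -/(tsq y) -sqr_tnorm -exprMn mulVf// expr1n.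
Qed.

Lemma urowZ s y : 0 < s -> urow (tscale s y) = urow y.
Proof.
move=> s0; apply/rowP => j; rewrite !mxE tnormZ gtr0_norm// tnth_mktuple invfM.
by rewrite mulrACA mulVf ?mul1r// gt_eqF.
Qed.

Lemma measurable_urow j : measurable_fun setT (fun y => urow y 0 j).
Proof.
under [X in measurable_fun _ X]funext do rewrite mxE.
apply: measurable_funM; last exact: measurable_tnth.
by apply: measurable_inv; exact: measurable_tnorm.
Qed.

Lemma measurable_furow f r : rcont f -> measurable_fun setT (fun y => f (r *: urow y)).
Proof.
move=> cf; have := measurable_rcont (u := fun j y => r * urow y 0 j) cf.
have -> : (fun y => f (\row_j (r * urow y 0 j))) = (fun y => f (r *: urow y)).
  by apply/funext => y; congr f; apply/rowP => j; rewrite !mxE.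
by apply => j; apply: measurable_funM => //; exact: measurable_urow.
Qed.

(** The weights that arise by differentiating in the radius: products of coordinates of [urow], each
    of modulus at most 1. *)
Definition coef c := measurable_fun setT c /\ forall y, `|c y| <= 1.

Lemma coef1 : coef (fun=> 1).
Proof. by split => // y; rewrite normr1. Qed.

Lemma coefM c j : coef c -> coef (fun y => c y * urow y 0 j).
Proof.
move=> [mc c1]; split; first by apply: measurable_funM => //; exact: measurable_urow.
by move=> y; rewrite normrM mulr_ile1// urow_le1.
Qed.

Definition sint c f r : R := \int[mu]_y (gw y * (c y * f (r *: urow y))).

Lemma rexpansion_bound f g : rexpansion f g -> forall B : R, exists M : R,
  0 <= M /\ forall x, rnorm1 x <= B -> `|f x| <= M.
Proof.
move=> [A [K [A0 K0 F1 _]]] B; exists (A * expR (K * B)).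
split=> [|x xB]; first by rewrite mulr_ge0 ?expR_ge0.
by rewrite (le_trans (F1 x))// ler_wpM2l// ler_expR ler_wpM2l.
Qed.

Lemma sint_integrable c f g r : coef c -> rexpansion f g ->
  mu.-integrable setT (EFin \o (fun y => gw y * (c y * f (r *: urow y)))).
Proof.
move=> [mc c1] fg; have [M [M0 fM]] := rexpansion_bound fg (`|r| * n.+1%:R).
apply: (gw_integrable (C := M) (a := 0)).
  apply: measurable_funM => //; apply: measurable_furow.
  exact: (rexpansion_rcont fg).
move=> y; rewrite mul0r expR0 mulr1 normrM -[leRHS]mul1r ler_pM//.
by apply: fM; exact: rnorm1_urow.
Qed.

Lemma gw_Rintegrable : mu.-integrable setT (EFin \o @gw R n.+1).
Proof.
have := @gw_integrable R n.+1 (fun=> 1) 1 0 (@measurable_cst _ _ _ _ _ _).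
have -> : (fun t : n.+1.-tuple T => gw t * 1) = @gw R n.+1.
  by apply/funext => t; rewrite mulr1.
by apply => t; rewrite mul0r expR0 mulr1 normr1.
Qed.

(** The points [r *: urow y] stay in a bounded set, so the quadratic remainder of [f] is uniform in
    [y] and integrates to at most [B * I * h ^+ 2]. *)
Lemma sint_derive c f g : coef c -> rexpansion f g ->
  (forall j, exists h, rexpansion (g j) h) -> forall r,
  is_derive r 1 (sint c f) (\sum_j sint (fun y => c y * urow y 0 j) (g j) r).
Proof.
move=> cc fg gh r; apply: near_derive => e e0.
have [A [K [A0 K0 F1 F2]]] := fg.
pose B := A * expR (K * (`|r| * n.+1%:R)) * n.+1%:R ^+ 2.
have B0 : 0 <= B by rewrite !mulr_ge0 ?expR_ge0 ?sqr_ge0.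
pose I := \int[mu]_y gw y.
have I0 : 0 <= I by apply: Rintegral_ge0 => y _; exact: gw_ge0.
have BI : 0 < B * I + 1 by rewrite ltr_wpDl// mulr_ge0.
(* The first bound keeps [rnorm1 (h *: urow y)] at most 1, the range of the expansion of [f]. *)
exists (Num.min n.+1%:R^-1 (e / (B * I + 1))).
  by rewrite lt_min invr_gt0 ltr0n divr_gt0.
move=> h; rewrite lt_min => /andP[h1 h2].
have ig j : mu.-integrable setT
    (EFin \o (fun y => gw y * (c y * urow y 0 j * g j (r *: urow y)))).
  by have [gg G] := gh j; apply: (sint_integrable _ _ G); exact: coefM.
have if_ r' := sint_integrable r' cc fg.
pose X y := gw y * (c y * f ((r + h) *: urow y)) - gw y * (c y * f (r *: urow y)) -
  h * \sum_j (gw y * (c y * urow y 0 j * g j (r *: urow y))).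
have iS := integrable_sumr (index_enum 'I_n.+1) ig.
have iS' := integrableZr measurableT h iS.
have i2 := integrableBr measurableT (if_ (r + h)) (if_ r).
have -> : sint c f (r + h) - sint c f r -
    (\sum_j sint (fun y => c y * urow y 0 j) (g j) r) * h = \int[mu]_y X y.
  rewrite /X RintegralB// RintegralB//; congr (_ - _).
  by rewrite RintegralZl// Rintegral_sum// mulrC.
have iX : mu.-integrable setT (EFin \o X) by exact: integrableBr.
apply: (le_trans (le_normr_Rintegral _ _)) => //.
apply: (@le_trans _ _ (\int[mu]_y (B * h ^+ 2 * gw y))).
  apply: le_Rintegral => //.
  - exact: (integrable_norm iX).
  - by apply: integrableZr => //; exact: gw_Rintegrable.
  move=> y _; rewrite /X.
  have -> : gw y * (c y * f ((r + h) *: urow y)) - gw y * (c y * f (r *: urow y)) -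
      h * \sum_j (gw y * (c y * urow y 0 j * g j (r *: urow y))) =
    gw y * (c y * (f (r *: urow y + h *: urow y) - f (r *: urow y) -
      \sum_j (h *: urow y) 0 j * g j (r *: urow y))).
    rewrite -scalerDl !mulrBr; congr (_ - _).
    rewrite !mulr_sumr; apply: eq_bigr => j _.
    have -> : (h *: urow y) 0 j = h * urow y 0 j by rewrite mxE.
    by ring.
  have hu : rnorm1 (h *: urow y) <= `|h| * n.+1%:R by exact: rnorm1_urow.
  have hu1 : rnorm1 (h *: urow y) <= 1.
    by rewrite (le_trans hu)// -ler_pdivlMr ?ltr0n// mul1r ltW.
  rewrite normrM (ger0_norm (gw_ge0 y)) mulrC ler_wpM2r ?gw_ge0// normrM.
  have [_ c1] := cc; rewrite -[leRHS]mul1r ler_pM//.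
  rewrite (le_trans (F2 _ _ hu1))// /B -[leRHS]mulrA.
  have -> : n.+1%:R ^+ 2 * h ^+ 2 = (`|h| * n.+1%:R) ^+ 2.
    by rewrite exprMn real_normK ?num_real// mulrC.
  apply: ler_pM.
  - by rewrite mulr_ge0 ?expR_ge0.
  - exact: sqr_ge0.
  - by rewrite ler_wpM2l// ler_expR ler_wpM2l// rnorm1_urow.
  - by rewrite lerXn2r ?nnegrE ?rnorm1_ge0 ?mulr_ge0.
rewrite RintegralZl//; last exact: gw_Rintegrable.
rewrite -/I -(real_normK (num_real h)) expr2 mulrAC mulrA ler_wpM2r//.
apply: (@le_trans _ _ ((B * I + 1) * `|h|)).
  by rewrite ler_wpM2r// lerDl.
by rewrite mulrC -ler_pdivlMr// ltW.
Qed.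

Lemma sint_zero f : sint (fun=> 1) f 0 = (\int[mu]_y gw y) * f 0.
Proof.
rewrite -RintegralZr//; last exact: gw_Rintegrable.
by apply: eq_Rintegral => y _; rewrite scale0r mul1r.
Qed.

Lemma Rintegral_gw : \int[mu]_y gw y = Num.sqrt pi ^+ n.+1.
Proof. by rewrite /Rintegral integral_gw. Qed.

End spherical_integral.

Section second_moment.
Context {R : realType} (n : nat).
Local Notation T := (measurableTypeR R).
Local Notation mu := (@lebesgue_tuple R n.+1).
Implicit Types (y : n.+1.-tuple T) (r s : R) (H : n.+1.-tuple T -> R).

Definition homog0 H := forall s y, 0 < s -> H (tscale s y) = H y.

Lemma sqr_le_expR (x : R) : 0 <= x -> x ^+ 2 <= expR (2 * x).
Proof.
move=> x0; rewrite expRM_natl lerXn2r ?nnegrE ?expR_ge0//.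
by have := expR_ge1Dx x; lra.
Qed.

Lemma gw_bounded_integrable H (M : R) : measurable_fun setT H -> (forall y, `|H y| <= M) ->
  mu.-integrable setT (EFin \o (fun y => gw y * H y)) /\
  mu.-integrable setT (EFin \o (fun y => gw y * (tsq y * H y))).
Proof.
move=> mH HM; have M0 : 0 <= M by apply: le_trans (HM (tzero n.+1)).
split.
  by apply: (gw_integrable (C := M) (a := 0)) => // t; rewrite mul0r expR0 mulr1.
apply: (gw_integrable (C := M) (a := 2)).
  by apply: measurable_funM => //; exact: measurable_tsq.
move=> t; rewrite normrM mulrC ler_pM// ger0_norm ?tsq_ge0// -sqr_tnorm.
by rewrite sqr_le_expR// tnorm_ge0.
Qed.

(** Apply the polar formula to [gw y * (tsq y * H y)]: as [H] has degree 0, the integral over the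
    sphere of radius [r] is [r ^+ 2 * expR (- r ^+ 2)] times the Gaussian integral of [H], which
    raises the radial power from [n] to [n + 2]. *)
Lemma kappa_moment H (M : R) : measurable_fun setT H -> (forall y, 0 <= H y <= M) ->
  homog0 H ->
  fine (@kappa R n) * \int[mu]_y (gw y * (tsq y * H y)) =
  fine (@kappa R n.+2) * \int[mu]_y (gw y * H y).
Proof.
move=> mH HM hH.
have H0 y : 0 <= H y by have /andP[] := HM y.
have HM' y : `|H y| <= M by rewrite ger0_norm//; have /andP[] := HM y.
have [i0 i2] := gw_bounded_integrable mH HM'.
pose h y := gw y * (tsq y * H y).
have mh : measurable_fun setT h.
  apply: measurable_funM; first exact: measurable_gw.
  by apply: measurable_funM => //; exact: measurable_tsq.
have h0 y : 0 <= h y by rewrite !mulr_ge0 ?gw_ge0 ?tsq_ge0.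
have P := polar mh h0.
have I0 : (\int[mu]_y (gw y * H y)%:E)%E = (\int[mu]_y (gw y * H y))%:E.
  by rewrite fineK//; exact: integrable_fin_num.
have I2 : (\int[mu]_y (gw y * (tsq y * H y))%:E)%E = (\int[mu]_y (gw y * (tsq y * H y)))%:E.
  by rewrite fineK//; exact: integrable_fin_num.
have mE : measurable_fun setT (fun y : n.+1.-tuple T => (gw y * H y)%:E : \bar R).
  by apply/measurable_EFinP; apply: measurable_funM => //; exact: measurable_gw.
have E r : 0 < r -> sphere_int h r =
    ((r ^+ 2 * expR (- r ^+ 2))%:E * (\int[mu]_y (gw y * H y)%:E))%E.
  move=> r0; rewrite -ge0_integralZl//; first last.
  - by rewrite lee_fin mulr_ge0 ?expR_ge0 ?sqr_ge0.
  - by move=> y _; rewrite lee_fin mulr_ge0 ?gw_ge0.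
  apply: ge0_ae_eq_integral => //.
  - apply/measurable_EFinP; apply: measurable_funM; first exact: measurable_gw.
    by apply: sphere_meas => //; exact: measurable_tunit.
  - exact: measurable_funeM.
  - move=> y _; rewrite lee_fin; apply: mulr_ge0; first exact: gw_ge0.
    exact: h0.
  - by move=> y _; rewrite -EFinM lee_fin; do 2![apply: mulr_ge0]; rewrite ?expR_ge0 ?sqr_ge0 ?gw_ge0.
  apply: not_tzero_ae => y y0 _; rewrite -EFinM; congr EFin.
  have ty : 0 < tnorm y by rewrite lt_neqAle tnorm_ge0 eq_sym tnorm_eq0 y0.
  rewrite /h /tunit tscaleA hH ?mulr_gt0 ?invr_gt0//.
  rewrite {2}/gw !tsqZ -sqr_tnorm -exprMn divfK ?gt_eqF//.
  by rewrite mulrCA mulrA [gw y * _]mulrC; ring.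
have := P; rewrite I2 => {}P.
have : (\int[lebesgue_measure]_r ((pos r * r ^+ n)%:E * sphere_int h r) =
    @kappa R n.+2 * (\int[mu]_y (gw y * H y))%:E)%E.
  rewrite /kappa -ge0_integralZr//; first last.
  - by rewrite lee_fin; apply: Rintegral_ge0 => y _; rewrite mulr_ge0 ?gw_ge0.
  - move=> r _; rewrite lee_fin posM_ge0// => r0.
    by rewrite mulr_ge0 ?expR_ge0// exprn_ge0// ltW.
  - apply/measurable_EFinP; apply: measurable_funM; first exact: measurable_pos.
    exact: (@measurable_moment R n.+2).
  apply: eq_integral => r _; case: (ltP 0 r) => [r0|/posF ->]; last by rewrite !mul0r !mul0e.
  rewrite E// I0 -!EFinM; congr EFin.
  by rewrite -[n.+2]addn2 exprD; ring.
rewrite P -(fineK (kappa_fin n)) -(fineK (kappa_fin n.+2)) -!EFinM.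
by case.
Qed.

(** Integration by parts gives [\int gw = 2 \int gw y_j^2] for each [j]. The sum over [j] is the
    second moment of the Gaussian, and [kappa_moment] at [H = 1] expresses the same moment by the
    ratio of the two constants. *)
Lemma kappa_SS : fine (@kappa R n.+2) = n.+1%:R / 2 * fine (@kappa R n).
Proof.
have I1 j : \int[mu]_y gw y = \int[mu]_y (gw y * (2 * tnth y j * tnth y j)).
  have mj : measurable_fun setT (fun y : n.+1.-tuple T => tnth y j : R) by exact: measurable_tnth.
  have := @gaussian_parts R n j (fun y => tnth y j) (fun=> 1) 1 1 mj.
  under eq_Rintegral do rewrite mulr1; apply => //.
  - move=> y; rewrite mul1r (le_trans (tnth_le_tnorm y j))//.
    by have := expR_ge1Dx (tnorm y); lra.
  - by move=> y s; rewrite tnth_shf eqxx mulr1 addrAC subrr add0r mul1r.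
  - move=> y _; under [X in is_derive _ _ X]funext do rewrite tnth_shf eqxx mulr1.
    by apply: is_derive_eq; rewrite add0r.
have one := @kappa_moment (fun=> 1) 1 (@measurable_cst _ _ _ _ _ _)
  (fun _ => ltac:(by rewrite ler01 lexx)) (fun _ _ _ => erefl).
have S : 2 * \int[mu]_y (gw y * (tsq y * 1)) = n.+1%:R * \int[mu]_y gw y.
  have -> : n.+1%:R * \int[mu]_y gw y =
      \sum_(j < n.+1) \int[mu]_y (gw y * (2 * tnth y j * tnth y j)).
    by rewrite -(eq_bigr _ (fun j _ => I1 j)) sumr_const card_ord mulr_natl.
  rewrite -Rintegral_sum; last first.
    move=> j; apply: (gw_integrable (C := 2) (a := 2)).
      apply: measurable_funM; last exact: measurable_tnth.
      by apply: measurable_funM; [exact: measurable_cst|exact: measurable_tnth].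
    move=> t; rewrite -mulrA normrM ger0_norm// ler_wpM2l// normrM.
    apply: le_trans (sqr_le_expR (tnorm_ge0 t)).
    by rewrite expr2 ler_pM// tnth_le_tnorm.
  have [|_ i2] := @gw_bounded_integrable (fun=> 1) 1 (@measurable_cst _ _ _ _ _ _).
    by move=> y; rewrite normr1.
  rewrite -RintegralZl//; apply: eq_Rintegral => y _.
  rewrite mulr1 /tsq !mulr_sumr; apply: eq_bigr => j _; ring.
have g0 : \int[mu]_y gw y != 0.
  by rewrite Rintegral_gw gt_eqF// exprn_gt0// sqrtr_gt0 pi_gt0.
move: one; under [X in _ = _ * X]eq_Rintegral do rewrite mulr1.
move=> one; apply: (mulIf g0); rewrite -one.
apply: (mulfI (_ : 2 != 0 :> R)) => //.
by rewrite mulrCA S; field.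
Qed.

Lemma second_moment H (M : R) : measurable_fun setT H -> (forall y, `|H y| <= M) ->
  homog0 H ->
  \int[mu]_y (gw y * (tsq y * H y)) = n.+1%:R / 2 * \int[mu]_y (gw y * H y).
Proof.
move=> mH HM hH.
have [i0 i2] := gw_bounded_integrable mH HM.
have M0 : 0 <= M by apply: le_trans (HM (tzero n.+1)).
have cM y : `|(fun=> M) y| <= M by rewrite ger0_norm.
have [j0 j2] := @gw_bounded_integrable (fun=> M) M (@measurable_cst _ _ _ _ _ _) cM.
have k0 := lt0r_neq0 (kappa_gt0 (R := R) n).
have h1 : \int[mu]_y (gw y * (tsq y * M)) = n.+1%:R / 2 * \int[mu]_y (gw y * M).
  apply: (mulfI k0); rewrite (@kappa_moment (fun=> M) M)//.
    by rewrite kappa_SS; ring.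
  by move=> y; rewrite M0 lexx.
(* Adding [M] makes the function nonnegative, as [kappa_moment] requires; the contribution of the
   constant is subtracted afterwards. *)
have h2 : \int[mu]_y (gw y * (tsq y * (H y + M))) =
    n.+1%:R / 2 * \int[mu]_y (gw y * (H y + M)).
  apply: (mulfI k0); rewrite (@kappa_moment (fun y => H y + M) (2 * M)).
  - by rewrite kappa_SS; ring.
  - exact: measurable_funD.
  - by clear cM => y; have := HM y; rewrite ler_norml; lra.
  - by move=> s y s0; rewrite hH.
have e2 : \int[mu]_y (gw y * (tsq y * (H y + M))) =
    \int[mu]_y (gw y * (tsq y * H y)) + \int[mu]_y (gw y * (tsq y * M)).
  by rewrite -RintegralD//; apply: eq_Rintegral => y _; ring.
have e0 : \int[mu]_y (gw y * (H y + M)) =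
    \int[mu]_y (gw y * H y) + \int[mu]_y (gw y * M).
  by rewrite -RintegralD//; apply: eq_Rintegral => y _; ring.
by clear cM; move: h2; rewrite e2 e0 h1 mulrDr => /addIr.
Qed.

End second_moment.

Section epd.
Context {R : realType} (n : nat).
Local Notation T := (measurableTypeR R).
Local Notation mu := (@lebesgue_tuple R n.+1).
Local Notation V := 'rV[R]_n.+1.
Implicit Types (y : n.+1.-tuple T) (r s : R) (j k : 'I_n.+1) (q : V -> R)
  (g : 'I_n.+1 -> V -> R).

Lemma tnorm_urow y k : tnorm y * urow y 0 k = tnth y k.
Proof.
rewrite mxE; have [t0|t0] := eqVneq (tnorm y) 0; last by rewrite mulVKf.
have := tnth_le_tnorm y k; rewrite t0 normr_le0 => /eqP ->; by rewrite mul0r.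
Qed.

(** Directions vary faster and faster near the origin; the factor [tnorm y] compensates this, which
    is why [epd_coord] integrates [tnorm y * q (r *: urow y)] by parts. *)
Lemma urow_shf_lip j s y k :
  tnorm y * `|urow (shf j s y) 0 k - urow y 0 k| <= 2 * `|s|.
Proof.
rewrite -[in leLHS](ger0_norm (tnorm_ge0 y)) -normrM.
have -> : tnorm y * (urow (shf j s y) 0 k - urow y 0 k) =
    (tnth (shf j s y) k - tnth y k) -
    (tnorm (shf j s y) - tnorm y) * urow (shf j s y) 0 k.
  by rewrite -!tnorm_urow; ring.
rewrite (le_trans (ler_normB _ _))// mulr_natl mulr2n lerD//.
  rewrite tnth_shf addrAC subrr add0r normrM ler_piMr//.
  by case: (k == j); rewrite ?normr1 ?normr0.
by rewrite normrM -[leRHS]mulr1 ler_pM// ?tnorm_shf// urow_le1.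
Qed.

Lemma tnorm_derive j y : y != tzero n.+1 ->
  is_derive (0 : R) 1 (fun s => tnorm (shf j s y)) (urow y 0 j).
Proof.
rewrite -tnorm_eq0 => y0.
have t0 : 0 < tnorm y by rewrite lt_neqAle tnorm_ge0 eq_sym y0.
have -> : (fun s => tnorm (shf j s y)) =
    Num.sqrt \o (fun s => tsq y + 2 * s * tnth y j + s ^+ 2).
  by apply/funext => s; rewrite /= /tnorm tsq_shf.
have P0 : tsq y + 2 * 0 * tnth y j + 0 ^+ 2 = tsq y by ring.
have d1 : is_derive (0 : R) 1 (fun s : R => tsq y + 2 * s * tnth y j + s ^+ 2)
    (2 * tnth y j).
  by apply: is_derive_eq; rewrite /GRing.scale/=; ring.
have := @is_derive1_comp R Num.sqrt _ 0 (2 * Num.sqrt (tsq y))^-1 _ _ d1.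
rewrite P0 => /(_ _) H.
apply: is_derive_eq; first by apply: H; apply: is_derive1_sqrt; rewrite -sqr_tnorm exprn_gt0.
by rewrite mxE /tnorm; field.
Qed.

Lemma urow_derive j y k : y != tzero n.+1 ->
  is_derive (0 : R) 1 (fun s => urow (shf j s y) 0 k)
    ((tnorm y)^-1 * ((k == j)%:R - urow y 0 j * urow y 0 k)).
Proof.
move=> y0; have t0 : tnorm y != 0 by rewrite tnorm_eq0.
have -> : (fun s => urow (shf j s y) 0 k) =
    (fun s => (tnorm (shf j s y))^-1 * (tnth y k + s * (k == j)%:R)).
  by apply/funext => s; rewrite mxE tnth_shf.
have d1 := tnorm_derive j y0.
have d2 : is_derive (0 : R) 1 (fun s => (tnorm (shf j s y))^-1)
    (- (tnorm y) ^- 2 *: urow y 0 j).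
  have := @is_deriveV R (fun s => tnorm (shf j s y)) 0 _ 1 _ d1.
  by rewrite shf0; apply.
have d3 : is_derive (0 : R) 1 (fun s : R => tnth y k + s * (k == j)%:R) (k == j)%:R.
  by apply: is_derive_eq; rewrite /GRing.scale/=; ring.
apply: (is_derive_eq (is_deriveM d2 d3)).
rewrite /GRing.scale/= shf0 mul0r addr0 -[tnth y k]tnorm_urow; field.
by [].
Qed.

(* [gaussian_parts] for the Lipschitz function [tnorm y * q (r y / |y|)]; [second_moment]
   removes the radial factor from the resulting right-hand side. *)
Lemma epd_coord j q qk : rexpansion q qk ->
  (forall k, exists h, rexpansion (qk k) h) -> forall r,
  r * (sint (fun=> 1) (qk j) r -
    \sum_k sint (fun y => urow y 0 j * urow y 0 k) (qk k) r) =
  n%:R * sint (fun y => urow y 0 j) q r.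
Proof.
move=> qe ke r.
have [M [M0 HM]] := rexpansion_bound qe (`|r| * n.+1%:R).
have [L [L0 HL]] := rexpansion_lip qe (`|r| * n.+1%:R).
have cq := rexpansion_rcont qe.
have ck k : rcont (qk k) by have [h /rexpansion_rcont] := ke k.
have cu := measurable_urow (R := R) (n := n).
pose U y := tnorm y * q (r *: urow y).
pose W k y := urow y 0 j * urow y 0 k * qk k (r *: urow y).
(* The derivative of [U] along the coordinate [j]: the factor [tnorm y] cancels the one in the
   derivative of the direction and leaves the tangential part of the gradient of [q]. *)
pose D y := urow y 0 j * q (r *: urow y) +
  (r * (1 * qk j (r *: urow y)) - r * \sum_k W k y).
have mU : measurable_fun setT U.
  by apply: measurable_funM; [exact: measurable_tnorm|exact: measurable_furow].
have mW k : measurable_fun setT (W k).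
  apply: measurable_funM; last exact: measurable_furow.
  by apply: measurable_funM.
have mD : measurable_fun setT D.
  apply: measurable_funD.
    by apply: measurable_funM; [exact: cu|exact: measurable_furow].
  apply: measurable_funB; apply: measurable_funM => //.
    by apply: measurable_funM => //; exact: measurable_furow.
  exact: measurable_sum.
have UM y : `|U y| <= M * expR (tnorm y).
  rewrite normrM ger0_norm ?tnorm_ge0// mulrC ler_pM ?tnorm_ge0//.
    by apply: HM; exact: rnorm1_urow.
  by have := expR_ge1Dx (tnorm y); lra.
have UL y s : `|U (shf j s y) - U y| <= (M + L * (`|r| * n.+1%:R * 2)) * `|s|.
  have -> : U (shf j s y) - U y =
      (tnorm (shf j s y) - tnorm y) * q (r *: urow (shf j s y)) +
      tnorm y * (q (r *: urow (shf j s y)) - q (r *: urow y)).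
    by rewrite /U; ring.
  rewrite [leRHS]mulrDl; apply: (le_trans (ler_normD _ _)); apply: lerD.
    by rewrite normrM mulrC ler_pM// ?tnorm_shf// HM// rnorm1_urow.
  rewrite normrM (ger0_norm (tnorm_ge0 y)).
  apply: (@le_trans _ _ (tnorm y * (L * rnorm1 (r *: urow (shf j s y) - r *: urow y)))).
    by rewrite ler_wpM2l ?tnorm_ge0// HL// rnorm1_urow.
  rewrite mulrCA -mulrA ler_wpM2l// /rnorm1 mulr_sumr.
  have -> : `|r| * n.+1%:R * 2 * `|s| = \sum_(k < n.+1) `|r| * (2 * `|s|).
    by rewrite sumr_const card_ord -[RHS]mulr_natr; ring.
  apply: ler_sum => k _.
  have -> : (r *: urow (shf j s y) - r *: urow y) 0 k =
      r * (urow (shf j s y) 0 k - urow y 0 k).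
    by rewrite mxE [X in X + _]mxE [X in _ + X]mxE [X in - X]mxE mulrBr.
  by rewrite normrM mulrCA ler_wpM2l// urow_shf_lip.
have UD y : y != tzero n.+1 -> is_derive (0 : R) 1 (fun s => U (shf j s y)) (D y).
  move=> y0; have t0 : tnorm y != 0 by rewrite tnorm_eq0.
  pose du : V := \row_k (r * ((tnorm y)^-1 * ((k == j)%:R - urow y 0 j * urow y 0 k))).
  have d1 : is_derive (0 : R) 1 (fun s => q (r *: urow (shf j s y)))
      (\sum_k du 0 k * qk k (r *: urow (shf j 0 y))).
    apply: (rexpansion_chain (u := fun s => r *: urow (shf j s y)) qe) => k.
    have -> : (fun s => (r *: urow (shf j s y)) 0 k) =
        r \*: (fun s => urow (shf j s y) 0 k).
      by apply/funext => s; rewrite [LHS]mxE.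
    have -> : du 0 k = r *: ((tnorm y)^-1 * ((k == j)%:R - urow y 0 j * urow y 0 k)).
      by rewrite [LHS]mxE.
    by apply: is_deriveZ; exact: urow_derive.
  apply: (is_derive_eq (is_deriveM (tnorm_derive j y0) d1)).
  rewrite shf0 /D /GRing.scale/= addrC [q _ * _]mulrC; congr (_ + _).
  rewrite -mulrBr mul1r.
  have -> : qk j (r *: urow y) = \sum_k (k == j)%:R * qk k (r *: urow y).
    rewrite (bigD1 j)//= eqxx mul1r big1 ?addr0// => k /negbTE ->.
    by rewrite mul0r.
  rewrite -sumrB !mulr_sumr; apply: eq_bigr => k _.
  rewrite [du 0 k]mxE /W; field.
  by [].
have parts := gaussian_parts mU mD UM UL UD.
pose H y := urow y 0 j * q (r *: urow y).
have mH : measurable_fun setT H.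
  by apply: measurable_funM; [exact: cu|exact: measurable_furow].
have HMb y : `|H y| <= M.
  rewrite normrM -[leRHS]mul1r ler_pM ?urow_le1//.
  by apply: HM; exact: rnorm1_urow.
have hH : homog0 H by move=> s y s0; rewrite /H urowZ.
have [iH iH2] := gw_bounded_integrable mH HMb.
have sm := second_moment mH HMb hH.
(* Here [2 * tnth y j * U y = 2 * tsq y * H y], whose Gaussian integral is [n + 1] times that of
   [H]. The term [urow y 0 j * q] of [D] cancels one copy, whence the coefficient [n]. *)
have R1 : \int[mu]_y (gw y * (2 * tnth y j * U y)) = n.+1%:R * sint (fun y => urow y 0 j) q r.
  have -> : n.+1%:R * sint (fun y => urow y 0 j) q r =
    2 * (n.+1%:R / 2 * \int[mu]_y (gw y * H y)).
    by rewrite /sint -/H; field.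
  rewrite -sm -RintegralZl//; apply: eq_Rintegral => y _.
  by rewrite /U /H -sqr_tnorm -tnorm_urow; ring.
have iW k : mu.-integrable setT (EFin \o (fun y => gw y * W k y)).
  have [h hk] := ke k; apply: (sint_integrable r _ hk).
  have : coef (fun y => 1 * urow y 0 j * urow y 0 k) by do 2!apply: coefM; exact: coef1.
  by under [X in coef X]funext do rewrite mul1r.
have ij : mu.-integrable setT (EFin \o (fun y => gw y * (1 * qk j (r *: urow y)))).
  by have [h hk] := ke j; exact: (sint_integrable r (@coef1 R n) hk).
have iS := integrable_sumr (index_enum 'I_n.+1) iW.
have L1 : \int[mu]_y (gw y * D y) = sint (fun y => urow y 0 j) q r +
  r * (sint (fun=> 1) (qk j) r -
    \sum_k sint (fun y => urow y 0 j * urow y 0 k) (qk k) r).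
  have -> : \int[mu]_y (gw y * D y) = \int[mu]_y (gw y * H y +
      r * (gw y * (1 * qk j (r *: urow y)) - \sum_k gw y * W k y)).
    by apply: eq_Rintegral => y _; rewrite /D /H -mulr_sumr; ring.
  rewrite RintegralD//; last by apply: integrableZr => //; exact: integrableBr.
  rewrite RintegralZl//; last exact: integrableBr.
  by rewrite RintegralB// Rintegral_sum.
move: parts; rewrite L1 R1 => parts.
apply: (addrI (sint (fun y => urow y 0 j) q r)); rewrite parts.
by rewrite -natr1; ring.
Qed.

End epd.

(** * The spherical mean intertwines the Laplacian and the Bessel operator *)

Section symmetrization.
Context {R : realType} (n : nat).
Local Notation T := (measurableTypeR R).
Local Notation C := R[i].
Local Notation mu := (@lebesgue_tuple R n.+1).
Local Notation V := 'rV[R]_n.+1.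
Implicit Types (r s : R) (j k : 'I_n.+1) (u : V -> R) (f : V -> C)
  (F G : 'rV[C]_n.+1 -> C) (w : C).

Lemma expansionD F G D E : expansion F D -> expansion G E ->
  expansion (fun z => F z + G z) (fun j z => D j z + E j z).
Proof.
move=> [A [K [A0 K0 F1 F2]]] [B [L [B0 L0 G1 G2]]].
have le (z : 'rV[C]_n.+1) : A * expR (K * norm1 z) + B * expR (L * norm1 z) <=
    (A + B) * expR (Num.max K L * norm1 z).
  by rewrite mulrDl lerD// ler_wpM2l// ler_expR ler_wpM2r ?norm1_ge0// le_max lexx ?orbT.
exists (A + B), (Num.max K L); split.
- exact: addr_ge0.
- by rewrite le_max K0.
- move=> z; rewrite (le_trans _ (le z))// (le_trans (ler_normcD _ _))//.
  exact: lerD.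
- move=> z h h1; apply: (@le_trans _ _
    ((A * expR (K * norm1 z) + B * expR (L * norm1 z)) * norm1 h ^+ 2)); last first.
    by rewrite ler_wpM2r ?sqr_ge0.
  rewrite mulrDl.
  have -> : F (z + h) + G (z + h) - (F z + G z) - \sum_j h 0 j * (D j z + E j z) =
      (F (z + h) - F z - \sum_j h 0 j * D j z) + (G (z + h) - G z - \sum_j h 0 j * E j z).
    rewrite (eq_bigr (fun j => h 0 j * D j z + h 0 j * E j z)); last first.
      by move=> j _; rewrite mulrDr.
    by rewrite big_split/=; ring.
  rewrite (le_trans (ler_normcD _ _))// lerD//; [exact: F2|exact: G2].
Qed.

Lemma expansionZ w F D : expansion F D ->
  expansion (fun z => w * F z) (fun j z => w * D j z).
Proof.
move=> [A [K [A0 K0 F1 F2]]]; exists (normc w * A), K; split => //.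
- by rewrite mulr_ge0 ?normc_ge0.
- by move=> z; rewrite normcM -mulrA ler_wpM2l ?normc_ge0.
- move=> z h h1.
  have -> : w * F (z + h) - w * F z - \sum_j h 0 j * (w * D j z) =
      w * (F (z + h) - F z - \sum_j h 0 j * D j z).
    by rewrite !mulrBr mulr_sumr; congr (_ - _); apply: eq_bigr => j _; rewrite mulrCA.
  by rewrite normcM -!mulrA ler_wpM2l ?normc_ge0// mulrA; exact: F2.
Qed.

Lemma expansion0 : expansion (fun _ : 'rV[C]_n.+1 => 0) (fun _ _ => 0).
Proof.
exists 0, 0; split => // z *; first by rewrite normc0 mul0r.
rewrite big1 ?subrr ?subr0 ?normc0 ?mul0r// => j _; exact: mulr0.
Qed.

(** The growth rate is left unspecified, so that the class is closed under the Laplacian and its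
    iterates. *)
Definition csmooth f := exists F D, expansion F D /\ forall x, f x = F (emb x).

Lemma csmoothD f g : csmooth f -> csmooth g -> csmooth (fun x => f x + g x).
Proof.
move=> [F [D [FD fF]]] [G [E [GE gG]]].
exists (fun z => F z + G z), (fun j z => D j z + E j z).
by split => [|x]; [exact: expansionD|rewrite fF gG].
Qed.

Lemma csmooth_sum (I : Type) (s : seq I) (f : I -> V -> C) :
  (forall i, csmooth (f i)) -> csmooth (fun x => \sum_(i <- s) f i x).
Proof.
move=> sf; elim: s => [|i s IH].
  exists (fun=> 0), (fun _ _ => 0); split; first exact: expansion0.
  by move=> x; rewrite big_nil.
by under [X in csmooth X]funext do rewrite big_cons; exact: csmoothD.
Qed.

Lemma Im_sum (I : Type) (s : seq I) (h : I -> C) :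
  complex.Im (\sum_(i <- s) h i) = \sum_(i <- s) complex.Im (h i).
Proof. by elim/big_rec2 : _ => // i a b _ <-; rewrite ImD. Qed.

Definition Ref f x := complex.Re (f x).
Definition Imf f x := complex.Im (f x).

Lemma expansion_Re F D : expansion F D ->
  rexpansion (fun x : V => complex.Re (F (emb x))) (fun j x => complex.Re (D j (emb x))).
Proof.
move=> [A [K [A0 K0 F1 F2]]]; exists A, K; split => //.
  by move=> x; rewrite (le_trans (normc_Re _))// -norm1_emb.
move=> x h h1; rewrite -!norm1_emb.
have := F2 (emb x) (emb h); rewrite norm1_emb => /(_ h1).
apply: le_trans; rewrite embD.
have -> : \sum_j h 0 j * complex.Re (D j (emb x)) =
    complex.Re (\sum_j emb h 0 j * D j (emb x)).
  rewrite Re_sum; apply: eq_bigr => j _.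
  by rewrite ReM mxE /= mul0r subr0.
by rewrite -!ReB normc_Re.
Qed.

Lemma csmooth_grad f : csmooth f -> exists g : 'I_n.+1 -> V -> C,
  [/\ forall j, csmooth (g j), rexpansion (Ref f) (fun j => Ref (g j)) &
      rexpansion (Imf f) (fun j => Imf (g j))].
Proof.
move=> [F [D [FD fF]]].
exists (fun j x => D j (emb x)); split.
- by move=> j; have [D' DD'] := expansion_partial FD j; exists (D j), D'.
- have -> : Ref f = fun x => complex.Re (F (emb x)) by apply/funext => x; rewrite /Ref fF.
  exact: expansion_Re.
(* The imaginary part is the real part after multiplication by [- 'i], so [expansion_Re] serves for
   both. *)
- have ImE w : complex.Im w = complex.Re (- 'i * w).
    by case: w => a b; rewrite mulNr ReN ReM /=; ring.
  have -> : Imf f = fun x => complex.Re (- 'i * F (emb x)).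
    by apply/funext => x; rewrite /Imf fF ImE.
  have -> : (fun j => Imf (fun x => D j (emb x))) =
      fun j x => complex.Re (- 'i * D j (emb x)).
    by apply/funext => j; apply/funext => x; rewrite /Imf ImE.
  exact: (expansion_Re (expansionZ (- 'i) FD)).
Qed.

Lemma derive_line (W : normedModType R) (u : W -> R) (v a : W) :
  'D_v u a = 'D_1 (fun h : R => u (h *: v + a)) 0.
Proof.
rewrite /derive.
have -> : (fun h : R => h^-1 *: ((u \o shift a) (h *: v) - u a)) =
  (fun h : R => h^-1 *: (((fun h : R => u (h *: v + a)) \o shift 0) (h *: 1) - u (0 *: v + a))).
  by apply/funext => h /=; rewrite scale0r add0r addr0 [h *: 1]mulr1.
by [].
Qed.

Lemma rexpansion_partial u (g : 'I_n.+1 -> V -> R) j x : rexpansion u g ->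
  'D_(delta_mx 0 j) u x = g j x.
Proof.
move=> ug; rewrite derive_line.
have d : is_derive (0 : R) 1 (fun h : R => u (h *: delta_mx 0 j + x))
    (\sum_k (delta_mx 0 j : V) 0 k * g k (0 *: delta_mx 0 j + x)).
  apply: (rexpansion_chain (u := fun h : R => h *: delta_mx 0 j + x) ug) => k.
  have -> : (fun h : R => (h *: delta_mx 0 j + x) 0 k) =
      (fun h : R => h * (delta_mx 0 j : V) 0 k + x 0 k).
    by apply/funext => h; rewrite mxE [X in X + _]mxE.
  by apply: is_derive_eq; rewrite /GRing.scale/=; ring.
rewrite derive_val scale0r add0r (bigD1 j)//= mxE !eqxx mul1r big1 ?addr0// => k kj.
by rewrite mxE eqxx (negbTE kj) mul0r.
Qed.

Lemma csmooth_cderive f : csmooth f -> exists g : 'I_n.+1 -> V -> C,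
  [/\ forall j, csmooth (g j), forall j, cderive (delta_mx 0 j) f = g j,
      rexpansion (Ref f) (fun j => Ref (g j)) &
      rexpansion (Imf f) (fun j => Imf (g j))].
Proof.
move=> /csmooth_grad[g [sg gR gI]]; exists g; split => // j.
apply/funext => x; rewrite /cderive.
rewrite (rexpansion_partial j x gR) (rexpansion_partial j x gI).
by rewrite /Ref /Imf; case: (g j x).
Qed.

(** The normalizing factor is the inverse of the Gaussian mass, so this is the mean of [u] over the
    sphere of radius [|r|]. *)
Definition sym u r := (Num.sqrt pi ^+ n.+1)^-1 * sint (fun=> 1) u r.
Definition csym f r : C := sym (Ref f) r +i* sym (Imf f) r.

Lemma sym0 u : sym u 0 = u 0.
Proof.
rewrite /sym sint_zero Rintegral_gw mulKf//.
by rewrite gt_eqF// exprn_gt0// sqrtr_gt0 pi_gt0.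
Qed.

Lemma csym0 f : csym f 0 = f 0.
Proof. by rewrite /csym !sym0 /Ref /Imf; case: (f 0). Qed.

(* The Euler-Poisson-Darboux equation for spherical means. *)
Lemma sym_epd u g gg : rexpansion u g -> (forall j, rexpansion (g j) (gg j)) ->
  (forall j k, exists h, rexpansion (gg j k) h) ->
  exists s1 s2 : R -> R, [/\ forall r, is_derive r 1 (sym u) (s1 r),
    forall r, is_derive r 1 s1 (s2 r) &
    forall r, r * sym (fun x => \sum_j gg j j x) r = r * s2 r + n%:R * s1 r].
Proof.
move=> ug ggg gh.
pose a := (Num.sqrt pi ^+ n.+1 : R)^-1.
pose c2 (j k : 'I_n.+1) y : R := urow y 0 j * urow y 0 k.
pose S1 r := \sum_j sint (fun y => urow y 0 j) (g j) r.
pose S2 r := \sum_j \sum_k sint (c2 j k) (gg j k) r.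
have c1P j : coef (fun y : n.+1.-tuple T => urow y 0 j).
  have := coefM j (@coef1 R n).
  by under [X in coef X]funext do rewrite mul1r.
have d1 r : is_derive r 1 (sint (fun=> 1) u) (S1 r).
  have -> : S1 r = \sum_j sint (fun y => 1 * urow y 0 j) (g j) r.
    by apply: eq_bigr => j _; congr sint; apply/funext => y; rewrite mul1r.
  by apply: sint_derive => //; [exact: coef1|move=> j; exists (gg j)].
have d2 r : is_derive r 1 S1 (S2 r).
  have -> : S1 = \sum_j sint (fun y => urow y 0 j) (g j).
    by apply/funext => s; rewrite fct_sumE.
  by apply: is_derive_sum => j; apply: sint_derive.
have E r : r * sint (fun=> 1) (fun x => \sum_j gg j j x) r = r * S2 r + n%:R * S1 r.
  have -> : sint (fun=> 1) (fun x => \sum_j gg j j x) r = \sum_j sint (fun=> 1) (gg j j) r.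
    rewrite /sint -Rintegral_sum; last first.
      by move=> j; have [h hh] := gh j j; exact: (sint_integrable r (@coef1 R n) hh).
    by apply: eq_Rintegral => y _; rewrite mul1r mulr_sumr; apply: eq_bigr => j _; rewrite mul1r.
  rewrite /S1 /S2 !mulr_sumr -big_split; apply: eq_bigr => j _ /=.
  by rewrite -(epd_coord j (ggg j) (gh j) r); ring.
exists (a \*: S1), (a \*: S2); split => r.
- have -> : sym u = a \*: sint (fun=> 1) u by apply/funext.
  exact: is_deriveZ.
- exact: is_deriveZ.
- by rewrite /sym -/a /= /GRing.scale/= mulrCA E; ring.
Qed.

Lemma csmooth_laplacian f : csmooth f -> csmooth (laplacian f).
Proof.
move=> /csmooth_cderive[g [sg gE _ _]].
have -> : laplacian f = fun x => \sum_j cderive (delta_mx 0 j) (g j) x.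
  by apply/funext => x; apply: eq_bigr => j _; rewrite gE.
apply: csmooth_sum => j.
by have [h [sh -> _ _]] := csmooth_cderive (sg j).
Qed.

(** For this index [2 * nu + 1 = n], and off 0 the identity is [sym_epd] divided by [r]. At 0 the
    Bessel operator is a limit, computed from the continuity of the spherical mean of the
    Laplacian. *)
Lemma bessel_csym f : csmooth f ->
  bessel (n.+1%:R / 2 - 1) (csym f) = csym (laplacian f).
Proof.
move=> sf; have [g [sg gE gR gI]] := csmooth_cderive sf.
have /choice[gg ggP] j := csmooth_cderive (sg j).
have lE : laplacian f = fun x => \sum_j gg j j x.
  apply/funext => x; apply: eq_bigr => j _; rewrite gE.
  by have [_ -> _ _] := ggP j.
have ggR j : rexpansion (Ref (g j)) (fun k => Ref (gg j k)) by have [] := ggP j.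
have ggI j : rexpansion (Imf (g j)) (fun k => Imf (gg j k)) by have [] := ggP j.
have ggRh j k : exists h, rexpansion (Ref (gg j k)) h.
  by have [s _ _ _] := ggP j; have [h [_ H _]] := csmooth_grad (s k); exists (fun i => Ref (h i)).
have ggIh j k : exists h, rexpansion (Imf (gg j k)) h.
  by have [s _ _ _] := ggP j; have [h [_ _ H]] := csmooth_grad (s k); exists (fun i => Imf (h i)).
have [a1 [a2 [da1 da2 ae]]] := sym_epd gR ggR ggRh.
have [b1 [b2 [db1 db2 be]]] := sym_epd gI ggI ggIh.
have lR : Ref (laplacian f) = fun x => \sum_j Ref (gg j j) x.
  by apply/funext => x; rewrite /Ref lE Re_sum.
have lI : Imf (laplacian f) = fun x => \sum_j Imf (gg j j) x.
  by apply/funext => x; rewrite /Imf lE Im_sum.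
have D1 : cderive (1 : R) (csym f) = fun r => a1 r +i* b1 r.
  by apply/funext => r; rewrite /cderive /csym /= !derive_val.
have D2 : cderive (1 : R) (cderive (1 : R) (csym f)) = fun r => a2 r +i* b2 r.
  by rewrite D1; apply/funext => r; rewrite /cderive /= !derive_val.
have A r : r != 0 -> bessel_away (n.+1%:R / 2 - 1) (csym f) r = csym (laplacian f) r.
  move=> r0; rewrite /bessel_away D2 D1 /csym lR lI.
  have -> : sym (fun x => \sum_j Ref (gg j j) x) r = a2 r + n%:R / r * a1 r.
    by apply: (mulfI r0); rewrite ae; field.
  have -> : sym (fun x => \sum_j Imf (gg j j) x) r = b2 r + n%:R / r * b1 r.
    by apply: (mulfI r0); rewrite be; field.
  have -> : 2 * (n.+1%:R / 2 - 1) + 1 = n%:R :> R by rewrite -natr1; field.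
  by apply: complex_ext; rewrite ?ReD ?ImD ?ReM ?ImM /=; ring.
have lim0 u h' (q : R -> R) : rexpansion u h' -> (forall j, exists h2, rexpansion (h' j) h2) ->
    (forall s, s != 0 -> q s = sym u s) -> lim (q s @[s --> (0 : R)^']) = sym u 0.
  move=> uh hh qE; apply: cvg_lim => //.
  have d : derivable (sint (fun=> 1) u) 0 1.
    by have [] := sint_derive (@coef1 R n) uh hh 0.
  have c : sym u s @[s --> (0 : R)] --> sym u 0.
    by apply: cvgMr; exact/differentiable_continuous/derivable1_diffP.
  apply: (@cvg_trans _ (sym u s @[s --> (0 : R)^'])); last exact: cvg_within_filter.
  apply: near_eq_cvg; near=> s; rewrite qE//.
  by near: s; exact: nbhs_dnbhs_neq.
have [h [sh hR hI]] := csmooth_grad (csmooth_laplacian sf).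
have hhR j : exists h2, rexpansion (Ref (h j)) h2.
  by have [h2 [_ H _]] := csmooth_grad (sh j); exists (fun i => Ref (h2 i)).
have hhI j : exists h2, rexpansion (Imf (h j)) h2.
  by have [h2 [_ _ H]] := csmooth_grad (sh j); exists (fun i => Imf (h2 i)).
apply/funext => r; rewrite /bessel; case: eqP => [->|/eqP]; last exact: A.
by rewrite (lim0 _ _ _ hR hhR) ?(lim0 _ _ _ hI hhI)// => s s0; rewrite A.
Unshelve. all: end_near. Qed.

Lemma iter_bessel_csym N f : csmooth f ->
  iter N (bessel (n.+1%:R / 2 - 1)) (csym f) 0 = iter N laplacian f 0.
Proof.
move=> sf; suff : iter N (bessel (n.+1%:R / 2 - 1)) (csym f) = csym (iter N laplacian f) /\
    csmooth (iter N laplacian f) by move=> [-> _]; rewrite csym0.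
by elim: N => //= N [-> sN]; split; [exact: bessel_csym|exact: csmooth_laplacian].
Qed.

End symmetrization.

(** * Spherical means and radial lifts of entire functions *)

Section differentiable_criterion.
Context {R : realType} (m : nat).
Local Notation C := R[i].
Local Notation V := 'rV[C]_m.
Implicit Types (z h v : V) (F : V -> C) (a : 'I_m -> C) (e r : R).

Lemma coord_le_norm (h : 'rV[C^o]_m) j : `|h 0 j| <= `|h|.
Proof.
rewrite [leRHS]/Num.Def.normr /= mx_normE.
rewrite [leLHS](_ : _ = (`|h 0 j|%:nng : {nonneg C})%:num)// num_le.
exact: (le_bigmax _ (fun ij : 'I_1 * 'I_m => `|h ij.1 ij.2|%:nng : {nonneg C}) (0, j)).
Qed.

Lemma norm1_le_norm (h : 'rV[C^o]_m) : (norm1 (h : V))%:C <= m%:R * `|h|.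
Proof.
rewrite /norm1 rmorph_sum /= mulr_natl -[X in _ *+ X](card_ord m) -sumr_const.
by apply: ler_sum => j _; rewrite -normr_normc coord_le_norm.
Qed.

Definition lform a (h : 'rV[C^o]_m) : C^o := \sum_j h 0 j * a j.

Lemma lform_is_linear a : linear (lform a).
Proof.
move=> w h v; rewrite scaler_sumr -big_split; apply: eq_bigr => j _ /=.
by rewrite !mxE mulrDl -mulrA.
Qed.

HB.instance Definition _ a := GRing.isLinear.Build _ _ _ _ (lform a) (lform_is_linear a).

Lemma lform_continuous a : continuous (lform a).
Proof.
suff H (s : seq 'I_m) :
    continuous ((fun h => \sum_(j <- s) h 0 j * a j) : 'rV[C^o]_m -> C^o) by exact: H.
elim: s => [|j s IH].
  have -> : ((fun h => \sum_(j <- [::]) h 0 j * a j) : 'rV[C^o]_m -> C^o) = cst 0.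
    by apply/funext => h; rewrite big_nil.
  exact: cst_continuous.
have -> : ((fun h => \sum_(j <- j :: s) h 0 j * a j) : 'rV[C^o]_m -> C^o) =
    (fun h => h 0 j * a j) \+ (fun h => \sum_(j <- s) h 0 j * a j).
  by apply/funext => h; rewrite big_cons.
move=> h; apply: cvgD; [exact: nbhs_filter| |exact: IH].
apply: (@cvgM C _ _ (nbhs_filter h) (fun h : 'rV[C^o]_m => h 0 j : C^o) (cst (a j)) (h 0 j) (a j)).
  exact: (@coord_continuous C^o).
exact: cvg_cst.
Qed.

(** Returns from estimates in [norm1] to differentiability over the field [C], whose row vectors
    carry the maximum norm. *)
Lemma entire_criterion F : (forall z, exists a, forall e, 0 < e ->
    exists2 r, 0 < r & forall h, norm1 h < r ->
      normc (F (z + h) - F z - \sum_j h 0 j * a j) <= e * norm1 h) -> entire F.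
Proof.
move=> H z; have [a Ha] := H z.
pose G : 'rV[C^o]_m -> C^o := F.
pose l : {linear 'rV[C^o]_m -> C^o} := lform a.
have L (eps : C) : 0 < eps -> \forall h \near (0 : 'rV[C^o]_m),
    `|G (h + z) - (G z + l h)| <= eps * `|h|.
  case: eps => e e'; rewrite ltcE /= => /andP[/eqP -> e0].
  have m0 : 0 < m.+1%:R :> R by rewrite ltr0n.
  (* The comparison of the two norms costs a factor [m]; [m.+1] keeps the divisor positive in
     dimension 0. *)
  have [r r0 Hr] := Ha (e / m.+1%:R) (divr_gt0 e0 m0).
  have rm : 0 < (r / m.+1%:R)%:C :> C by rewrite ltcR divr_gt0.
  apply/nbhs_normP; exists (r / m.+1%:R)%:C => //= h; rewrite /ball_/= sub0r normrN => hr.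
  have hm : (norm1 (h : V))%:C <= (m.+1%:R * `|h| : C).
    by rewrite (le_trans (norm1_le_norm h))// ler_wpM2r// ler_nat.
  have h1 : norm1 (h : V) < r.
    rewrite -ltcR (le_lt_trans hm)//.
    have -> : r%:C = m.+1%:R * (r / m.+1%:R)%:C :> C.
      by rewrite -(rmorph_nat (real_complex R)) -rmorphM /= mulrC divfK ?gt_eqF.
    by rewrite ltr_pM2l.
  have := Hr _ h1; rewrite -lecR -normr_normc => B.
  rewrite /= [h + z]addrC /G opprD addrA (le_trans B)//.
  rewrite rmorphM /= -[e +i* 0]/(e%:C).
  apply: (@le_trans _ _ ((e / m.+1%:R)%:C * (m.+1%:R * `|h|))).
    by rewrite ler_wpM2l// lecR divr_ge0// ltW.
  by rewrite mulrA -(rmorph_nat (real_complex R)) -rmorphM /= divfK ?gt_eqF.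
have dE : 'd G (z : 'rV[C^o]_m) = l :> (_ -> _).
  by apply: diff_unique; [exact: lform_continuous|exact/eqaddoP].
apply/diff_locallyP; rewrite dE; split; first exact: lform_continuous.
exact/eqaddoP.
Qed.

Lemma entire_quadratic F : (forall z, exists a, exists M r : R, [/\ 0 <= M, 0 < r &
    forall h, norm1 h <= r ->
      normc (F (z + h) - F z - \sum_j h 0 j * a j) <= M * norm1 h ^+ 2]) -> entire F.
Proof.
move=> H; apply: entire_criterion => z; have [a [M [r [M0 r0 Hr]]]] := H z.
have M1 : 0 < M + 1 by rewrite ltr_wpDl.
exists a => e e0; exists (Num.min r (e / (M + 1))); first by rewrite lt_min r0 divr_gt0.
move=> h; rewrite lt_min => /andP[h1 h2].
rewrite (le_trans (Hr _ (ltW h1)))// expr2 mulrA ler_wpM2r ?norm1_ge0//.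
apply: (@le_trans _ _ ((M + 1) * norm1 h)).
  by rewrite ler_wpM2r ?norm1_ge0// lerDl.
by rewrite mulrC -ler_pdivlMr// ltW.
Qed.

End differentiable_criterion.

Section translation.
Context {R : realType} (m : nat).
Local Notation C := R[i].
Local Notation V := 'rV[C]_m.
Implicit Types (z h v : V) (F : V -> C).

Lemma cnorm2_ge0 z : 0 <= cnorm2 z. Proof. exact: sqrtr_ge0. Qed.

Lemma sqr_cnorm2 z : cnorm2 z ^+ 2 = \sum_j normc (z 0 j) ^+ 2.
Proof. by rewrite sqr_sqrtr// sumr_ge0// => j _; exact: sqr_ge0. Qed.

Lemma cauchy_schwarz (x y : 'I_m -> R) (A B : R) : 0 <= A -> 0 <= B ->
  \sum_j x j ^+ 2 = A ^+ 2 -> \sum_j y j ^+ 2 = B ^+ 2 -> \sum_j x j * y j <= A * B.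
Proof.
move=> A0 B0 xA yB.
have zero (u : 'I_m -> R) : \sum_j u j ^+ 2 = 0 -> forall j, u j = 0.
  move=> u0 j; apply/eqP; rewrite -sqrf_eq0; apply/eqP.
  by have /psumr_eq0P := u0; apply => // i _; exact: sqr_ge0.
have [A1|A1] := eqVneq A 0.
  move: xA; rewrite A1 expr0n => /zero x0.
  by rewrite mul0r big1// => j _; rewrite x0 mul0r.
have [B1|B1] := eqVneq B 0.
  move: yB; rewrite B1 expr0n => /zero y0.
  by rewrite mulr0 big1// => j _; rewrite y0 mulr0.
have : 0 <= \sum_j (x j * B - y j * A) ^+ 2 by apply: sumr_ge0 => j _; exact: sqr_ge0.
have -> : \sum_j (x j * B - y j * A) ^+ 2 =
    B ^+ 2 * \sum_j x j ^+ 2 + A ^+ 2 * \sum_j y j ^+ 2 - 2 * (A * B) * \sum_j x j * y j.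
  rewrite !mulr_sumr -big_split -sumrB; apply: eq_bigr => j _ /=; ring.
rewrite xA yB.
have -> : B ^+ 2 * A ^+ 2 + A ^+ 2 * B ^+ 2 - 2 * (A * B) * (\sum_j x j * y j) =
  2 * (A * B) * (A * B - \sum_j x j * y j) by ring.
by rewrite pmulr_rge0 ?subr_ge0// !mulr_gt0// lt_neqAle eq_sym ?A1 ?B1.
Qed.

Lemma ler_cnorm2D z h : cnorm2 (z + h) <= cnorm2 z + cnorm2 h.
Proof.
rewrite -(@ler_pXn2r _ 2) ?nnegrE ?addr_ge0 ?cnorm2_ge0//.
rewrite sqr_cnorm2 sqrrD !sqr_cnorm2.
apply: (@le_trans _ _ (\sum_j (normc (z 0 j) + normc (h 0 j)) ^+ 2)).
  apply: ler_sum => j _; rewrite mxE lerXn2r ?nnegrE ?addr_ge0 ?normc_ge0//.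
  exact: ler_normcD.
under eq_bigr do rewrite sqrrD.
rewrite !big_split/= lerD2r lerD2l -mulr2n lerMn2r /=.
by apply: cauchy_schwarz; rewrite ?cnorm2_ge0 ?sqr_cnorm2.
Qed.

Lemma spherical_type_shift F (s : R) v : 0 <= s -> spherical_type s F ->
  spherical_type s (fun z => F (v + z)).
Proof.
move=> s0 sF e e0; have [C0 H] := sF e e0.
have C00 : 0 <= C0.
  have := H 0; rewrite -(pmulr_lge0 _ (expR_gt0 (s * (1 + e) * cnorm2 (0 : V)))).
  by apply: le_trans; exact: normc_ge0.
exists (C0 * expR (s * (1 + e) * cnorm2 v)) => z.
rewrite (le_trans (H _))// -[leRHS]mulrA ler_wpM2l// -expRD ler_expR -mulrDr.
by rewrite ler_wpM2l ?ler_cnorm2D// mulr_ge0// addr_ge0// ltW.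
Qed.

(** Yields, from a nonzero [f], a function of the same type that does not vanish at the origin. *)
Lemma exp_type_shift (f : 'rV[R]_m -> C) x : exp_type 1 m f ->
  exp_type 1 m (fun y => f (x + y)).
Proof.
move=> [F [eF sF fF]]; exists (fun z => F (emb x + z)); split.
- have [D [A [K [A0 K0 F1 F2]]]] := entire_expansion eF sF.
  apply: entire_quadratic => z.
  exists (D ^~ (emb x + z)), (A * expR (K * norm1 (emb x + z))), 1; split => //.
    by rewrite mulr_ge0 ?expR_ge0.
  by move=> h h1; rewrite addrA; exact: F2.
- exact: spherical_type_shift.
- by move=> y; rewrite fF -/(emb (x + y)) embD.
Qed.

End translation.

Section sphere_extension.
Context {R : realType} (n : nat).
Local Notation T := (measurableTypeR R).
Local Notation C := R[i].
Local Notation mu := (@lebesgue_tuple R n.+1).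
Local Notation V := 'rV[R]_n.+1.
Implicit Types (y : n.+1.-tuple T) (r s : R) (j k : 'I_n.+1) (f : V -> C)
  (F G : 'rV[C]_n.+1 -> C) (w z : C) (c : n.+1.-tuple T -> R).

Definition cunit y : 'rV[C]_n.+1 := emb (urow y).

Lemma norm1_cunit z y : norm1 (z *: cunit y) <= normc z * n.+1%:R.
Proof.
rewrite norm1Z norm1_emb ler_wpM2l ?normc_ge0//.
by have := rnorm1_urow 1 y; rewrite scale1r normr1 mul1r.
Qed.

Lemma cnorm2_cunit z y : cnorm2 (z *: cunit y) <= normc z.
Proof.
rewrite -(@ler_pXn2r _ 2) ?nnegrE ?cnorm2_ge0 ?normc_ge0// sqr_cnorm2.
have -> : \sum_j normc ((z *: cunit y) 0 j) ^+ 2 = normc z ^+ 2 * \sum_j urow y 0 j ^+ 2.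
  rewrite mulr_sumr; apply: eq_bigr => j _.
  by rewrite mxE normcM [cunit y 0 j]mxE normc_real exprMn real_normK// num_real.
rewrite ler_piMr ?sqr_ge0//.
have [->|y0] := eqVneq y (tzero n.+1); last by rewrite urow_sqr.
rewrite big1// => j _; rewrite mxE.
by have := tnorm_eq0 (tzero n.+1 : n.+1.-tuple T); rewrite eqxx => /eqP ->; rewrite invr0 mul0r expr0n.
Qed.

Lemma cunit_integrable c F z (A K : R) : coef c -> mcont F ->
  0 <= A -> 0 <= K -> (forall v, normc (F v) <= A * expR (K * norm1 v)) ->
  cintegrable mu setT (fun y => (gw y * c y)%:C * F (z *: cunit y)).
Proof.
move=> [mc c1] cF A0 K0 FA.
have bnd y : normc (F (z *: cunit y)) <= A * expR (K * (normc z * n.+1%:R)).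
  by rewrite (le_trans (FA _))// ler_wpM2l// ler_expR ler_wpM2l// norm1_cunit.
(* [p] stands for the real or the imaginary part, both 1-Lipschitz. *)
have rc (p : C -> R) : (forall a b, `|p a - p b| <= normc (a - b)) ->
    rcont (fun x : V => p (F (z *: emb x))).
  move=> pl x e e0; have [r r0 H] := cF (z *: emb x) e e0.
  have d0 : 0 < normc z * n.+1%:R + 1 by rewrite ltr_wpDl// mulr_ge0 ?normc_ge0.
  exists (r / (normc z * n.+1%:R + 1)); first by rewrite divr_gt0.
  move=> x' xx'; rewrite (le_trans (pl _ _))//.
  have -> : z *: emb x' = z *: emb x + z *: emb (x' - x).
    by rewrite -scalerDr -embD addrC subrK.
  apply: H; rewrite norm1Z norm1_emb.
  apply: (@le_lt_trans _ _ (normc z * (n.+1%:R * (r / (normc z * n.+1%:R + 1))))).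
    rewrite ler_wpM2l ?normc_ge0// mulr_natl -[X in _ *+ X](card_ord n.+1) -sumr_const.
    by apply: ler_sum => j _; rewrite !mxE ltW.
  by rewrite !mulrA ltr_pdivrMr// mulrC ltr_pM2l// ltrDl.
have key (p : C -> R) : (forall a b, `|p a - p b| <= normc (a - b)) -> p 0 = 0 ->
    mu.-integrable setT (EFin \o (fun y => gw y * (c y * p (F (z *: cunit y))))).
  move=> pl p0; apply: (gw_integrable (C := A * expR (K * (normc z * n.+1%:R))) (a := 0)).
    apply: measurable_funM => //.
    have := measurable_furow 1 (rc p pl).
    by under [X in measurable_fun _ X]funext do rewrite scale1r.
  move=> y; rewrite mul0r expR0 mulr1 normrM -[leRHS]mul1r ler_pM//.
  by apply: le_trans (bnd y); have := pl (F (z *: cunit y)) 0; rewrite p0 !subr0.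
split.
  under [X in EFin \o X]funext do rewrite ReM /= mul0r subr0 -mulrA.
  by apply: key => // a b; rewrite -ReB normc_Re.
under [X in EFin \o X]funext do rewrite ImM /= mul0r addr0 -mulrA.
by apply: key => // a b; rewrite -ImB normc_Im.
Qed.

(** The spherical mean with the radius made complex. The factor 1 is the weight [coef1], in the form
    that [cunit_integrable] expects. *)
Definition sphere_ext F z : C := ((Num.sqrt pi ^+ n.+1)^-1)%:C *
  cint mu setT (fun y => (gw y * 1)%:C * F (z *: cunit y)).

Lemma gw_int_gt0 : 0 < Num.sqrt pi ^+ n.+1 :> R.
Proof. by rewrite exprn_gt0// sqrtr_gt0 pi_gt0. Qed.

Lemma gw_integrable_cst (M : R) : mu.-integrable setT (EFin \o (fun y => M * gw y)).
Proof. by apply: integrableZr => //; exact: gw_Rintegrable. Qed.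

Lemma normc_gw_cint (f : n.+1.-tuple T -> C) (M : R) : cintegrable mu setT f ->
  (forall y, normc (f y) <= M * gw y) ->
  normc (((Num.sqrt pi ^+ n.+1)^-1)%:C * cint mu setT f) <= M.
Proof.
move=> fi fM; rewrite normcM normc_real ger0_norm ?invr_ge0 ?(ltW gw_int_gt0)//.
rewrite mulrC ler_pdivrMr ?gw_int_gt0//.
rewrite (le_trans (normc_cint _ fi (gw_integrable_cst M) _))//.
rewrite RintegralZl//; last exact: gw_Rintegrable.
by rewrite Rintegral_gw.
Qed.

Lemma csym_sphere_ext f F : (forall x, f x = F (emb x)) -> forall r,
  csym f r = sphere_ext F r%:C.
Proof.
move=> fF r; rewrite /csym /sym /sphere_ext /cint /sint.
have e y : f (r *: urow y) = F (r%:C *: cunit y).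
  by rewrite fF; congr F; apply/rowP => j; rewrite !mxE rmorphM.
have -> : \int[mu]_y complex.Re ((gw y * 1)%:C * F (r%:C *: cunit y)) =
    \int[mu]_y (gw y * (1 * Ref f (r *: urow y))).
  by apply: eq_Rintegral => y _; rewrite ReM /= mul0r subr0 /Ref e mul1r mulr1.
have -> : \int[mu]_y complex.Im ((gw y * 1)%:C * F (r%:C *: cunit y)) =
    \int[mu]_y (gw y * (1 * Imf f (r *: urow y))).
  by apply: eq_Rintegral => y _; rewrite ImM /= mul0r addr0 /Imf e mul1r mulr1.
by apply: complex_ext; rewrite ?ReM ?ImM /=; ring.
Qed.

Lemma coord_row1 (z : 'rV[C]_1) : norm1 z = normc (z 0 0).
Proof. by rewrite /norm1 big_ord1. Qed.

(** The quadratic expansion of [F] along [cunit y] is uniform in [y], hence survives the Gaussian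
    mean. *)
Lemma sphere_ext_entire F D : expansion F D ->
  entire (fun z : 'rV[C]_1 => sphere_ext F (z 0 0)).
Proof.
move=> FD; have [A [K [A0 K0 F1 F2]]] := FD.
have [B [L [B0 L0 D1]]] := expansion_partial_bound FD.
have cF := expansion_mcont FD; have cD := expansion_partial_mcont FD.
pose a := ((Num.sqrt pi ^+ n.+1)^-1)%:C : C.
have iF z := cunit_integrable z (@coef1 R n) cF A0 K0 F1.
have cj j : coef (fun y : n.+1.-tuple T => urow y 0 j).
  have := coefM j (@coef1 R n).
  by under [X in coef X]funext do rewrite mul1r.
have iD z j := cunit_integrable z (cj j) (cD j) B0 L0 (D1 ^~ j).
apply: entire_quadratic => z0; pose z := z0 0 0.
exists (fun=> a * \sum_j cint mu setT (fun y => (gw y * urow y 0 j)%:C * D j (z *: cunit y))).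
exists (A * expR (K * (normc z * n.+1%:R)) * n.+1%:R ^+ 2), (n.+1%:R^-1); split.
- by rewrite !mulr_ge0 ?expR_ge0 ?sqr_ge0.
- by rewrite invr_gt0.
move=> h0; rewrite coord_row1 big_ord1 mxE -/z; set h := h0 0 0 => h1.
have iS : cintegrable mu setT
    (fun y => \sum_j (gw y * urow y 0 j)%:C * D j (z *: cunit y)).
  exact: cintegrable_sum.
have iB : cintegrable mu setT (fun y => (gw y * 1)%:C * F ((z + h) *: cunit y) -
    (gw y * 1)%:C * F (z *: cunit y)).
  exact: cintegrableB.
have iZ : cintegrable mu setT
    (fun y => h * \sum_j (gw y * urow y 0 j)%:C * D j (z *: cunit y)).
  exact: cintegrableZ.
rewrite /sphere_ext -/a.
have -> : a * cint mu setT (fun y => (gw y * 1)%:C * F ((z + h) *: cunit y)) -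
    a * cint mu setT (fun y => (gw y * 1)%:C * F (z *: cunit y)) -
    h * (a * \sum_j cint mu setT (fun y => (gw y * urow y 0 j)%:C * D j (z *: cunit y))) =
  a * cint mu setT (fun y => (gw y * 1)%:C * F ((z + h) *: cunit y) -
    (gw y * 1)%:C * F (z *: cunit y) -
    h * \sum_j (gw y * urow y 0 j)%:C * D j (z *: cunit y)).
  by rewrite cintB// cintB// cintZ// cint_sum// (mulrCA h a) !mulrBr.
apply: normc_gw_cint; first exact: cintegrableB.
move=> y.
have -> : (gw y * 1)%:C * F ((z + h) *: cunit y) - (gw y * 1)%:C * F (z *: cunit y) -
    h * \sum_j (gw y * urow y 0 j)%:C * D j (z *: cunit y) =
  (gw y)%:C * (F (z *: cunit y + h *: cunit y) - F (z *: cunit y) -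
    \sum_j (h *: cunit y) 0 j * D j (z *: cunit y)).
  rewrite -scalerDl mulr1 !mulrBr; congr (_ - _).
  rewrite !mulr_sumr; apply: eq_bigr => j _.
  have -> : (h *: cunit y) 0 j = h * (urow y 0 j)%:C by rewrite mxE [cunit y 0 j]mxE.
  by rewrite rmorphM; ring.
rewrite normcM normc_real ger0_norm ?gw_ge0// mulrC ler_wpM2r ?gw_ge0//.
have hu : norm1 (h *: cunit y) <= normc h * n.+1%:R by exact: norm1_cunit.
have hu1 : norm1 (h *: cunit y) <= 1.
  by rewrite (le_trans hu)// -ler_pdivlMr ?ltr0n// mul1r.
rewrite (le_trans (F2 _ _ hu1))// -[leRHS]mulrA -exprMn.
apply: ler_pM.
- by rewrite mulr_ge0 ?expR_ge0.
- exact: sqr_ge0.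
- by rewrite ler_wpM2l// ler_expR ler_wpM2l// norm1_cunit.
- by rewrite mulrC lerXn2r ?nnegrE ?norm1_ge0 ?mulr_ge0 ?normc_ge0.
Qed.

(** [cunit y] has Euclidean norm at most 1, so the type is preserved exactly. The estimate is made
    with [cnorm2], since [norm1] would enlarge the type. *)
Lemma sphere_ext_type F D (t : R) : 0 <= t -> expansion F D -> spherical_type t F ->
  spherical_type t (fun z : 'rV[C]_1 => sphere_ext F (z 0 0)).
Proof.
move=> t0 FD sF e e0; have [A [K [A0 K0 F1 F2]]] := FD.
have [C0 H] := sF e e0.
have C00 : 0 <= C0.
  have := H 0; rewrite -(pmulr_lge0 _ (expR_gt0 (t * (1 + e) * cnorm2 (0 : 'rV[C]_n.+1)))).
  by apply: le_trans; exact: normc_ge0.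
exists C0 => z; apply: normc_gw_cint.
  exact: (cunit_integrable (z 0 0) (@coef1 R n) (expansion_mcont FD) A0 K0 F1).
move=> y; rewrite mulr1 normcM normc_real ger0_norm ?gw_ge0// mulrC ler_wpM2r ?gw_ge0//.
rewrite (le_trans (H _))// ler_wpM2l// ler_expR ler_wpM2l//.
  by rewrite mulr_ge0// addr_ge0// ltW.
have -> : cnorm2 z = normc (z 0 0).
  by rewrite /cnorm2 big_ord1 sqrtr_sqr ger0_norm// normc_ge0.
exact: cnorm2_cunit.
Qed.

Lemma urow_reflect y : urow (aff (-1) (fun=> 0) y) = - urow y.
Proof.
rewrite -tscale_aff; apply/rowP => j; rewrite !mxE tnormZ normrN normr1 mul1r.
by rewrite tnth_mktuple mulN1r mulrN.
Qed.

Lemma sym_even (u : V -> R) g : rexpansion u g -> forall r, sym u (- r) = sym u r.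
Proof.
move=> ug r; rewrite /sym; congr (_ * _); rewrite /sint /Rintegral; congr fine.
have N1 : `|-1 : R| = 1 by rewrite normrN normr1.
have [mf _] := integrableP _ _ _ (sint_integrable r (@coef1 R n) ug).
rewrite -(@integral_isometry R n.+1 (-1) (fun=> 0) _ N1 mf).
apply: eq_integral => y _ /=; rewrite urow_reflect scalerN scaleNr.
by rewrite -tscale_aff /gw tsqZ sqrrN expr1n !mul1r.
Qed.

Lemma csym_exp_type f : exp_type 1 n.+1 f -> exp_type1_even 1 (csym f).
Proof.
move=> [F [eF sF fF]]; have [D FD] := entire_expansion eF sF.
have cf : csmooth f by exists F, D.
split; last first.
  move=> t; have [g [_ gR gI]] := csmooth_grad cf.
  by rewrite /csym (sym_even gR) (sym_even gI).
exists (fun z : 'rV[C]_1 => sphere_ext F (z 0 0)); split.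
- exact: sphere_ext_entire FD.
- exact: (sphere_ext_type _ FD).
- by move=> x; rewrite (csym_sphere_ext fF) mxE.
Qed.

Lemma exp_type_csmooth f : exp_type 1 n.+1 f -> csmooth f.
Proof. by move=> [F [eF sF fF]]; have [D FD] := entire_expansion eF sF; exists F, D. Qed.

End sphere_extension.

(** * From an even function of one variable to a function of the sum of squares *)

Section even_function.
Context {R : realType}.
Local Notation C := R[i].
Implicit Types (s w h : C) (e t : R) (P : C -> C) (F : 'rV[C]_1 -> C).

Lemma normcX w n : normc (w ^+ n) = normc w ^+ n.
Proof. by elim: n => [|n IH]; rewrite ?expr0 ?normc1// !exprS normcM IH. Qed.

Definition row1 w : 'rV[C]_1 := w *: delta_mx 0 0.

Lemma norm1_row1 w : norm1 (row1 w) = normc w.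
Proof. by rewrite norm1Z norm1_delta mulr1. Qed.

Lemma row1D w h : row1 (w + h) = row1 w + row1 h.
Proof. exact: scalerDl. Qed.

Lemma row1N w : row1 (- w) = - row1 w.
Proof. exact: scaleNr. Qed.

Lemma expansion_opp F D : expansion F D ->
  expansion (fun z => F (- z)) (fun j z => - D j (- z)).
Proof.
have N (z : 'rV[C]_1) : norm1 (- z) = norm1 z.
  by rewrite -scaleN1r norm1Z normcN normc1 mul1r.
move=> [A [K [A0 K0 F1 F2]]]; exists A, K; split => // [z|z h h1].
  by rewrite -(N z) F1.
have := F2 (- z) (- h); rewrite !N => /(_ h1).
by rewrite opprD !big_ord1 mxE mulrN mulNr.
Qed.

(** Collects what the lift uses: evenness and growth, a quadratic remainder at every point, and at 0
    an expansion without linear term and with cubic remainder, [c] being half the second derivative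
    there. *)
Definition type1_even P (P' : C -> C) (c : C) := [/\ forall w, P (- w) = P w,
  forall e, 0 < e -> exists C0 : R, forall w, normc (P w) <= C0 * expR ((1 + e) * normc w),
  forall s, exists M : R, 0 <= M /\ forall h, normc h <= 1 ->
    normc (P (s + h) - P s - P' s * h) <= M * normc h ^+ 2 &
  exists M : R, 0 <= M /\ forall s, normc s <= 1 ->
    normc (P s - P 0 - c * s ^+ 2) <= M * normc s ^+ 3].

Lemma exp_type1_even_ext (g : R -> C) : exp_type1_even 1 g ->
  exists P P' c, type1_even P P' c /\ forall t, g t = P t%:C.
Proof.
move=> [[F [eF sF gF]] ge]; have [D0 FD0] := entire_expansion eF sF.
(* Averaging [F z] and [F (- z)] produces an even extension; on the real line it is still [g],
   because [g] is even. *)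
pose G (z : 'rV[C]_1) := 2^-1 * (F z + F (- z)).
pose D (j : 'I_1) (z : 'rV[C]_1) := 2^-1 * (D0 j z + - D0 j (- z)).
have GD : expansion G D by apply: expansionZ; apply: expansionD => //; exact: expansion_opp.
have [E DE] := expansion_partial GD 0.
pose P w := G (row1 w); pose P' w := D 0 (row1 w); pose c := E 0 0.
have gP t : g t = P t%:C.
  have e1 u : F (row1 u%:C) = g u.
    have := gF (\row_(_ < 1) u); rewrite mxE => ->; congr F.
    by apply/rowP => j; rewrite !mxE !ord1 eqxx mulr1.
  by rewrite /P /G -row1N -rmorphN !e1 ge; field.
have dP w : cdiff P w (P' w).
  have := expansion_cdiff GD 0 0 w.
  under [X in cdiff X]funext do rewrite add0r.
  by rewrite add0r.
have P'0 : P' 0 = 0.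
  by rewrite /P' /D /row1 scale0r oppr0 subrr mulr0.
exists P, P', (2^-1 * c); split=> //; split.
- by move=> w; rewrite /P /G row1N opprK addrC.
- move=> e e0; have [C0 H] := sF e e0; exists C0 => w.
  have Hw u : normc u = normc w -> normc (F (row1 u)) <= C0 * expR ((1 + e) * normc w).
    move=> uw; rewrite (le_trans (H _))// mul1r.
    by rewrite /cnorm2 big_ord1 sqrtr_sqr ger0_norm ?normc_ge0// !mxE eqxx mulr1 uw.
  rewrite /P /G -row1N normcM.
  have -> : normc (2^-1 : C) = 2^-1.
    by rewrite normcV -[2 : C](rmorph_nat (real_complex R) 2) normc_real normr_nat.
  rewrite mulrC ler_pdivrMr// (le_trans (ler_normcD _ _))//.
  by rewrite mulr_natr mulr2n lerD// Hw// normcN.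
- move=> s; have [A [K [A0 K0 _ H]]] := GD.
  exists (A * expR (K * norm1 (row1 s))); split; first by rewrite mulr_ge0 ?expR_ge0.
  move=> h h1; have := H (row1 s) (row1 h); rewrite norm1_row1 => /(_ h1).
  by rewrite big_ord1 -row1D [row1 h 0 0]mxE mxE eqxx mulr1 [h * _]mulrC norm1_row1.
have [A [K [A0 K0 _ H]]] := DE.
exists (2 * A); split; first by rewrite mulr_ge0.
move=> s s1.
(* The derivative of [P w - c / 2 * w ^+ 2] is [P' w - c * w], of second order because [P' 0 = 0];
   the mean value estimate raises the order to 3. *)
have fd w : cdiff (fun w => P w - 2^-1 * c * w ^+ 2) w (P' w - c * w).
  have idd : cdiff (fun w : C => w) w 1.
    by move=> e e0; exists 1 => // h _; rewrite mul1r addrAC addrK subrr normc0 mulr_ge0 ?normc_ge0 ?ltW.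
  have d2 := cdiffM idd idd.
  have d3 := cdiffM (cdiff_cst (- (2^-1 * c)) w) d2.
  move=> e e0; have e2 : 0 < e / 2 by rewrite divr_gt0.
  have [r1 r10 B1] := dP w _ e2; have [r2 r20 B2] := d3 _ e2.
  exists (Num.min r1 r2); first by rewrite lt_min r10.
  move=> h; rewrite lt_min => /andP[/B1 {}B1 /B2 {}B2].
  have -> : e * normc h = e / 2 * normc h + e / 2 * normc h by field.
  apply: le_trans (lerD B1 B2); apply: le_trans (ler_normcD _ _).
  by rewrite le_eqVlt; apply/orP; left; apply/eqP; congr normc; field.
have := complex_MVT fd (a := s) (b := 0) (K := A * normc s ^+ 2).
rewrite subr0 expr0n mulr0 subr0 => B.
have -> : P s - P 0 - 2^-1 * c * s ^+ 2 = P s - 2^-1 * c * s ^+ 2 - P 0 by ring.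
have -> : 2 * A * normc s ^+ 3 = 2 * (A * normc s ^+ 2) * normc s by ring.
apply: B => t /andP[t0 t1]; rewrite add0r.
have ts : normc (t%:C * s) <= normc s.
  by rewrite normcM normc_real ger0_norm// ler_piMl ?normc_ge0.
have := H 0 (row1 (t%:C * s)); rewrite norm1_row1 => /(_ (le_trans ts s1)).
rewrite add0r norm1_0 mulr0 expR0 mulr1 big_ord1 [row1 _ 0 0]mxE mxE eqxx mulr1.
have -> : D 0 0 = 0 by have := P'0; rewrite /P' /row1 scale0r.
rewrite subr0 [_ * E 0 0]mulrC => /le_trans; apply.
by rewrite ler_wpM2l// lerXn2r ?nnegrE ?normc_ge0.
Qed.

Variables (P P' : C -> C) (c : C).
Hypothesis PP : type1_even P P' c.

Lemma type1_even_root s w : s ^+ 2 = w ^+ 2 -> P s = P w.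
Proof.
have [ev _ _ _] := PP.
by move=> /eqP; rewrite eqf_sqr => /orP[/eqP ->//|/eqP ->].
Qed.

(* Evenness makes the choice of the root irrelevant. Away from [0] take the root [s] with
   [|s - s0| <= |s + s0|]; at [0] the expansion of [P] has no linear term. *)
Lemma cdiff_root q : exists b, cdiff (fun w => P (sqrtc w)) q b.
Proof.
have [ev _ exs ex0] := PP.
have [->|q0] := eqVneq q 0.
  have [M [M0 H]] := ex0; exists c => e e0.
  have M1 : 0 < M + 1 by rewrite ltr_wpDl.
  (* The radius is squared because the modulus of [sqrtc h] is the square root of that of [h]; the
     cubic remainder is then small relative to [h]. *)
  exists (Num.min 1 ((e / (M + 1)) ^+ 2)); first by rewrite lt_min ltr01 exprn_gt0// divr_gt0.
  move=> h; rewrite lt_min add0r sqrtc0 => /andP[h1 h2].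
  have s2 : normc (sqrtc h) ^+ 2 = normc h by rewrite -normcX sqr_sqrtc.
  have s1 : normc (sqrtc h) <= 1.
    by rewrite -(@ler_pXn2r _ 2) ?nnegrE ?normc_ge0// s2 expr1n ltW.
  have se : normc (sqrtc h) <= e / (M + 1).
    have e1 : 0 <= e / (M + 1) by rewrite divr_ge0 ?ltW.
    by rewrite -(@ler_pXn2r _ 2) ?nnegrE ?normc_ge0// s2 ltW.
  have := H _ s1; rewrite sqr_sqrtc => /le_trans; apply.
  rewrite exprS s2 mulrA ler_wpM2r ?normc_ge0//.
  apply: (@le_trans _ _ ((M + 1) * (e / (M + 1)))); last by rewrite mulrC divfK ?gt_eqF.
  by rewrite ler_pM ?normc_ge0// lerDl.
pose s0 := sqrtc q.
have s0q : s0 ^+ 2 = q by exact: sqr_sqrtc.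
have s00 : s0 != 0 by apply: contra_neq q0; rewrite -s0q => ->; rewrite expr0n.
have n0 : 0 < normc s0.
  by rewrite lt_neqAle normc_ge0 andbT eq_sym; apply: contra_neq s00; exact: eq0_normc.
have [M [M0 H]] := exs s0.
(* The chain rule through a square root, whose derivative at [q] is [1 / (2 * s0)]. *)
pose b := P' s0 / (2 * s0).
pose K := (M + normc b) / normc s0 ^+ 2.
have K0 : 0 <= K by rewrite divr_ge0 ?addr_ge0 ?normc_ge0 ?sqr_ge0.
have K1 : 0 < K + 1 by rewrite ltr_wpDl.
exists b => e e0; exists (Num.min (normc s0) (e / (K + 1))).
  by rewrite lt_min n0 divr_gt0.
move=> h; rewrite lt_min => /andP[h1 h2].
have [s [sP sq sd]] : exists s, [/\ P (sqrtc (q + h)) = P s, s ^+ 2 = q + h &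
    normc (s - s0) <= normc (s + s0)].
  have [H1|H1] := leP (normc (sqrtc (q + h) - s0)) (normc (sqrtc (q + h) + s0)).
    by exists (sqrtc (q + h)); split => //; exact: sqr_sqrtc.
  exists (- sqrtc (q + h)); rewrite ev sqrrN sqr_sqrtc; split => //.
  have -> : - sqrtc (q + h) + s0 = - (sqrtc (q + h) - s0) by ring.
  by rewrite -opprD !normcN ltW.
have hE : h = (s - s0) * (s + s0) by rewrite -subr_sqr sq s0q; ring.
have sn : normc s0 <= normc (s + s0).
  have : normc (2 * s0) <= normc (s + s0) + normc (s - s0).
    have -> : 2 * s0 = (s + s0) - (s - s0) by ring.
    by apply: (le_trans (ler_normcD _ _)); rewrite normcN.
  have -> : normc (2 * s0) = 2 * normc s0.
    by rewrite normcM -[2 : C](rmorph_nat (real_complex R) 2) normc_real normr_nat.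
  by move: sd; lra.
pose d := s - s0.
have dh : normc d * normc s0 <= normc h by rewrite hE normcM ler_wpM2l ?normc_ge0.
have d1 : normc d <= 1.
  by rewrite -(ler_pM2r n0) mul1r (le_trans dh)// ltW.
have sE : s = s0 + d by rewrite /d addrC subrK.
have -> : P (sqrtc (q + h)) - P (sqrtc q) - b * h =
    (P (s0 + d) - P s0 - P' s0 * d) - b * d ^+ 2.
  rewrite sP sE -/s0 hE.
  have -> : s - s0 = d by [].
  by rewrite sE /b; field.
apply: (@le_trans _ _ (K * normc h ^+ 2)).
  apply: (@le_trans _ _ ((M + normc b) * normc d ^+ 2)).
    rewrite (le_trans (ler_normcD _ _))// mulrDl normcN normcM normcX lerD//.
    exact: H.
  rewrite /K mulrAC ler_pdivlMr ?exprn_gt0// -mulrA -exprMn.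
  by rewrite ler_wpM2l ?addr_ge0 ?normc_ge0// lerXn2r ?nnegrE ?mulr_ge0 ?normc_ge0.
rewrite expr2 mulrA ler_wpM2r ?normc_ge0//.
apply: (@le_trans _ _ ((K + 1) * normc h)); first by rewrite ler_wpM2r ?normc_ge0// lerDl.
by rewrite mulrC -ler_pdivlMr// ltW.
Qed.

Variable m : nat.
Local Notation V := 'rV[C]_m.

(** The holomorphic extension of the squared Euclidean norm: the squares are taken without
    moduli. *)
Definition qform (z : V) : C := \sum_j z 0 j ^+ 2.

Lemma normc_sum (I : Type) (r : seq I) (f : I -> C) :
  normc (\sum_(i <- r) f i) <= \sum_(i <- r) normc (f i).
Proof.
elim/big_rec2 : _ => [|i a b _ H]; first by rewrite normc0.
by rewrite (le_trans (ler_normcD _ _))// lerD2l.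
Qed.

Lemma qform_bound (z : V) : normc (qform z) <= cnorm2 z ^+ 2.
Proof.
rewrite sqr_cnorm2 (le_trans (normc_sum _ _))//.
by apply: ler_sum => j _; rewrite normcX.
Qed.

Lemma lift_entire : entire (fun z : V => P (sqrtc (qform z))).
Proof.
apply: entire_criterion => z; have [b cb] := cdiff_root (qform z).
exists (fun j => b * (2 * z 0 j)) => e e0.
pose B := 2 * norm1 z + 1.
have B0 : 0 < B by rewrite ltr_wpDl// mulr_ge0// norm1_ge0.
have eB : 0 < e / 2 / B by rewrite !divr_gt0.
have [r r0 Hr] := cb _ eB.
have b0 : 0 < normc b + 1 by rewrite ltr_wpDl ?normc_ge0.
exists (Num.min (Num.min 1 (r / B)) (e / 2 / (normc b + 1))).
  by rewrite !lt_min ltr01 !divr_gt0.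
move=> h; rewrite !lt_min => /andP[/andP[h1 hr] hb].
pose d := qform (z + h) - qform z.
have dE : d = 2 * (\sum_j z 0 j * h 0 j) + qform h.
  rewrite /d /qform mulr_sumr -sumrB -big_split; apply: eq_bigr => j _ /=.
  by rewrite mxE; ring.
have qh : normc (qform h) <= norm1 h ^+ 2.
  rewrite (le_trans (qform_bound _))// lerXn2r ?nnegrE ?cnorm2_ge0 ?norm1_ge0//.
  exact: cnorm2_le_norm1.
have n2 (w : C) : normc (2 * w) = 2 * normc w.
  by rewrite normcM -[2 : C](rmorph_nat (real_complex R) 2) normc_real normr_nat.
have dB : normc d <= B * norm1 h.
  rewrite dE /B [leRHS]mulrDl mul1r (le_trans (ler_normcD _ _))// lerD//.
    rewrite n2 -mulrA ler_wpM2l// (le_trans (normc_sum _ _))// mulr_sumr.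
    apply: ler_sum => j _; rewrite normcM ler_wpM2r ?normc_ge0//.
    exact: normc_le_norm1.
  by rewrite (le_trans qh)// expr2 ler_piMl ?norm1_ge0// ltW.
have dr : normc d < r.
  by rewrite (le_lt_trans dB)// mulrC -ltr_pdivlMr.
have -> : P (sqrtc (qform (z + h))) - P (sqrtc (qform z)) -
    \sum_j h 0 j * (b * (2 * z 0 j)) =
  (P (sqrtc (qform z + d)) - P (sqrtc (qform z)) - b * d) + b * qform h.
  have -> : \sum_j h 0 j * (b * (2 * z 0 j)) = b * (2 * \sum_j z 0 j * h 0 j).
    by rewrite !mulr_sumr; apply: eq_bigr => j _; ring.
  have -> : qform z + d = qform (z + h) by rewrite /d addrC subrK.
  by rewrite dE; ring.
rewrite (le_trans (ler_normcD _ _))//.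
have -> : e * norm1 h = e / 2 * norm1 h + e / 2 * norm1 h by field.
rewrite lerD//.
  rewrite (le_trans (Hr _ dr))//.
  have -> : e / 2 * norm1 h = e / 2 / B * (B * norm1 h) by field; rewrite gt_eqF.
  by rewrite ler_wpM2l// ltW.
rewrite normcM (@le_trans _ _ ((normc b + 1) * norm1 h ^+ 2))//.
  by rewrite ler_pM ?normc_ge0// lerDl.
rewrite expr2 mulrA ler_wpM2r ?norm1_ge0//.
by rewrite mulrC -ler_pdivlMr// ltW.
Qed.

Lemma lift_type : spherical_type 1 (fun z : V => P (sqrtc (qform z))).
Proof.
move=> e e0; have [_ ty _ _] := PP; have [C0 H] := ty e e0.
have C00 : 0 <= C0.
  have := H 0; rewrite -(pmulr_lge0 _ (expR_gt0 ((1 + e) * normc 0))).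
  by apply: le_trans; exact: normc_ge0.
exists C0 => z; rewrite (le_trans (H _))// ler_wpM2l// ler_expR mul1r.
rewrite ler_wpM2l//; first by rewrite addr_ge0// ltW.
rewrite -(@ler_pXn2r _ 2) ?nnegrE ?cnorm2_ge0 ?normc_ge0//.
by rewrite -normcX sqr_sqrtc qform_bound.
Qed.

End even_function.

Section radial_lift.
Context {R : realType} (m : nat).

Definition enorm (x : 'rV[R]_m) : R := Num.sqrt (\sum_j x 0 j ^+ 2).

(** On real vectors [qform] is the square of [enorm], and [type1_even_root] disposes of the sign of
    the root picked by [sqrtc]. *)
Lemma exp_type_radial (g : R -> R[i]) : exp_type1_even 1 g ->
  exp_type 1 m (fun x => g (enorm x)).
Proof.
move=> /exp_type1_even_ext[P [P' [c [PP gP]]]].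
exists (fun z => P (sqrtc (qform z))); split.
- exact: lift_entire PP _.
- exact: lift_type PP _.
move=> x; rewrite gP; apply: (type1_even_root PP).
rewrite sqr_sqrtc -rmorphXn /= sqr_sqrtr ?sumr_ge0// => [|j _]; last exact: sqr_ge0.
by rewrite /qform rmorph_sum; apply: eq_bigr => j _; rewrite mxE rmorphXn.
Qed.

End radial_lift.

(** * Comparison of the norms and of the sharp constants *)

Section norm_identities.
Context {R : realType} (n : nat).
Local Notation T := (measurableTypeR R).
Local Notation C := R[i].
Local Notation leb := (@lebesgue_measure R).
Local Notation mu := (@lebesgue_tuple R n.+1).
Local Notation V := 'rV[R]_n.+1.
Implicit Types (y t : n.+1.-tuple T) (r s : R) (f : V -> C) (g : R -> C)
  (h : n.+1.-tuple T -> R) (F : R -> R).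

Lemma half_line_measurable F : measurable_fun setT F ->
  measurable_fun setT (fun s : T => (pos s * F s)%:E).
Proof.
by move=> mF; apply/measurable_EFinP; apply: measurable_funM => //; exact: measurable_pos.
Qed.

Lemma half_int_even F : measurable_fun setT F -> (forall s, 0 <= F s) ->
  (forall s, F (- s) = F s) ->
  (\int[leb]_s (F s)%:E = 2%:E * half_int F)%E.
Proof.
move=> mF F0 Fe.
have mp := half_line_measurable mF.
have p0 s : (0 <= (pos s * F s)%:E)%E by rewrite lee_fin mulr_ge0 ?pos_ge0.
have N0 : (-1 : R) != 0 by rewrite oppr_eq0 oner_neq0.
have := integral_affine 0 N0 mp p0.
rewrite normrN normr1 invr1 mul1e => E.
have mN : measurable_fun setT (fun s : T => - s : T) by exact: measurable_funN.
have mp' : measurable_fun setT (fun s : T => (pos (-1 * s + 0) * F (-1 * s + 0))%:E).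
  under [X in measurable_fun _ X]funext do rewrite mulN1r addr0.
  exact: (measurableT_comp (f := fun s : T => (pos s * F s)%:E) mp mN).
have -> : (2%:E * half_int F = half_int F + half_int F)%E.
  by rewrite -[2%R]/(1 + 1)%R EFinD ge0_muleDl ?mul1e.
rewrite {2}/half_int -E /half_int -ge0_integralD//.
apply: ge0_ae_eq_integral => //.
- exact/measurable_EFinP.
- exact: emeasurable_funD.
- by move=> s _; rewrite lee_fin.
- by move=> s _; rewrite adde_ge0.
exists [set 0%R]; split; [exact: measurable_set1|exact: lebesgue_measure_set1|].
move=> s /= H; apply: contrapT => /eqP s0; apply: H => _.
rewrite mulN1r addr0 Fe -EFinD; congr EFin.
have [sp|sn|s00] := ltrgtP s 0; last by rewrite s00 eqxx in s0.
  by rewrite (posF (ltW sp)) posT ?oppr_gt0// mul0r add0r mul1r.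
by rewrite (posT sn) (posF (_ : - s <= 0)) ?oppr_le0 ?ltW// mul0r addr0 mul1r.
Qed.

Lemma measurable_sphere_int h : measurable_fun setT h -> (forall t, 0 <= h t) ->
  measurable_fun setT (sphere_int h : T -> \bar R).
Proof.
move=> mh h0.
pose q (z : T * n.+1.-tuple T) : \bar R := (gw z.2 * h (tscale z.1 (tunit z.2)))%:E.
have mq : measurable_fun setT q.
  apply/measurable_EFinP; apply: measurable_funM.
    exact: (measurableT_comp (@measurable_gw R n.+1) measurable_snd).
  apply: (@sphere_meas _ _ _ _ (fun z : T * n.+1.-tuple T => z.1) (fun z => tunit z.2) h) => //.
    exact: (measurable_fst (T1 := T) (T2 := n.+1.-tuple T)).
  exact: (measurableT_comp (@measurable_tunit R n.+1) measurable_snd).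
have q0 z : (0 <= q z)%E by rewrite lee_fin mulr_ge0 ?gw_ge0.
exact: (@measurable_fun_fubini_tonelli_F _ _ _ _ _ mu q mq q0).
Qed.

Lemma on_tuple_urow f s y : on_tuple f (tscale s (tunit y)) = f (s *: urow y).
Proof.
rewrite /on_tuple; congr f; apply/rowP => j.
by rewrite !mxE !tnth_mktuple.
Qed.

Lemma cmeasurable_normc d (X : measurableType d) (u : X -> C) : cmeasurable u ->
  measurable_fun setT (fun x => normc (u x)).
Proof.
move=> [m1 m2]; have -> : (fun x => normc (u x)) = (fun x =>
    Num.sqrt (complex.Re (u x) ^+ 2 + complex.Im (u x) ^+ 2)).
  by apply/funext => x; case: (u x).
by apply: measurable_sqrt; apply: measurable_funD; exact: measurable_funX.
Qed.

Lemma csmooth_cmeasurable f : csmooth f -> cmeasurable (on_tuple f).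
Proof.
move=> /csmooth_grad[g [_ gR gI]]; split.
  apply: (@measurable_rcont _ _ _ _ (Ref f) (fun j t => tnth t j)).
    exact: rexpansion_rcont gR.
  by move=> j; exact: measurable_tnth.
apply: (@measurable_rcont _ _ _ _ (Imf f) (fun j t => tnth t j)).
  exact: rexpansion_rcont gI.
by move=> j; exact: measurable_tnth.
Qed.

Lemma sym_continuous (u : V -> R) ug : rexpansion u ug ->
  (forall j, exists q, rexpansion (ug j) q) -> continuous (sym u).
Proof.
move=> uu hh s.
have d : derivable (sint (fun=> 1) u) s 1.
  by have [] := sint_derive (@coef1 R n) uu hh s.
by apply: cvgMr; exact/differentiable_continuous/derivable1_diffP.
Qed.

Lemma csym_ccontinuous f : csmooth f -> ccontinuous (csym f).
Proof.
move=> /csmooth_grad[g [sg gR gI]]; split; [apply: (sym_continuous gR)|apply: (sym_continuous gI)] => j.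
  by have [q [_ H _]] := csmooth_grad (sg j); eexists; exact: H.
by have [q [_ _ H]] := csmooth_grad (sg j); eexists; exact: H.
Qed.

Lemma ccontinuous_cmeasurable g : ccontinuous g -> cmeasurable (g : T -> C).
Proof. by move=> [c1 c2]; split; exact: continuous_measurable_fun. Qed.

(* Young's inequality gives the supporting line of [x `^ p] at [a]. *)
Lemma powR_tangent (p x a : R) : 1 <= p -> 0 <= x -> 0 <= a ->
  p * (a `^ (p - 1)) * x <= x `^ p + (p - 1) * a `^ p.
Proof.
rewrite le_eqVlt => /predU1P[<- x0 a0|p1 x0 a0].
  rewrite subrr powRr0 mul0r addr0 !mul1r powRr1//.
have p0 : 0 < p by apply: lt_trans p1.
pose q := p / (p - 1).
have pm : 0 < p - 1 by rewrite subr_gt0.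
have q0 : 0 < q by rewrite divr_gt0.
have := conjugate_powR x0 (powR_ge0 a (p - 1)) p0 q0.
have -> : p^-1 + q^-1 = 1 by rewrite /q; field; rewrite !gt_eqF.
move=> /(_ erefl).
rewrite -powRrM /q (_ : (p - 1) * (p / (p - 1)) = p); last by field; rewrite gt_eqF.
rewrite -(ler_pM2l p0) => H.
rewrite -[leLHS]mulrA [_ * x]mulrC (le_trans H)// le_eqVlt; apply/orP; left; apply/eqP.
by field; rewrite !gt_eqF.
Qed.

Lemma csym_cint f r : csym f r = ((Num.sqrt pi ^+ n.+1)^-1)%:C *
  cint mu setT (fun y => (gw y)%:C * f (r *: urow y)).
Proof.
rewrite /csym /sym /cint /sint.
have -> : \int[mu]_y complex.Re ((gw y)%:C * f (r *: urow y)) =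
    \int[mu]_y (gw y * (1 * Ref f (r *: urow y))).
  by apply: eq_Rintegral => y _; rewrite ReM /= mul0r subr0 mul1r.
have -> : \int[mu]_y complex.Im ((gw y)%:C * f (r *: urow y)) =
    \int[mu]_y (gw y * (1 * Imf f (r *: urow y))).
  by apply: eq_Rintegral => y _; rewrite ImM /= mul0r addr0 mul1r.
by apply: complex_ext; rewrite ?ReM ?ImM /=; ring.
Qed.

Lemma csmooth_integrable f r : csmooth f ->
  cintegrable mu setT (fun y => (gw y)%:C * f (r *: urow y)).
Proof.
move=> /csmooth_grad[g [_ gR gI]]; split.
  under [X in EFin \o X]funext do rewrite ReM /= mul0r subr0 -[complex.Re _]mul1r.
  exact: (sint_integrable r (@coef1 R n) gR).
under [X in EFin \o X]funext do rewrite ImM /= mul0r addr0 -[complex.Im _]mul1r.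
exact: (sint_integrable r (@coef1 R n) gI).
Qed.

Lemma csmooth_bound f r : csmooth f -> exists M : R, forall y,
  normc (f (r *: urow y)) <= M.
Proof.
move=> /csmooth_grad[g [_ gR gI]].
have [M1 [_ H1]] := rexpansion_bound gR (`|r| * n.+1%:R).
have [M2 [_ H2]] := rexpansion_bound gI (`|r| * n.+1%:R).
exists (M1 + M2) => y; rewrite (le_trans (normc_le_ReIm _))//.
by rewrite lerD//; [apply: H1|apply: H2]; exact: rnorm1_urow.
Qed.

Lemma csmooth_measurable_urow f r : csmooth f ->
  measurable_fun setT (fun y => normc (f (r *: urow y))).
Proof.
move=> sf; have := cmeasurable_normc (csmooth_cmeasurable sf) => m.
under [X in measurable_fun _ X]funext do rewrite -on_tuple_urow.
apply: (@sphere_meas _ _ _ _ (fun=> r) (@tunit R n.+1) (fun t => normc (on_tuple f t))) => //.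
exact: measurable_tunit.
Qed.

(** The tangent line of the power function at the Gaussian mean [I] of the modulus of [f] is
    integrated against [gw]; the modulus of the spherical mean is at most [I]. *)
Lemma csym_jensen f (p : R) r : 1 <= p -> csmooth f ->
  ((Num.sqrt pi ^+ n.+1 * normc (csym f r) `^ p)%:E <=
   sphere_int (fun t => (normc (on_tuple f t) `^ p)%R) r)%E.
Proof.
move=> p1 sf; pose P : R := Num.sqrt pi ^+ n.+1.
have P0 : 0 < P by exact: gw_int_gt0.
have p0 : 0 <= p by apply: le_trans p1.
have [M HM] := csmooth_bound r sf.
have M0 : 0 <= M by rewrite (le_trans _ (HM (tzero n.+1)))// normc_ge0.
pose u y := normc (f (r *: urow y)).
have u0 y : 0 <= u y by exact: normc_ge0.
have mu_ : measurable_fun setT u by exact: csmooth_measurable_urow.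
have iu : mu.-integrable setT (EFin \o (fun y => gw y * u y)).
  apply: (gw_integrable (C := M) (a := 0)) => // y.
  by rewrite mul0r expR0 mulr1 ger0_norm// HM.
have ip : mu.-integrable setT (EFin \o (fun y => gw y * u y `^ p)).
  apply: (gw_integrable (C := M `^ p) (a := 0)).
    exact: measurable_powR_comp.
  move=> y; rewrite mul0r expR0 mulr1 ger0_norm ?powR_ge0//.
  by apply: ge0_ler_powR; rewrite ?nnegrE// HM.
pose I := P^-1 * \int[mu]_y (gw y * u y).
have I0 : 0 <= I.
  rewrite mulr_ge0 ?invr_ge0 ?(ltW P0)//; apply: Rintegral_ge0 => y _.
  by rewrite mulr_ge0 ?gw_ge0.
have cI : normc (csym f r) <= I.
  rewrite csym_cint normcM normc_real ger0_norm ?invr_ge0 ?(ltW P0)//.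
  rewrite ler_wpM2l ?invr_ge0 ?(ltW P0)//.
  apply: normc_cint => //; first exact: csmooth_integrable.
  by move=> y _; rewrite normcM normc_real ger0_norm ?gw_ge0.
have -> : sphere_int (fun t => (normc (on_tuple f t) `^ p)%R) r =
    (\int[mu]_y (gw y * u y `^ p))%:E.
  have := integrable_fin_num measurableT ip => ipf.
  rewrite /Rintegral (fineK ipf).
  by apply: eq_integral => y _; rewrite on_tuple_urow.
rewrite lee_fin.
apply: (@le_trans _ _ (P * I `^ p)).
  by rewrite ler_wpM2l ?(ltW P0)//; apply: ge0_ler_powR; rewrite ?nnegrE ?normc_ge0.
have ig := @gw_Rintegrable R n.
have H : \int[mu]_y (p * I `^ (p - 1) * (gw y * u y)) <=
    \int[mu]_y (gw y * u y `^ p + (p - 1) * I `^ p * gw y).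
  apply: le_Rintegral => //.
  - exact: integrableZr.
  - by apply: integrableDr => //; exact: integrableZr.
  move=> y _; have := powR_tangent p1 (u0 y) I0.
  move=> /(ler_wpM2l (gw_ge0 y)) Q.
  have -> : p * I `^ (p - 1) * (gw y * u y) = gw y * (p * I `^ (p - 1) * u y) by ring.
  by rewrite (le_trans Q)// le_eqVlt; apply/orP; left; apply/eqP; ring.
move: H; rewrite RintegralZl// RintegralD//; last exact: integrableZr.
rewrite RintegralZl// Rintegral_gw -/P.
have -> : \int[mu]_y (gw y * u y) = P * I by rewrite /I mulVKf ?gt_eqF.
have -> : p * I `^ (p - 1) * (P * I) = p * (P * I `^ p).
  (* The exponent [p] is split as [(p - 1) + 1] by [powRD] for a nonzero base; the base 0 is treated
     directly. *)
  have [->|I1] := eqVneq I 0.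
    by rewrite mulr0 mulr0 powR0 ?mulr0// gt_eqF// (lt_le_trans _ p1).
  have -> : I `^ p = I `^ (p - 1) * I.
    rewrite -{3}(powRr1 I0) -powRD ?subrK//.
    by apply/implyP; rewrite I1.
  by ring.
by lra.
Qed.

Definition Iint (p : R) f : \bar R := (\int[mu]_t (normc (on_tuple f t) `^ p)%:E)%E.
Definition Jint (p : R) g : \bar R :=
  (\int[leb]_s (normc (g s) `^ p * `|s| ^+ n)%:E)%E.

Lemma Iint_ge0 p f : (0 <= Iint p f)%E.
Proof. by apply: integral_ge0 => t _; rewrite lee_fin powR_ge0. Qed.

Lemma Jint_ge0 p g : (0 <= Jint p g)%E.
Proof. by apply: integral_ge0 => t _; rewrite lee_fin mulr_ge0 ?powR_ge0 ?exprn_ge0. Qed.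

Lemma Lp_norm_fin p f : Lp_norm p%:E f = (Iint p f `^ p^-1)%E.
Proof.
rewrite /Lp_norm Lnorm.unlock /Iint; congr poweR; apply: eq_integral => t _.
by rewrite /= ger0_norm ?normc_ge0.
Qed.

Lemma polar_Iint p f : cmeasurable (on_tuple f) ->
  (\int[leb]_r ((pos r * r ^+ n)%:E * sphere_int (fun t => (normc (on_tuple f t) `^ p)%R) r) =
  @kappa R n * Iint p f)%E.
Proof.
move=> mf; apply: polar => [|t]; last exact: powR_ge0.
exact/measurable_powR_comp/cmeasurable_normc.
Qed.

Lemma Jint_half p g : cmeasurable (g : T -> C) -> (forall s, g (- s) = g s) ->
  Jint p g = (2%:E * half_int (fun s => normc (g s) `^ p * s ^+ n)%R)%E.
Proof.
move=> mg ge; rewrite /Jint half_int_even.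
- congr (_ * _)%E; apply: eq_integral => s _; case: (ltP 0 s) => [s0|/posF ->].
    by rewrite ger0_norm// ltW.
  by rewrite !mul0r.
- apply: measurable_funM; first exact/measurable_powR_comp/cmeasurable_normc.
  by apply: measurable_funX; exact: measurable_norm_comp.
- by move=> s; rewrite mulr_ge0 ?powR_ge0 ?exprn_ge0.
- by move=> s; rewrite ge normrN.
Qed.

(** Equal to [2 / |S^n|] by [two_sphere_area]. The 2 counts the two half lines, the power of pi
    normalizes the Gaussian mean, and [kappa] comes from the polar formula. *)
Definition sphere_cst : R := 2 * (Num.sqrt pi ^+ n.+1)^-1 * fine (@kappa R n).

Lemma Jint_csym p f : 1 <= p -> exp_type 1 n.+1 f ->
  (Jint p (csym f) <= sphere_cst%:E * Iint p f)%E.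
Proof.
move=> p1 ef; have sf := exp_type_csmooth ef.
have [_ ev] := csym_exp_type ef.
have mf := csmooth_cmeasurable sf.
have mc := ccontinuous_cmeasurable (csym_ccontinuous sf).
have P0 := @gw_int_gt0 R n.
rewrite Jint_half// /sphere_cst.
pose h t := normc (on_tuple f t) `^ p.
have mh : measurable_fun setT h by exact/measurable_powR_comp/cmeasurable_normc.
have h0 t : 0 <= h t by exact: powR_ge0.
rewrite -mulrA EFinM -muleA lee_pmul2l//.
rewrite EFinM fineK ?kappa_fin// -muleA -polar_Iint//.
have w0 (r : R) : 0 <= pos r * r ^+ n by apply: posM_ge0 => r0; rewrite exprn_ge0// ltW.
have mw : measurable_fun setT (fun r : T => (pos r * r ^+ n)%:E * sphere_int h r)%E.
  apply: emeasurable_funM; last exact: measurable_sphere_int.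
  apply/measurable_EFinP; apply: measurable_funM; first exact: measurable_pos.
  exact: exprn_measurable.
have wh0 (r : R) : setT r -> (0 <= (pos r * r ^+ n)%:E * sphere_int h r)%E.
  by move=> _; rewrite mule_ge0 ?lee_fin ?sphere_int_ge0.
have Pi0 : (0 <= ((Num.sqrt pi ^+ n.+1)^-1)%:E :> \bar R)%E.
  by rewrite lee_fin invr_ge0 ltW.
rewrite -(ge0_integralZl leb measurableT mw wh0 Pi0).
apply: ge0_le_integral => //.
- move=> r _; rewrite lee_fin; apply: posM_ge0 => r0.
  by rewrite mulr_ge0 ?powR_ge0// exprn_ge0// ltW.
- apply: half_line_measurable; apply: measurable_funM.
    exact/measurable_powR_comp/cmeasurable_normc.
  exact: exprn_measurable.
- exact: measurable_funeM.
move=> r _.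
have J := csym_jensen r p1 sf.
apply: (@le_trans _ _ (((Num.sqrt pi ^+ n.+1)^-1)%:E * ((pos r * r ^+ n)%:E *
   (Num.sqrt pi ^+ n.+1 * normc (csym f r) `^ p)%:E))%E).
  rewrite -!EFinM lee_fin le_eqVlt; apply/orP; left; apply/eqP.
  by field; rewrite gt_eqF.
rewrite lee_pmul2l ?lte_fin ?invr_gt0//.
by apply: lee_wpmul2l; rewrite ?lee_fin.
Qed.

Definition radial g : V -> C := fun x => g (enorm x).

Lemma enorm_urow r y : y != tzero n.+1 -> enorm (r *: urow y) = `|r|.
Proof.
move=> y0; rewrite /enorm.
have -> : \sum_j (r *: urow y) 0 j ^+ 2 = r ^+ 2 * \sum_j urow y 0 j ^+ 2.
  by rewrite mulr_sumr; apply: eq_bigr => j _; rewrite mxE exprMn.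
by rewrite urow_sqr// mulr1 sqrtr_sqr.
Qed.

Lemma Jint_radial p g : exp_type1_even 1 g -> cmeasurable (g : T -> C) ->
  Jint p g = (sphere_cst%:E * Iint p (radial g))%E.
Proof.
move=> eg mg; have [_ ev] := eg.
have sf : csmooth (radial g) by exact/exp_type_csmooth/exp_type_radial.
have mf := csmooth_cmeasurable sf.
have P0 := @gw_int_gt0 R n.
rewrite Jint_half// /sphere_cst -mulrA EFinM -muleA; congr (_ * _)%E.
rewrite EFinM fineK ?kappa_fin// -muleA -polar_Iint//.
pose h t := normc (on_tuple (radial g) t) `^ p.
have mh : measurable_fun setT h by exact/measurable_powR_comp/cmeasurable_normc.
have h0 t : 0 <= h t by exact: powR_ge0.
have w0 (r : R) : 0 <= pos r * r ^+ n by apply: posM_ge0 => r0; rewrite exprn_ge0// ltW.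
have mw : measurable_fun setT (fun r : T => (pos r * r ^+ n)%:E * sphere_int h r)%E.
  apply: emeasurable_funM; last exact: measurable_sphere_int.
  apply/measurable_EFinP; apply: measurable_funM; first exact: measurable_pos.
  exact: exprn_measurable.
have wh0 (r : R) : setT r -> (0 <= (pos r * r ^+ n)%:E * sphere_int h r)%E.
  by move=> _; rewrite mule_ge0 ?lee_fin ?sphere_int_ge0.
have Pi0 : (0 <= ((Num.sqrt pi ^+ n.+1)^-1)%:E :> \bar R)%E.
  by rewrite lee_fin invr_ge0 ltW.
rewrite -(ge0_integralZl leb measurableT mw wh0 Pi0).
apply: eq_integral => r _.
case: (ltP 0 r) => [r0|/posF ->]; last by rewrite !mul0r mul0e mule0.
have -> : sphere_int (fun t => normc (on_tuple (radial g) t) `^ p) r =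
    ((normc (g r) `^ p)%:E * \int[mu]_y (gw y)%:E)%E.
  have mg' : measurable_fun setT (fun y : n.+1.-tuple T => (gw y)%:E : \bar R).
    by apply/measurable_EFinP; exact: measurable_gw.
  have g0 y : setT y -> (0 <= (gw y)%:E :> \bar R)%E by rewrite lee_fin gw_ge0.
  have q0 : (0 <= (normc (g r) `^ p)%:E)%E by rewrite lee_fin powR_ge0.
  rewrite -(ge0_integralZl mu measurableT mg' g0 q0).
  apply: ge0_ae_eq_integral => //.
  - apply/measurable_EFinP; apply: measurable_funM; first exact: measurable_gw.
    apply: (@sphere_meas _ _ _ _ (fun=> r) (@tunit R n.+1) h) => //.
    exact: measurable_tunit.
  - exact: measurable_funeM.
  - by move=> y _; rewrite lee_fin mulr_ge0 ?gw_ge0 ?powR_ge0.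
  - by move=> y _; rewrite -EFinM lee_fin mulr_ge0 ?gw_ge0 ?powR_ge0.
  apply: not_tzero_ae => y y0 _.
  by rewrite on_tuple_urow /radial enorm_urow// gtr0_norm// -EFinM mulrC.
rewrite integral_gw -!EFinM posT//; congr EFin.
by field; rewrite gt_eqF.
Qed.

End norm_identities.

(** * Essential suprema of continuous functions, and the norm comparison for all exponents *)

Section supremum_norm.
Context {R : realType}.
Local Notation C := R[i].

Lemma normcB_le (a b : C) : normc a - normc (a - b) <= normc b.
Proof.
rewrite lerBlDr addrC.
have -> : normc a = normc ((a - b) + b) by rewrite subrK.
exact: ler_normcD.
Qed.

(* Positive measure of every superlevel neighbourhood turns the essential supremum into
   a supremum. *)
Lemma Linf_leP d (X : measurableType d) (nu : {measure set X -> \bar R}) (u : X -> C)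
    (y : \bar R) : (0 < nu setT)%E ->
  (forall x (e : R), 0 < e -> exists A, [/\ measurable A, (0 < nu A)%E &
    forall z, A z -> normc (u x) - e <= normc (u z)]) ->
  (Lnorm nu +oo (fun x => (normc (u x))%:E) <= y)%E <->
  forall x, ((normc (u x))%:E <= y)%E.
Proof.
move=> nuT cu; rewrite Lnorm.unlock nuT; split => [/ess_supP H x|H]; last first.
  apply/ess_supP; apply: aeW => x /=.
  by rewrite ger0_norm ?normc_ge0//; exact: H.
rewrite leNgt; apply/negP => xy.
have [e e0 ey] : exists2 e : R, 0 < e & (y < (normc (u x) - e)%:E)%E.
  clear H; case: y xy => [y| |] //=.
    rewrite lte_fin => xy; exists ((normc (u x) - y) / 2); first by rewrite divr_gt0// subr_gt0.
    by rewrite lte_fin; lra.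
  by move=> _; exists 1 => //; exact: ltNyr.
have [A [mA A0 HA]] := cu x e e0.
have [N [mN N0 HN]] := H.
have : (nu A <= nu N)%E.
  apply: le_measure; rewrite ?inE// => z Az; apply: HN => /=.
  rewrite ger0_norm ?normc_ge0// => zy.
  have := lt_le_trans ey (le_trans _ zy); rewrite lee_fin => /(_ (HA z Az)).
  by rewrite ltxx.
by rewrite N0 leNgt A0.
Qed.

End supremum_norm.

Section norm_comparison.
Context {R : realType} (n : nat).
Local Notation T := (measurableTypeR R).
Local Notation C := R[i].
Local Notation leb := (@lebesgue_measure R).
Local Notation mu := (@lebesgue_tuple R n.+1).
Local Notation V := 'rV[R]_n.+1.
Local Notation w := (fun t : R => `|t| ^+ n).
Implicit Types (t : n.+1.-tuple T) (r s : R) (f : V -> C) (g : R -> C) (p y : \bar R).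

(** Characterizing the norm for [p = +oo] by its upper bounds reduces the comparisons below to
    pointwise ones. *)
Lemma Linf_tuple f y : csmooth f ->
  (Lp_norm +oo f <= y)%E <-> forall x, ((normc (f x))%:E <= y)%E.
Proof.
move=> sf; have [g [_ gR gI]] := csmooth_grad sf.
have cR := rexpansion_rcont gR; have cI := rexpansion_rcont gI.
have cube (t0 : n.+1.-tuple T) (r : R) : measurable [set t | forall i, `|tnth t i - tnth t0 i| < r].
  have -> : [set t : n.+1.-tuple T | forall i, `|tnth t i - tnth t0 i| < r] =
      \bigcap_(i in [set: 'I_n.+1])
        ((fun t : n.+1.-tuple T => `|tnth t i - tnth t0 i|) @^-1` `]-oo, r[%classic).
    apply/seteqP; split => t /= H i.
      by move=> _ /=; rewrite in_itv /=; exact: H.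
    by have := H i I; rewrite /= in_itv.
  apply: fin_bigcap_measurable => // i _; rewrite -[_ @^-1` _]setTI.
  have m : measurable_fun setT (fun t : n.+1.-tuple T => `|tnth t i - tnth t0 i|).
    apply: measurable_norm_comp; apply: measurable_funB => //; exact: measurable_tnth.
  by apply: m => //; exact: measurable_itv.
rewrite /Lp_norm; split => H.
  move=> x; pose t := [tuple x 0 i | i < n.+1] : n.+1.-tuple T.
  have -> : f x = on_tuple f t.
    by congr f; apply/rowP => j; rewrite mxE tnth_mktuple.
  move: (t); apply/(Linf_leP (nu := mu)); [| |exact: H].
    have := @lebesgue_tuple_cube R n.+1 (tzero n.+1) 1 ltr01 => /lt_le_trans; apply.
    by apply: le_measure => //; rewrite inE//; exact: cube.
  move=> t0 e e0; have e2 : 0 < e / 2 by rewrite divr_gt0.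
  have [r1 r10 H1] := cR (\row_j tnth t0 j) _ e2.
  have [r2 r20 H2] := cI (\row_j tnth t0 j) _ e2.
  have r0 : 0 < Num.min r1 r2 by rewrite lt_min r10.
  exists [set t | forall i, `|tnth t i - tnth t0 i| < Num.min r1 r2]; split.
  - exact: cube.
  - exact: (lebesgue_tuple_cube t0 r0).
  move=> z Hz; apply: le_trans (normcB_le (on_tuple f t0) (on_tuple f z)).
  rewrite lerD2l lerN2 (le_trans (normc_le_ReIm _))// ReB ImB.
  have -> : e = e / 2 + e / 2 by field.
  rewrite lerD// distrC; [apply: H1|apply: H2] => j.
    by rewrite !mxE; have := Hz j; rewrite lt_min => /andP[].
  by rewrite !mxE; have := Hz j; rewrite lt_min => /andP[].
rewrite Lnorm.unlock; case: ifPn => _.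
  apply/ess_supP; apply: aeW => t /=.
  by rewrite ger0_norm ?normc_ge0//; exact: H.
by apply: le_trans (H 0); rewrite lee_fin normc_ge0.
Qed.

Lemma Linf_line g y : ccontinuous g ->
  (wLp_norm +oo w g <= y)%E <-> forall s, ((normc (g s))%:E <= y)%E.
Proof.
move=> [c1 c2]; apply: Linf_leP.
  apply: (@lt_le_trans _ _ (leb `[0, 1])); last by apply: le_measure; rewrite ?inE.
  by rewrite lebesgue_measure_itv /= lte_fin ltr01 oppr0 adde0.
move=> s e e0; have e2 : 0 < e / 2 by rewrite divr_gt0.
have [r1 /= r10 H1] : \forall z \near s, `|complex.Re (g s) - complex.Re (g z)| < e / 2.
  by move: (c1 s) => /cvgrPdist_lt; exact.
have [r2 /= r20 H2] : \forall z \near s, `|complex.Im (g s) - complex.Im (g z)| < e / 2.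
  by move: (c2 s) => /cvgrPdist_lt; exact.
have r0 : 0 < Num.min r1 r2 by rewrite lt_min r10.
exists (ball s (Num.min r1 r2)); split.
- exact: measurable_ball.
- by rewrite lebesgue_measure_ball ?(ltW r0)// lte_fin pmulrn_lgt0.
move=> z sz; apply: le_trans (normcB_le (g s) (g z)).
rewrite lerD2l lerN2 (le_trans (normc_le_ReIm _))// ReB ImB.
have -> : e = e / 2 + e / 2 by field.
have [s1 s2] : ball s r1 z /\ ball s r2 z.
  by move: sz; rewrite /ball /= lt_min => /andP[].
by rewrite lerD// ltW//; [apply: H1|apply: H2].
Qed.

(** Dimension 1 is separate because [sphere_area] has the value 2 there by definition; the other
    dimensions follow from [Gamma_kappa]. *)
Lemma two_sphere_area : 2 / sphere_area R n.+1 = @sphere_cst R n.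
Proof.
rewrite /sphere_area /sphere_cst eqSS; have [->|n0] := eqVneq n 0%N.
  by rewrite kappa0 expr1 /=; field; rewrite gt_eqF// sqrtr_gt0 pi_gt0.
case: n n0 => // k _.
have pi0 := pi_gt0 R.
have -> : pi `^ (k.+2%:R / 2) = Num.sqrt pi ^+ k.+2 :> R.
  by rewrite mulrC powRrM powR12_sqrt ?ltW// powR_mulrn// sqrtr_ge0.
rewrite Gamma_kappa; have := kappa_gt0 (R := R) k.+1 => k0.
have : 0 < Num.sqrt pi ^+ k.+2 :> R by rewrite exprn_gt0// sqrtr_gt0.
move: (fine _) k0 (Num.sqrt pi ^+ k.+2) => a a0 b b0.
by field; rewrite !gt_eqF.
Qed.

Lemma sphere_cst_gt0 : 0 < @sphere_cst R n.
Proof.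
by rewrite !mulr_gt0 ?invr_gt0 ?gw_int_gt0 ?kappa_gt0.
Qed.

Lemma Lp_norm_ge0 p f : (0 <= Lp_norm p f)%E. Proof. exact: Lnorm_ge0. Qed.

Lemma wLp_norm_ge0 p (v : R -> R) g : (0 <= wLp_norm p v g)%E.
Proof. by case: p => [r| |] /=; [exact: poweR_ge0|exact: Lnorm_ge0..]. Qed.

Lemma poweR_mono (r : R) (x y : \bar R) : 0 <= r -> (0 <= x)%E -> (x <= y)%E ->
  (x `^ r <= y `^ r)%E.
Proof.
move=> r0 x0 xy; apply: gt0_ler_poweR => //; rewrite in_itv /= leey andbT//.
exact: le_trans xy.
Qed.

Lemma wLp_norm_fin (r : R) g : wLp_norm r%:E w g = (Jint n r g `^ r^-1)%E.
Proof. by []. Qed.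

Lemma csym_norm p f : (1 <= p)%E -> exp_type 1 n.+1 f ->
  (wLp_norm p w (csym f) <=
   ((2 / sphere_area R n.+1) `^ inv_exponent p)%:E * Lp_norm p f)%E.
Proof.
move=> p1 ef; have sf := exp_type_csmooth ef.
rewrite two_sphere_area; case: p p1 => [r| |] //.
  rewrite lee_fin => r1; rewrite wLp_norm_fin Lp_norm_fin.
  have r0 : 0 <= r^-1 by rewrite invr_ge0 (le_trans _ r1).
  rewrite -poweR_EFin -poweRM ?Iint_ge0 ?lee_fin ?(ltW sphere_cst_gt0)//.
  exact: (poweR_mono r0 (Jint_ge0 n r _) (Jint_csym r1 ef)).
move=> _; rewrite powRr0 mul1e.
apply/Linf_line; first exact: csym_ccontinuous.
have [/Linf_tuple H _] : (Lp_norm +oo f <= Lp_norm +oo f)%E /\ True by split.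
move=> s; case E : (Lp_norm +oo f) => [M| |]; rewrite ?leey//.
  rewrite lee_fin csym_cint; apply: normc_gw_cint.
    exact: csmooth_integrable.
  move=> y; rewrite normcM normc_real ger0_norm ?gw_ge0// mulrC ler_wpM2r ?gw_ge0//.
  by rewrite -lee_fin -E; exact: H.
by have := Lp_norm_ge0 +oo f; rewrite E.
Qed.

Lemma sym_cst (u : V -> R) ug r (k : R) : rexpansion u ug ->
  (forall t, t != tzero n.+1 -> u (r *: urow t) = k) -> sym u r = k.
Proof.
move=> uu uk; rewrite /sym; have -> : sint (fun=> 1) u r = \int[mu]_t (gw t * k).
  have [m1 _] := integrableP _ _ _ (sint_integrable r (@coef1 R n) uu).
  rewrite /sint /Rintegral; congr fine; apply: ae_eq_integral => //.
    apply/measurable_EFinP; apply: measurable_funM => //; exact: measurable_gw.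
  by apply: not_tzero_ae => t t0 _; rewrite uk// mul1r.
rewrite RintegralZr//; last exact: gw_Rintegrable.
by rewrite Rintegral_gw mulKf// gt_eqF// gw_int_gt0.
Qed.

(** Makes the radial lift injective, and lets [iter_bessel_csym], applied to the lift, compute the
    iterated Bessel operator on [g]. *)
Lemma csym_radial g : exp_type1_even 1 g -> csym (radial (n := n) g) = g.
Proof.
move=> eg; have [_ ev] := eg; apply/funext => r.
have rE t : t != tzero n.+1 -> radial g (r *: urow t) = g r.
  move=> t0; rewrite /radial enorm_urow//.
  by case: (ger0P r) => // _; rewrite ev.
have [h [_ hR hI]] := csmooth_grad (exp_type_csmooth (exp_type_radial n.+1 eg)).
rewrite /csym (sym_cst (k := complex.Re (g r)) hR); last by move=> t /rE <-.
rewrite (sym_cst (k := complex.Im (g r)) hI); last by move=> t /rE <-.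
by case: (g r).
Qed.

Lemma radial_norm p g : (1 <= p)%E -> exp_type1_even 1 g -> cmeasurable (g : T -> C) ->
  wLp_norm p w g =
   (((2 / sphere_area R n.+1) `^ inv_exponent p)%:E * Lp_norm p (radial (n := n) g))%E.
Proof.
move=> p1 eg mg; have er := exp_type_radial n.+1 eg.
have sf := exp_type_csmooth er.
rewrite two_sphere_area; case: p p1 => [r| |] //.
  rewrite lee_fin => r1; rewrite wLp_norm_fin Lp_norm_fin.
  rewrite -poweR_EFin -poweRM ?Iint_ge0 ?lee_fin ?(ltW sphere_cst_gt0)//.
  by rewrite -Jint_radial.
move=> _; rewrite powRr0 mul1e.
have cg : ccontinuous g by rewrite -(csym_radial eg); exact: csym_ccontinuous.
apply/eqP; rewrite eq_le; apply/andP; split.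
  apply/(Linf_line _ cg) => s.
  (* A vector with equal coordinates and Euclidean norm [|s|]: every value of [g] is a value of its
     lift. *)
  have -> : g s = radial (n := n) g (const_mx (`|s| / Num.sqrt n.+1%:R)).
    rewrite /radial /enorm.
    under eq_bigr do rewrite mxE.
    have -> : \sum_(j < n.+1) (`|s| / Num.sqrt n.+1%:R) ^+ 2 = `|s| ^+ 2.
      rewrite sumr_const card_ord -[LHS]mulr_natr exprMn exprVn sqr_sqrtr//.
      by rewrite divfK ?pnatr_eq0.
    rewrite sqrtr_sqr normr_id; have [_ ev] := eg.
    by case: (ger0P s) => // _; rewrite ev.
  by apply/(Linf_tuple _ sf): (const_mx _).
apply/(Linf_tuple _ sf) => x.
by apply/(Linf_line _ cg): (enorm x).
Qed.

End norm_comparison.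

Section sharp_constants.
Context {R : realType} (n : nat).
Local Notation T := (measurableTypeR R).
Local Notation C := R[i].
Local Notation mu := (@lebesgue_tuple R n.+1).
Local Notation V := 'rV[R]_n.+1.
Implicit Types (f : V -> C) (g : R -> C) (p : \bar R).

(** In [\bar R] the inverse of 0 is [+oo] and [0 * +oo = 0]. If [y = 0], the right side is therefore
    [+oo], except for [d = 0], when both sides vanish. *)
Lemma quotient_le (d c : R) (x y : \bar R) : 0 <= d -> 0 < c ->
  (0 <= x < +oo)%E -> (0 <= y < +oo)%E -> (y <= c%:E * x)%E ->
  (d%:E / x <= c%:E * (d%:E / y))%E.
Proof.
move=> d0 c0; case: x => [a| |]; [|by rewrite ltxx andbF|by move=> /andP[]].
case: y => [b| |]; [|by rewrite ltxx andbF|by move=> _ /andP[]].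
rewrite !lee_fin => /andP[a0 _] /andP[b0 _] bca.
have [->|d1] := eqVneq d 0; first by rewrite !mul0e mule0.
have dp : 0 < d by rewrite lt_neqAle eq_sym d1.
have top : (d%:E * +oo = +oo)%E by rewrite gt0_muley// lte_fin.
have [b1|b1] := eqVneq b 0.
  by rewrite [X in (_ * (_ / X))%E](_ : _ = 0%E) ?b1// inve0 top gt0_muley ?lte_fin// leey.
have bp : 0 < b by rewrite lt_neqAle eq_sym b1.
have ap : 0 < a by rewrite -(pmulr_rgt0 _ c0) (lt_le_trans bp).
rewrite !inver !gt_eqF// -!EFinM lee_fin mulrA ler_pdivrMr// mulrAC ler_pdivlMr//.
have -> : c * d * a = d * (c * a) by ring.
by rewrite ler_wpM2l.
Qed.

Lemma Lp_norm_shift p f (x : V) : (1 <= p)%E -> exp_type 1 n.+1 f ->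
  (Lp_norm p (fun y => f (x + y)%R) <= Lp_norm p f)%E.
Proof.
move=> p1 ef; have sf := exp_type_csmooth ef.
case: p p1 => [r| |] //.
  move=> _; rewrite !Lp_norm_fin; have -> : Iint r (fun y => f (x + y)) = Iint r f.
    rewrite /Iint -[RHS](@integral_isometry R n.+1 1 (fun i => x 0 i) _ (normr1 R)).
      apply: eq_integral => t _; congr (normc _ `^ _)%:E; congr f.
      by apply/rowP => j; rewrite !mxE tnth_mktuple mul1r addrC.
    apply/measurable_EFinP/measurable_powR_comp/cmeasurable_normc.
    exact: csmooth_cmeasurable.
  exact: lexx.
move=> _; have ss := exp_type_csmooth (exp_type_shift x ef).
by apply/(Linf_tuple _ ss) => y; apply/(Linf_tuple _ sf): (x + y).
Qed.

Lemma laplacian0 : laplacian (cst 0 : V -> C) = cst 0.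
Proof.
have D0 (v : V) : cderive v (cst 0 : V -> C) = cst 0.
  by apply/funext => x; rewrite /cderive /= !derive_cst.
by apply/funext => x; rewrite /laplacian big1// => j _; rewrite !D0.
Qed.

Lemma iter_laplacian0 N : iter N laplacian (cst 0 : V -> C) = cst 0.
Proof. by elim: N => //= N ->; exact: laplacian0. Qed.

Lemma csmooth0 : csmooth (cst 0 : V -> C).
Proof. by exists (fun=> 0), (fun _ _ => 0); split=> //; exact: expansion0. Qed.

Lemma csym_cst0 : csym (cst 0 : V -> C) = cst 0.
Proof.
apply/funext => r; rewrite csym_cint.
have -> : (fun y => (gw y)%:C * (cst 0 : V -> C) (r *: urow y)) = fun=> 0.
  by apply/funext => y; rewrite mulr0.
by rewrite /cint /Rintegral !integral0 /= mulr0.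
Qed.

End sharp_constants.

Theorem corollary3p11 (R : realType) (m N : nat) (p : \bar R)
    (hm : (0 < m)%N) (hp : (1 <= p)%E) :
  sharp_constant (exp_type 1 m `&` Lp_space p) (Lp_norm p)
    (iter N laplacian) 0 =
  (((2 / sphere_area R m) `^ inv_exponent p)%:E *
   sharp_constant
     (exp_type1_even 1%R `&` wLp_space p (fun t : R => (`|t| ^+ m.-1)%R))
     (wLp_norm p (fun t : R => (`|t| ^+ m.-1)%R))
     (iter N (bessel (m%:R / 2 - 1)%R)) 0%R)%E.
Proof.
case: m hm => // n _; rewrite /=.
set w := fun t : R => _; set c := (_ `^ _)%R.
have c0 : 0 < c by rewrite powR_gt0// two_sphere_area sphere_cst_gt0.
set BL := _ `&` _; set BR := _ `&` _.
have symB f : BL f -> BR (csym f).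
  move=> [ef [mf nf]]; split; first exact: csym_exp_type.
  split; first exact/ccontinuous_cmeasurable/csym_ccontinuous/exp_type_csmooth.
  apply: le_lt_trans (csym_norm hp ef) _.
  by rewrite lte_mul_pinfty ?lee_fin ?(ltW c0).
have radB g : BR g -> BL (radial (n := n) g).
  move=> [eg [mg ng]]; have er := exp_type_radial n.+1 eg; split => //.
  split; first exact/csmooth_cmeasurable/exp_type_csmooth.
  move: ng; rewrite (radial_norm n hp eg mg).
  have := Lp_norm_ge0 p (radial (n := n) g); case: (Lp_norm p _) => [a| |].
  - by move=> _ _; exact: ltry.
  - by rewrite gt0_muley ?lte_fin.
  - by [].
have symD f : exp_type 1 n.+1 f ->
    iter N (bessel (n.+1%:R / 2 - 1)) (csym f) 0 = iter N laplacian f 0.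
  by move=> /exp_type_csmooth; exact: iter_bessel_csym.
have nBL f : BL f -> (0 <= Lp_norm p f < +oo)%E.
  by move=> [_ [_ nf]]; rewrite Lp_norm_ge0.
have nBR g : BR g -> (0 <= wLp_norm p w g < +oo)%E.
  by move=> [_ [_ nf]]; rewrite wLp_norm_ge0.
rewrite /sharp_constant.
set SL := [set _ | _ in _]; set SR := [set _ | _ in _].
apply/eqP; rewrite eq_le; apply/andP; split; last first.
  (* Lower bound on the m-dimensional constant: each [g] is compared with its radial lift. *)
  rewrite -lee_pdivlMl//; apply: ge_ereal_sup => _ [g [Bg g0] <-].
  rewrite lee_pdivlMl//.
  have [eg [mg ng]] := Bg; have er := exp_type_radial n.+1 eg.
  apply: (@le_trans _ _ ((normc (iter N laplacian (radial (n := n) g) 0))%:E /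
     Lp_norm p (radial (n := n) g))%E); last first.
    apply: ereal_sup_ubound; exists (radial g) => //; split; first exact: radB.
    (* The lift is nonzero because its spherical mean is [g]. *)
    by move=> /= r0; apply: g0; rewrite -(csym_radial n eg) r0 csym_cst0.
  rewrite -symD// csym_radial// -lee_pdivlMl//.
  apply: quotient_le; rewrite ?normc_ge0 ?invr_gt0 ?nBR ?nBL//; first exact: radB.
  by rewrite lee_pdivlMl// (radial_norm n hp eg mg).
apply: ge_ereal_sup => _ [f [Bf f0] <-].
have [ef [mf nf]] := Bf.
have [x fx] : exists x, f x != 0.
  apply: contrapT => H; apply: f0; apply/funext => x; apply/eqP.
  by apply/negP => /negP fx; apply: H; exists x.
(* For some nonzero [f], such as odd ones, [csym f] is zero and does not compete in the
   one-dimensional supremum. *)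
have [z|z] := pselect (csym f = cst 0); last first.
  apply: (@le_trans _ _ (c%:E * ((normc (iter N (bessel (n.+1%:R / 2 - 1)) (csym f) 0))%:E /
      wLp_norm p w (csym f)))%E).
    rewrite symD//; apply: quotient_le; rewrite ?normc_ge0 ?nBL ?nBR//; first exact: symB.
    exact: csym_norm.
  rewrite lee_pmul2l//; apply: ereal_sup_ubound; exists (csym f) => //.
  by split => //; exact: symB.
(* The value at 0 depends on [f] only through [csym f], so here it is that of the zero function. *)
have -> : iter N laplacian f 0 = 0.
  rewrite -symD// z -(@csym_cst0 R n) iter_bessel_csym; last exact: csmooth0.
  by rewrite iter_laplacian0.
rewrite normc0 mul0e; apply: mule_ge0; first by rewrite lee_fin ltW.
(* The supremum of an empty set would be [-oo]. A nonzero competitor is the mean of this translate,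
   whose value at 0 is [f x]; its quotient bounds the supremum below by 0. *)
pose f' y := f (x + y).
have ef' : exp_type 1 n.+1 f' by exact: exp_type_shift.
have Bf' : BL f'.
  split => //; split; first exact/csmooth_cmeasurable/exp_type_csmooth.
  exact: le_lt_trans (Lp_norm_shift x hp ef) nf.
apply: (@le_trans _ _ ((normc (iter N (bessel (n.+1%:R / 2 - 1)) (csym f') 0))%:E /
      wLp_norm p w (csym f'))%E).
  by rewrite mule_ge0 ?lee_fin ?normc_ge0// inve_ge0 wLp_norm_ge0.
apply: ereal_sup_ubound; exists (csym f') => //; split; first exact: symB.
move=> /= /(congr1 (fun g => g 0)); rewrite csym0 /f' addr0.
by move/eqP; rewrite (negbTE fx).
Qed.
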